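(* Let $(\mathcal{B},\mathcal{L},\theta,\mathcal{I}_\alpha)$ be a generalized Boolean dynamical system, with associated inverse semigroup $S$, tight groupoid $\mathcal{G}_{tight}=\mathcal{G}_{tight}(S)$ and groupoid $\Gamma=\Gamma(\mathcal{B},\mathcal{L},\theta,\mathcal{I}_\alpha)$. Then $$C^*(\mathcal{B},\mathcal{L},\theta,\mathcal{I}_\alpha)\cong C^*(\Gamma)\cong C^*(\mathcal{G}_{tight}).$$
   Context: **Generalized Boolean dynamical systems.** A Boolean algebra $\mathcal{B}$ is a (not necessarily unital) relatively complemented distributive lattice with least element $\emptyset$ and operations $\cap,\cup,\setminus$; $A\subseteq B$ means $A\cap B=A$. An ideal is a non-empty subset closed under finite unions and under intersection with arbitrary elements of $\mathcal{B}$. An action is a map $\mathcal{B}\to\mathcal{B}$ preserving $\cap,\cup,\setminus$ and $\emptyset$. A generalized Boolean dynamical system $(\mathcal{B},\mathcal{L},\theta,\mathcal{I}_\alpha)$ consists of a Boolean algebra $\mathcal{B}$, a set $\mathcal{L}$, actions $\{\theta_\alpha\}_{\alpha\in\mathcal{L}}$ and ideals $\{\mathcal{I}_\alpha\}_{\alpha\in\mathcal{L}}$ with $\{A\in\mathcal{B}:A\subseteq\theta_\alpha(B)\text{ for some }B\in\mathcal{B}\}\subseteq\mathcal{I}_\alpha$ for all $\alpha\in\mathcal{L}$. **Its $C^*$-algebra.** For $A\in\mathcal{B}$, $\Delta_A=\{\alpha\in\mathcal{L}:\theta_\alpha(A)\ne\emptyset\}$; $A$ is regular ($A\in\mathcal{B}_{reg}$)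 if $0<|\Delta_B|<\infty$ for all $\emptyset\neq B\subseteq A$. $C^*(\mathcal{B},\mathcal{L},\theta,\mathcal{I}_\alpha)$ is the universal $C^*$-algebra generated by projections $\{p_A:A\in\mathcal{B}\}$ and partial isometries $\{s_{\alpha,B}:\alpha\in\mathcal{L},B\in\mathcal{I}_\alpha\}$ such that (i) $p_\emptyset=0$, $p_{A\cap A'}=p_Ap_{A'}$, $p_{A\cup A'}=p_A+p_{A'}-p_{A\cap A'}$; (ii) $p_As_{\alpha,B}=s_{\alpha,B}p_{\theta_\alpha(A)}$; (iii) $s_{\alpha,B}^*s_{\alpha',B'}=\delta_{\alpha,\alpha'}p_{B\cap B'}$; (iv) $p_A=\sum_{\alpha\in\Delta_A}s_{\alpha,\theta_\alpha(A)}s_{\alpha,\theta_\alpha(A)}^*$ for all $A\in\mathcal{B}_{reg}$. **Words.** $\mathcal{L}^*$: finite words over $\mathcal{L}$ (including the empty word $\emptyset$); $\mathcal{L}^\infty$: infinite words; $|\alpha|$: length; $\alpha_{i,j}=\alpha_i\cdots\alpha_j$ (empty if $j<i$). For $\alpha=\alpha_1\cdots\alpha_n$: $\theta_\alpha=\theta_{\alpha_n}\circ\cdots\circ\theta_{\alpha_1}$, $\theta_\emptyset=\mathrm{Id}$; $\mathcal{I}_\alpha=\{A\in\mathcal{B}:A\subseteq\theta_{\alpha_2\cdots\alpha_n}(B)\text{ for some }B\in\mathcal{I}_{\alpha_1}\}$ for $n\ge1$, $\mathcal{I}_\emptyset=\mathcal{B}$. $\mathcal{W}^*=\{\alpha\in\mathcal{L}^*:\mathcal{I}_\alpha\neq\{\emptyset\}\}$,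 $\mathcal{W}^\infty=\{\alpha\in\mathcal{L}^\infty:\alpha_{1,n}\in\mathcal{W}^*\ \forall n\geq1\}$, $\mathcal{W}^{\leq\infty}=\mathcal{W}^*\cup\mathcal{W}^\infty$. **Inverse semigroup.** $S=\{(\alpha,A,\beta):\alpha,\beta\in\mathcal{L}^*,\ \emptyset\neq A\in\mathcal{I}_\alpha\cap\mathcal{I}_\beta\}\cup\{0\}$, with $0$ absorbing and $(\alpha,A,\beta)(\gamma,B,\delta)$ equal to $(\alpha,A\cap B,\delta)$ if $\beta=\gamma$; $(\alpha\gamma',\theta_{\gamma'}(A)\cap B,\delta)$ if $\gamma=\beta\gamma'$; $(\alpha,A\cap\theta_{\beta'}(B),\delta\beta')$ if $\beta=\gamma\beta'$ (interpreted as $0$ when the middle entry is $\emptyset$); $0$ otherwise; $(\alpha,A,\beta)^*=(\beta,A,\alpha)$. Its idempotents form $E=E(S)=\{(\alpha,A,\alpha):\emptyset\neq A\in\mathcal{I}_\alpha\}\cup\{0\}$, ordered by $e\le f$ iff $ef=e$. **Tight spectrum.** A filter in a poset with least element is a non-empty, upward closed, downward directed subset not containing the least element. Each filter $\xi$ in $E$ has an associated word $\alpha\in\mathcal{W}^{\leq\infty}$ (the longest first entry of elements of $\xi$, or the infinite word of which all first entries of elements of $\xi$ are beginnings if their lengths are unbounded); write $\xi=\xi^\alpha$ and $\xi_n=\{A\in\mathcal{I}_{\alpha_{1,n}}:(\alpha_{1,n},A,\alpha_{1,n})\in\xi\}$; $\xi$ is determined by $\alpha$ and $\{\xi_n\}_n$.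 A finite $Z\subseteq\{y:y\le x\}$ is a cover for $x\in E$ if every $0\neq y\le x$ satisfies $yz\neq0$ for some $z\in Z$; $\xi$ is tight if $Z\cap\xi\neq\emptyset$ for each $x\in\xi$ and each finite cover $Z$ of $x$. $\mathsf{T}$ is the set of tight filters, with basis of open sets $V_{e:e_1,\dots,e_n}=\{\xi\in\mathsf{T}:e\in\xi,e_i\notin\xi\ \forall i\}$, $e,e_i\in E$, $n\ge0$. $\hat E_{tight}$ is the corresponding space of tight characters $\phi_\xi:E\to\{0,1\}$, $\phi_\xi(e)=1\iff e\in\xi$, with pointwise convergence topology. **The groupoid $\Gamma$.** For non-empty $\alpha\in\mathcal{L}^*$ and $\alpha\gamma\in\mathcal{W}^{\le\infty}$, $H_{[\alpha]\gamma}$ sends a tight filter $\xi$ with word $\alpha\gamma$ to the tight filter $\eta$ with word $\gamma$ and $\eta_n=\{B\in\mathcal{I}_{\gamma_{1,n}}:A\subseteq B\text{ for some }A\in\xi_{|\alpha|+n}\}$, $0\le n\le|\gamma|$; $H_{[\emptyset]\gamma}$ is the identity. $\Gamma=\{(\eta^{\alpha\gamma},|\alpha|-|\beta|,\xi^{\beta\gamma})\in\mathsf{T}\times\mathbb{Z}\times\mathsf{T}:H_{[\alpha]\gamma}(\eta)=H_{[\beta]\gamma}(\xi)\}$ with $(\eta,m,\xi)(\xi,n,\rho)=(\eta,m+n,\rho)$, $(\eta,m,\xi)^{-1}=(\xi,-m,\eta)$, and topology with basis the sets $\{(\eta^{\mu\gamma},|\mu|-|\nu|,\xi^{\nu\gamma})\in\Gamma:\xi\in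 V_{e:e_1,\dots,e_n},H_{[\mu]\gamma}(\eta)=H_{[\nu]\gamma}(\xi)\}$ for $(\mu,A,\nu)\in S$, $e,e_i\in E$. It is an étale groupoid. **The tight groupoid.** $D_e=\{\phi\in\hat E_{tight}:\phi(e)=1\}$; for $s\in S$, $\rho_s:D_{s^*s}\to D_{ss^*}$, $\rho_s(\phi)(e)=\phi(s^*es)$. On $\{(s,\phi):\phi\in D_{s^*s}\}$ put $(s,\phi)\sim(t,\psi)$ iff $\phi=\psi$ and $se=te$ for some $e\in E$ with $\phi\in D_e$. $\mathcal{G}_{tight}$ is the set of classes $[s,\phi]$ with product $[s,\rho_t(\psi)][t,\psi]=[st,\psi]$, inverse $[s,\phi]^{-1}=[s^*,\rho_s(\phi)]$, and topology with basis $\Theta(s,\mathcal{U})=\{[s,\phi]:\phi\in\mathcal{U}\}$, $s\in S$, $\mathcal{U}\subseteq D_{s^*s}$ open. $C^*(\cdot)$ of an étale groupoid is its groupoid $C^*$-algebra. *)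

(* Defs.v *)
From HB Require Import structures.
From mathcomp Require Import all_boot all_order all_algebra.
From mathcomp Require Import complex.
From mathcomp Require Import all_classical all_reals.
From mathcomp Require Import topology normedtype.

Set Implicit Arguments.
Unset Strict Implicit.
Unset Printing Implicit Defensive.

Import Order.TTheory GRing.Theory Num.Theory.
Import numFieldNormedType.Exports.

Local Open Scope classical_set_scope.
Local Open Scope ring_scope.

(* Not necessarily unital, so the product is not MathComp's ring product.
   The norm of a normed module over R[i] takes its values in R[i]. *)
HB.mixin Record isCStarAlgebra (R : realType) A
    & CompleteNormedModule R[i] A := {
  cmul : A -> A -> A;
  cadj : A -> A;
  cmulA : associative cmul;
  cmulDl : left_distributive cmul +%R;
  cmulDr : right_distributive cmul +%R;
  cmulZl : forall (k : R[i]) x y, cmul (k *: x) y = k *: cmul x y;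
  cmulZr : forall (k : R[i]) x y, cmul x (k *: y) = k *: cmul x y;
  cadjK : involutive cadj;
  cadjD : {morph cadj : x y / x + y};
  cadjZ : forall (k : R[i]) x, cadj (k *: x) = k^* *: cadj x;
  cadjM : forall x y, cadj (cmul x y) = cmul (cadj y) (cadj x);
  cnormM : forall x y, `|cmul x y| <= `|x| * `|y|;
  cnorm_adjM : forall x, `|cmul (cadj x) x| = `|x| ^+ 2
}.

#[short(type="cstarAlgType")]
HB.structure Definition CStarAlgebra (R : realType) :=
  {A of CompleteNormedModule R[i] A & isCStarAlgebra R A}.

Section CStarTheory.
Context {R : realType}.

Definition is_projection (A : cstarAlgType R) (p : A) : Prop :=
  cadj p = p /\ cmul p p = p.

Definition is_partial_isometry (A : cstarAlgType R) (s : A) : Prop :=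
  cmul (cmul s (cadj s)) s = s.

Record is_star_hom (A A' : cstarAlgType R) (h : A -> A') : Prop := StarHom {
  star_homD : {morph h : x y / x + y};
  star_homZ : forall (k : R[i]) x, h (k *: x) = k *: h x;
  star_homM : {morph h : x y / cmul x y};
  star_homV : {morph h : x / cadj x}
}.

Definition cstar_iso (A A' : cstarAlgType R) : Prop :=
  exists2 h : A -> A', is_star_hom h & bijective h.

Record is_cstar_subalgebra (A : cstarAlgType R) (X : set A) : Prop :=
  CStarSubalgebra {
  cstar_sub0 : X 0;
  cstar_subD : forall x y, X x -> X y -> X (x + y);
  cstar_subZ : forall (k : R[i]) x, X x -> X (k *: x);
  cstar_subM : forall x y, X x -> X y -> X (cmul x y);
  cstar_subV : forall x, X x -> X (cadj x);
  cstar_sub_closed : closed X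
}.

Definition cstar_generated_by (A : cstarAlgType R) (G : set A) : Prop :=
  forall X : set A, is_cstar_subalgebra X -> G `<=` X -> X = setT.

End CStarTheory.

(* [cbDistrLatticeType] is the type of relatively complemented distributive
   lattices with a least element; [Order.diff] is the relative complement. *)
Record gbds (d : Order.disp_t) (B : cbDistrLatticeType d) (L : choiceType) :=
  Gbds {
  act : L -> B -> B;
  act_meet : forall a A A', act a (Order.meet A A')
                            = Order.meet (act a A) (act a A');
  act_join : forall a A A', act a (Order.join A A')
                            = Order.join (act a A) (act a A');
  act_diff : forall a A A', act a (Order.diff A A')
                            = Order.diff (act a A) (act a A');
  act_bot : forall a, act a \bot%O = \bot%O;
  ideal : L -> set B;
  ideal_neq0 : forall a, ideal a !=set0;
  ideal_join : forall a A A', ideal a A -> ideal a A' ->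
                              ideal a (Order.join A A');
  ideal_meet : forall a A X, ideal a A -> ideal a (Order.meet A X);
  ideal_act : forall a A X, (A <= act a X)%O -> ideal a A
}.

Section Gbds.
Context {d : Order.disp_t} {B : cbDistrLatticeType d} {L : choiceType}.
Variable D : gbds B L.

Definition Delta (A : B) : set L := [set a | act D a A <> \bot%O].

Definition regular (A : B) : Prop :=
  forall X : B, X <> \bot%O -> (X <= A)%O ->
    finite_set (Delta X) /\ Delta X !=set0.

(* Only the values [s a X] with [X] in the ideal of [a] are meaningful. *)
Record gbds_rep {R : realType} (A : cstarAlgType R)
    (p : B -> A) (s : L -> B -> A) : Prop := GbdsRep {
  rep_proj : forall X, is_projection (p X);
  rep_isometry : forall a X, ideal D a X -> is_partial_isometry (s a X);
  rep_bot : p \bot%O = 0;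
  rep_meet : forall X Y, p (Order.meet X Y) = cmul (p X) (p Y);
  rep_join : forall X Y, p (Order.join X Y) = p X + p Y - p (Order.meet X Y);
  rep_comm : forall X a Y, ideal D a Y ->
    cmul (p X) (s a Y) = cmul (s a Y) (p (act D a X));
  rep_adj : forall a a' Y Y', ideal D a Y -> ideal D a' Y' ->
    cmul (cadj (s a Y)) (s a' Y')
    = if a == a' then p (Order.meet Y Y') else 0;
  rep_regular : forall X, regular X ->
    p X = \sum_(a \in Delta X)
            cmul (s a (act D a X)) (cadj (s a (act D a X)))
}.

Definition is_gbds_cstar {R : realType} (A : cstarAlgType R) : Prop :=
  exists (p : B -> A) (s : L -> B -> A),
    [/\ gbds_rep p s,
        cstar_generated_by
          (range p `|` [set x | exists a X, ideal D a X /\ x = s a X])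
      & forall (A' : cstarAlgType R) (q : B -> A') (t : L -> B -> A'),
          gbds_rep q t ->
          exists h : A -> A', [/\ is_star_hom h,
            forall X, h (p X) = q X
          & forall a X, ideal D a X -> h (s a X) = t a X]].

Definition actw (w : seq L) (A : B) : B := foldl (fun X a => act D a X) A w.

Definition idealw (w : seq L) : set B :=
  if w is a :: w' then [set A | exists2 X, ideal D a X & (A <= actw w' X)%O]
  else setT.

Inductive word := FinWord of seq L | InfWord of (nat -> L).

Definition le_wlen (n : nat) (w : word) : bool :=
  if w is FinWord u then (n <= size u)%N else true.

Definition wprefix (w : word) (n : nat) : seq L :=
  match w with FinWord u => take n u | InfWord u => mkseq u n end.

Definition wcat (u : seq L) (w : word) : word :=
  match w with
  | FinWord v => FinWord (u ++ v)
  | InfWord v => InfWord (fun n => nth (v (n - size u)%N) u n)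
  end.

(* Ambient type of S; [None] is the zero element. *)
Definition triple : Type := option (seq L * B * seq L).

Definition mk_triple (a : seq L) (A : B) (b : seq L) : triple :=
  if A == \bot%O then None else Some (a, A, b).

Definition S_set : set triple := fun x =>
  if x is Some (a, A, b) then [/\ A <> \bot%O, idealw a A & idealw b A]
  else True.

Definition smul (x y : triple) : triple :=
  match x, y with
  | Some (a, A, b), Some (c, C, e) =>
      if b == c then mk_triple a (Order.meet A C) e
      else if prefix b c then
        let c' := drop (size b) c in
        mk_triple (a ++ c') (Order.meet (actw c' A) C) e
      else if prefix c b then
        let b' := drop (size c) b in
        mk_triple a (Order.meet A (actw b' C)) (e ++ b')
      else None
  | _, _ => None
  end.

Definition sadj (x : triple) : triple :=
  if x is Some (a, A, b) then Some (b, A, a) else None.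

Definition E_set : set triple := fun x =>
  if x is Some (a, A, b) then [/\ a = b, A <> \bot%O & idealw a A] else True.

Definition E_le (e f : triple) : Prop := smul e f = e.

Record is_filter (xi : set triple) : Prop := IsFilter {
  filter_sub : xi `<=` E_set;
  filter_neq0 : xi !=set0;
  filter_up : forall e f, xi e -> E_set f -> E_le e f -> xi f;
  filter_down : forall e f, xi e -> xi f ->
    exists g, [/\ xi g, E_le g e & E_le g f];
  filter_zero : ~ xi None
}.

Definition is_cover (x : triple) (Z : set triple) : Prop :=
  [/\ finite_set Z,
      Z `<=` [set y | E_set y /\ E_le y x]
    & forall y, E_set y -> y <> None -> E_le y x ->
        exists2 z, Z z & smul y z <> None].

Definition tight_filter : set (set triple) := [set xi | is_filter xi /\
  forall x Z, xi x -> is_cover x Z -> Z `&` xi !=set0].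

Definition filter_word (xi : set triple) (w : word) : Prop :=
  match w with
  | FinWord u => (exists A, xi (Some (u, A, u))) /\
      forall v A, xi (Some (v, A, v)) -> (size v <= size u)%N
  | InfWord u =>
      (forall v A, xi (Some (v, A, v)) -> v = mkseq u (size v)) /\
      forall n, exists v A, xi (Some (v, A, v)) /\ (n <= size v)%N
  end.

(* xi_n, for a filter xi with word w and n <= |w| *)
Definition filter_at (xi : set triple) (w : word) (n : nat) : set B :=
  [set A | idealw (wprefix w n) A /\
           xi (Some (wprefix w n, A, wprefix w n))].

(* A filter is determined by its word w and its components, indexed by n <= |w|. *)
Definition filter_of (w : word) (xi_ : nat -> set B) : set triple :=
  [set e | exists n A, [/\ le_wlen n w, xi_ n A &
                           e = Some (wprefix w n, A, wprefix w n)]].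

Definition basic_open (e : triple) (es : seq triple) : set (set triple) :=
  [set xi | [/\ tight_filter xi, xi e & forall f, f \in es -> ~ xi f]].

Definition tight_char : set (triple -> bool) :=
  [set phi | exists2 xi, tight_filter xi & phi = (fun e => `[< xi e >])].

(* H_[u]w, for a filter xi with word uw *)
Definition shift (u : seq L) (w : word) (xi : set triple) : set triple :=
  if u is [::] then xi else
  filter_of w (fun n => [set X | idealw (wprefix w n) X /\
    exists2 A, filter_at xi (wcat u w) (size u + n) A & (A <= X)%O]).

End Gbds.

(* The arrows are the elements of [garr], a subset of the ambient type
   [gamb]; [gmul x y] is meaningful if [gsrc x = grng y].  [gbase] is a basis of
   the topology, each member of which is a set of arrows. *)
Record groupoid := Groupoid {
  gamb : Type;
  gobj : Type;
  garr : set gamb;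
  gsrc : gamb -> gobj;
  grng : gamb -> gobj;
  gmul : gamb -> gamb -> gamb;
  ginv : gamb -> gamb;
  gbase : set (set gamb)
}.

Definition garrow (G : groupoid) : Type := {x : gamb G | garr x}.

HB.instance Definition _ (G : groupoid) := gen_eqMixin (garrow G).
HB.instance Definition _ (G : groupoid) := gen_choiceMixin (garrow G).
HB.instance Definition _ (G : groupoid) :=
  @isSubBaseTopological.Build (garrow G) (set (garrow G))
    [set U | exists2 Z, @gbase G Z & U = [set x | Z (sval x)]] id.

Section GroupoidCStar.
Context {R : realType}.
Variable G : groupoid.

Definition bisection (U : set (garrow G)) : Prop :=
  [/\ open U,
      {in U &, injective (fun x : garrow G => gsrc (sval x))}
    & {in U &, injective (fun x : garrow G => grng (sval x))}].

(* C_c(U), extended by zero outside U *)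
Definition Cc_on (U : set (garrow G)) : set (garrow G -> R[i]) :=
  [set f | (forall x, U x -> {for x, continuous (f : garrow G -> R[i]^o)}) /\
           exists K, [/\ compact K, K `<=` U & forall x, ~ K x -> f x = 0]].

(* The linear span of the C_c(U), U an open bisection; it is C_c(G) if G is
   Hausdorff. *)
Definition Cc : set (garrow G -> R[i]) :=
  [set f | exists (n : nat) (g : 'I_n -> garrow G -> R[i]),
     (forall i, exists2 U, bisection U & Cc_on U (g i)) /\
     f = (fun x => \sum_(i < n) g i x)].

Definition convolution (f g : garrow G -> R[i]) : garrow G -> R[i] :=
  fun z => \sum_(xy \in [set xy : garrow G * garrow G |
      gsrc (sval xy.1) = grng (sval xy.2) /\
      gmul (sval xy.1) (sval xy.2) = sval z]) f xy.1 * g xy.2.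

(* The second case does not occur in a groupoid. *)
Definition arrow_inv (x : garrow G) : garrow G :=
  if pselect (garr (ginv (sval x))) is left h then exist _ _ h else x.

Definition involution (f : garrow G -> R[i]) : garrow G -> R[i] :=
  fun x => (f (arrow_inv x))^*.

(* Only the values on C_c(G) are meaningful. *)
Record Cc_rep (A : cstarAlgType R) (pi : (garrow G -> R[i]) -> A) : Prop :=
  CcRep {
  Cc_repD : forall f g, Cc f -> Cc g -> pi (fun x => f x + g x) = pi f + pi g;
  Cc_repZ : forall (k : R[i]) f, Cc f -> pi (fun x => k * f x) = k *: pi f;
  Cc_repM : forall f g, Cc f -> Cc g ->
    pi (convolution f g) = cmul (pi f) (pi g);
  Cc_repV : forall f, Cc f -> pi (involution f) = cadj (pi f)
}.

(* A is the completion of C_c(G) in the universal C*-norm. *)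
Definition is_groupoid_cstar (A : cstarAlgType R) : Prop :=
  exists j : (garrow G -> R[i]) -> A,
    [/\ Cc_rep j,
        dense (j @` Cc)
      & forall f, Cc f ->
          isLub [set r | exists (A' : cstarAlgType R)
                           (pi : (garrow G -> R[i]) -> A'),
                           Cc_rep pi /\ r = `|pi f|]
                `|j f|].

End GroupoidCStar.

Section TwoGroupoids.
Context {d : Order.disp_t} {B : cbDistrLatticeType d} {L : choiceType}.
Variable D : gbds B L.
Local Notation triple := (@triple d B L).

Definition Gamma_arr : set (set triple * int * set triple) :=
  [set x | exists (eta xi : set triple) (u v : seq L) (w : word),
     [/\ tight_filter D eta, filter_word eta (wcat u w),
         tight_filter D xi, filter_word xi (wcat v w)
       & shift D u w eta = shift D v w xi /\
         x = (eta, (size u)%:Z - (size v)%:Z, xi)]].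

Definition Gamma_base : set (set (set triple * int * set triple)) :=
  [set Z | exists (u v : seq L) (A : B) (e : triple) (es : seq triple),
     [/\ S_set D (Some (u, A, v)), E_set D e,
         forall f, f \in es -> E_set D f
       & Z = [set x | exists (eta xi : set triple) (w : word),
           [/\ x = (eta, (size u)%:Z - (size v)%:Z, xi), Gamma_arr x,
               filter_word eta (wcat u w), filter_word xi (wcat v w)
             & basic_open D e es xi /\
               shift D u w eta = shift D v w xi]]]].

Definition Gamma : groupoid := {|
  garr := Gamma_arr;
  gsrc := fun x => x.2;
  grng := fun x => x.1.1;
  gmul := fun x y => (x.1.1, x.1.2 + y.1.2, y.2);
  ginv := fun x => (x.2, - x.1.2, x.1.1);
  gbase := Gamma_base
|}.

(* A character of E is extended by [false] to the ambient type of S. *)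
Definition rho (s : triple) (phi : triple -> bool) : triple -> bool :=
  fun e => `[< E_set D e >] && phi (smul D (sadj s) (smul D e s)).

Definition germ_dom : set (triple * (triple -> bool)) :=
  [set sp | [/\ S_set D sp.1, tight_char D sp.2
              & sp.2 (smul D (sadj sp.1) sp.1)]].

(* The class [s, phi], as a set of pairs; it is empty off [germ_dom]. *)
Definition germ (s : triple) (phi : triple -> bool) :
    set (triple * (triple -> bool)) :=
  [set tp | [/\ germ_dom tp, phi = tp.2 & exists e,
               [/\ E_set D e, phi e & smul D s e = smul D tp.1 e]]].

Definition Gtight_base : set (set (set (triple * (triple -> bool)))) :=
  [set Z | exists (s : triple) (O : set {ptws triple -> bool}),
     [/\ S_set D s, open O,
         O `&` tight_char D `<=` [set phi | phi (smul D (sadj s) s)]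
       & Z = [set germ s phi | phi in O `&` tight_char D]]].

(* Operations on classes are defined elementwise.  The unit space consists of
   the characters, here given as singletons. *)
Definition Gtight : groupoid := {|
  garr := [set germ sp.1 sp.2 | sp in germ_dom];
  gsrc := fun X => [set sp.2 | sp in X];
  grng := fun X => [set rho sp.1 sp.2 | sp in X];
  gmul := fun X Y => [set x | exists s t psi,
    [/\ X (s, rho t psi), Y (t, psi) & germ (smul D s t) psi x]];
  ginv := fun X => [set x | exists s phi,
    X (s, phi) /\ germ (sadj s) (rho s phi) x];
  gbase := Gtight_base
|}.

End TwoGroupoids.

(* Main.v *)
Require Import Defs.
From HB Require Import structures.
From mathcomp Require Import all_boot all_order all_algebra.
From mathcomp Require Import complex.
From mathcomp Require Import all_classical all_reals.
From mathcomp Require Import topology normedtype realfun.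
From mathcomp Require Import finmap.
From mathcomp Require Import ring lra zify.

Set Implicit Arguments.
Unset Strict Implicit.
Unset Printing Implicit Defensive.

Import Order.CBDistrLatticeTheory Order.TTheory GRing.Theory Num.Theory.
Import numFieldNormedType.Exports.

Local Open Scope classical_set_scope.
Local Open Scope ring_scope.

(* Write a representation of the Boolean dynamical system as a representation
   T of the inverse semigroup S on a C*-algebra: T sends (a, A, b) to
   s_a p_A s_b^*, and relation (iv) makes T respect finite covers of
   idempotents.  Both groupoids are groupoids of germs of S acting on tight
   filters: in an arrow of Gamma the common tail of the two words, cut at a
   sufficiently long prefix, determines an element of S, and the germ of an
   element of S is determined by its length difference and by the image of the
   filter.

   For a groupoid of germs G, the functions of C_c(G) supported in a compact
   slice are uniform limits of linear combinations of the indicators of the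
   basic slices of the elements of S.  If a linear combination f of indicators
   is supported in a slice, then |T(f)|^2 = |T(f^* f)| and f^* f is a
   combination of commuting idempotents with values in [0, C^2], which bounds
   |T(f)| by the supremum C of |f|.  Hence T extends to C_c(G); conversely the
   indicators of basic slices turn a representation of C_c(G) into one of the
   Boolean dynamical system.  The two correspondences are mutually inverse, so
   the universal C*-algebras agree.

   The universal C*-algebra itself consists of the bounded families of elements,
   indexed by all representations, that are uniform limits of the families
   given by star-polynomials in the generators. *)

(** * Norms in C*-algebras *)

(** The decisive norm estimates use no spectral theory. They come from one identity: if commuting
    self-adjoint a and h satisfy a^2 + h^2 = 2 C h, that is a^2 + (C - h)^2 = C^2, then |a| <= C.
    For a function with values in [0, C] such an h is obtained by a pointwise square root; for a
    small self-adjoint element it is found by a fixed point iteration, which gives the contractivity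
    of star-homomorphisms. The obstacle in passing from S to functions is that different
    combinations of elements of S may define the same function. That T depends only on the function
    rests on meets in S: two elements that agree below some non-zero idempotent agree on the
    intersection of their domains. Hence slices meet in slices, and the question reduces to
    idempotents, where covers decide it. The two groupoids are never compared with each other. Each
    is matched with the axioms of [model], and any groupoid satisfying them has the algebra of the
    dynamical system as its C*-algebra. No continuity of a representation of C_c(G) is assumed:
    boundedness on a slice is automatic. *)

Section RealNorm.
Context {R : realType}.

(** Norms of modules over [R[i]] are complex numbers; they are moved to [R], where [lra] and [nra]
    apply. *)
Definition nrm (V : normedZmodType R[i]) (x : V) : R := complex.Re `|x|.

Lemma nrmE (V : normedZmodType R[i]) (x : V) : `|x| = (real_complex R (nrm x)).
Proof. by rewrite /nrm RRe_real// normr_real. Qed.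

Lemma nrm_ge0 (V : normedZmodType R[i]) (x : V) : 0 <= nrm x.
Proof. by rewrite -lecR -nrmE normr_ge0. Qed.

Lemma nrmD (V : normedZmodType R[i]) (x y : V) : nrm (x + y) <= nrm x + nrm y.
Proof. by rewrite -lecR rmorphD/= -!nrmE ler_normD. Qed.

Lemma nrmN (V : normedZmodType R[i]) (x : V) : nrm (- x) = nrm x.
Proof. by rewrite /nrm normrN. Qed.

Lemma nrm0 (V : normedZmodType R[i]) : nrm (0 : V) = 0.
Proof. by rewrite /nrm normr0. Qed.

Lemma nrm_distrC (V : normedZmodType R[i]) (x y : V) : nrm (x - y) = nrm (y - x).
Proof. by rewrite -nrmN opprB. Qed.

Lemma nrmB (V : normedZmodType R[i]) (x y : V) : nrm (x - y) <= nrm x + nrm y.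
Proof. by rewrite -[nrm y]nrmN nrmD. Qed.

Lemma nrm_trans (V : normedZmodType R[i]) (y x z : V) :
  nrm (x - z) <= nrm (x - y) + nrm (y - z).
Proof. by rewrite -{1}(subrK y x) -addrA nrmD. Qed.

Lemma nrm_eq0 (V : normedZmodType R[i]) (x : V) : nrm x = 0 -> x = 0.
Proof. by move=> h; apply: normr0_eq0; rewrite nrmE h. Qed.

Lemma nrm_small (V : normedZmodType R[i]) (x : V) :
  (forall e, 0 < e -> nrm x <= e) -> x = 0.
Proof.
by move=> h; apply: nrm_eq0; apply/eqP; rewrite eq_le nrm_ge0 andbT;
  apply/ler_addgt0Pl => e e0; rewrite addr0 h.
Qed.

Lemma nrm_sum (V : normedZmodType R[i]) (I : Type) (s : seq I) (F : I -> V) :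
  nrm (\sum_(i <- s) F i) <= \sum_(i <- s) nrm (F i).
Proof.
elim: s => [|i s IH]; first by rewrite !big_nil nrm0.
by rewrite !big_cons (le_trans (nrmD _ _))// lerD2l.
Qed.

Lemma nrmZ (V : normedModType R[i]) (k : R[i]) (x : V) :
  nrm (k *: x) = nrm (k : R[i]) * nrm x.
Proof. by apply: complexI; rewrite rmorphM/= -!nrmE normrZ. Qed.

Lemma nrmMc (k x : R[i]) : nrm (k * x) = nrm k * nrm x.
Proof. by apply: complexI; rewrite rmorphM/= -!nrmE normrM. Qed.

Lemma nrm_real (r : R) : nrm (real_complex R r) = `|r|.
Proof. by apply: complexI; rewrite -nrmE normc_def /= expr0n addr0 sqrtr_sqr. Qed.

Lemma nrmJ (x : R[i]) : nrm x^* = nrm x.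
Proof. by rewrite /nrm norm_conjC. Qed.

Lemma sqr_nrm (x : R[i]) : real_complex R (nrm x ^+ 2) = x^* * x.
Proof. by rewrite rmorphXn/= -nrmE normCK mulrC. Qed.

Lemma nrm_ge_Re (x : R[i]) : `|complex.Re x| <= nrm x.
Proof. by rewrite -lecR -nrmE normc_ge_Re. Qed.

Lemma invn_lt (e : R) : 0 < e -> exists n : nat, n.+1%:R^-1 < e.
Proof.
move=> e0; exists (Num.truncn e^-1).+1.
rewrite invf_plt ?posrE//.
by rewrite (lt_trans (Num.Theory.truncnS_gt _))// ltr_nat.
Qed.

Lemma le_invn (m n : nat) : (m <= n)%N -> n.+1%:R^-1 <= m.+1%:R^-1 :> R.
Proof. by move=> mn; rewrite lef_pV2 ?posrE// ler_nat. Qed.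

Lemma lt0_complex (e : R[i]) : 0 < e -> e = real_complex R (complex.Re e) /\ 0 < complex.Re e.
Proof.
move=> e0; have /RRe_real ee : e \is Num.real by apply: gtr0_real.
by split => //; rewrite -ltcR ee.
Qed.

Lemma ball_nrm (V : normedModType R[i]) (x y : V) (e : R[i]) :
  0 < e -> ball x e y <-> nrm (x - y) < complex.Re e.
Proof.
move=> /lt0_complex[ee _]; rewrite -ball_normE /ball_/= nrmE ee ltcR.
by rewrite -ee.
Qed.

Lemma ball_nrmE (V : normedModType R[i]) (x y : V) (e : R) :
  0 < e -> ball x (real_complex R e) y <-> nrm (x - y) < e.
Proof. by move=> e0; rewrite ball_nrm ?ltcR. Qed.

Lemma closed_nrm (V : normedModType R[i]) (X : set V) (x : V) : closed X ->
  (forall e, 0 < e -> exists2 y, X y & nrm (x - y) <= e) -> X x.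
Proof.
move=> cX h; apply: cX => B /nbhs_ballP[e /= e0 eB].
have [ee e1] := lt0_complex e0.
have [y Xy xy] := h (complex.Re e / 2) ltac:(lra).
exists y; split => //; apply: eB; apply/ball_nrm => //.
by apply: le_lt_trans xy _; lra.
Qed.

Lemma nrm_closed (V : normedModType R[i]) (X : set V) :
  (forall x, (forall e, 0 < e -> exists2 y, X y & nrm (x - y) <= e) -> X x) ->
  closed X.
Proof.
move=> h x cx; apply: h => e e0.
have [y [Xy bxy]] := cx _ (nbhsx_ballx x (real_complex R e) ltac:(by rewrite ltcR)).
by exists y => //; apply/ltW/ball_nrmE.
Qed.

Lemma dense_nrm (V : normedModType R[i]) (X : set V) : dense X <->
  forall x e, 0 < e -> exists2 y, X y & nrm (x - y) <= e.
Proof.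
split=> [dX x e e0|h O [x Ox] oO].
  have e0' : (0 : R[i]) < real_complex R e by rewrite ltcR.
  have [|y [/interior_subset /ball_nrmE xy Xy]] :=
    dX (interior (ball x (real_complex R e))) _ (@open_interior _ _).
    by exists x; exact: nbhsx_ballx.
  by exists y => //; exact/ltW/xy.
have /nbhs_ballP[e /= e0 eO] : nbhs x O by exact: open_nbhs_nbhs.
have [ee e1] := lt0_complex e0.
have [y Xy xy] := h x (complex.Re e / 2) ltac:(lra).
exists y; split => //; apply: eO; apply/ball_nrm => //.
by apply: le_lt_trans xy _; lra.
Qed.

Lemma cauchy_nrm (V : completeNormedModType R[i]) (u : nat -> V) :
  (forall e, 0 < e -> exists N : nat, forall m n : nat, (N <= m)%N -> (N <= n)%N ->
     nrm (u m - u n) <= e) ->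
  exists a, forall e, 0 < e -> exists N : nat, forall n : nat, (N <= n)%N ->
     nrm (a - u n) <= e.
Proof.
move=> cu.
have cF : cauchy (u @ \oo).
  apply: cauchy_exP => e e0.
  have [ee e1] := lt0_complex e0.
  have [N hN] := cu (complex.Re e / 2) ltac:(lra).
  exists (u N); exists N => // n /= Nn.
  apply/ball_nrm => //; apply: le_lt_trans (hN _ _ (leqnn N) Nn) _; lra.
have /cvg_ex[a ua] : cvg (u @ \oo) by exact: cauchy_cvg.
exists a => e e0.
have e0' : (0 : R[i]) < real_complex R e by rewrite ltcR.
have [N _ hN] := ua _ (nbhsx_ballx a _ e0').
by exists N => n Nn; apply/ltW/ball_nrmE => //; exact: hN.
Qed.

End RealNorm.

(** * Algebra and norm identities in a C*-algebra *)

Section CStarBasics.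
Context {R : realType}.
Implicit Types A : cstarAlgType R.

Lemma cmul0r A (x : A) : cmul 0 x = 0.
Proof. by apply: (addIr (cmul 0 x)); rewrite -cmulDl !add0r. Qed.

Lemma cmulr0 A (x : A) : cmul x 0 = 0.
Proof. by apply: (addIr (cmul x 0)); rewrite -cmulDr !add0r. Qed.

Lemma cmulNl A (x y : A) : cmul (- x) y = - cmul x y.
Proof. by apply: (addrI (cmul x y)); rewrite -cmulDl !subrr cmul0r. Qed.

Lemma cmulNr A (x y : A) : cmul x (- y) = - cmul x y.
Proof. by apply: (addrI (cmul x y)); rewrite -cmulDr !subrr cmulr0. Qed.

Lemma cmulBl A (x y z : A) : cmul (x - y) z = cmul x z - cmul y z.
Proof. by rewrite cmulDl cmulNl. Qed.

Lemma cmulBr A (x y z : A) : cmul z (x - y) = cmul z x - cmul z y.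
Proof. by rewrite cmulDr cmulNr. Qed.

Lemma cadj0 A : cadj (0 : A) = 0.
Proof. by apply: (addIr (cadj 0)); rewrite -cadjD !add0r. Qed.

Lemma cadjN A (x : A) : cadj (- x) = - cadj x.
Proof. by apply: (addrI (cadj x)); rewrite -cadjD !subrr cadj0. Qed.

Lemma cadjB A (x y : A) : cadj (x - y) = cadj x - cadj y.
Proof. by rewrite cadjD cadjN. Qed.

Lemma cadj_sum A (I : Type) (s : seq I) (F : I -> A) :
  cadj (\sum_(i <- s) F i) = \sum_(i <- s) cadj (F i).
Proof. exact: (big_morph _ (@cadjD _ A) (@cadj0 A)). Qed.

Lemma cmul_suml A (I : Type) (s : seq I) (F : I -> A) x :
  cmul (\sum_(i <- s) F i) x = \sum_(i <- s) cmul (F i) x.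
Proof.
exact: (big_morph (fun y => cmul y x) (fun y z => cmulDl y z x) (cmul0r x)).
Qed.

Lemma cmul_sumr A (I : Type) (s : seq I) (F : I -> A) x :
  cmul x (\sum_(i <- s) F i) = \sum_(i <- s) cmul x (F i).
Proof. exact: (big_morph (cmul x) (cmulDr x) (cmulr0 x)). Qed.

Lemma nrmM A (x y : A) : nrm (cmul x y) <= nrm x * nrm y.
Proof. by rewrite -lecR rmorphM/= -!nrmE cnormM. Qed.

Lemma nrm_adjM A (x : A) : nrm (cmul (cadj x) x) = nrm x ^+ 2.
Proof. by apply: complexI; rewrite rmorphXn/= -!nrmE cnorm_adjM. Qed.

Lemma nrm_adj A (x : A) : nrm (cadj x) = nrm x.
Proof.
suff h (y : A) : nrm y <= nrm (cadj y).
  by apply/eqP; rewrite eq_le h -{2}(cadjK x) h.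
have [->|y0] := eqVneq (nrm y) 0; first exact: nrm_ge0.
have y1 : 0 < nrm y by rewrite lt_def y0 nrm_ge0.
by rewrite -(ler_pM2r y1) -expr2 -nrm_adjM nrmM.
Qed.

Lemma nrm_selfadj A (x : A) : cadj x = x -> nrm (cmul x x) = nrm x ^+ 2.
Proof. by move=> xx; rewrite -nrm_adjM xx. Qed.

Lemma nrm_proj A (p : A) : is_projection p -> nrm p <= 1.
Proof.
move=> [p1 p2]; have := nrm_selfadj p1; rewrite p2 => h.
have := nrm_ge0 p => h0; nra.
Qed.

(* With [w = a + i (C - h)] in the unitization, [w] is normal and
   [w^* w = C ^ 2]; hence [|a| = |w + w^*| / 2 <= C]. *)
Lemma nrm_circle A (a h : A) (C : R) : 0 <= C ->
  cadj a = a -> cadj h = h -> cmul a h = cmul h a ->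
  cmul a a + cmul h h = real_complex R (2 * C) *: h -> nrm a <= C.
Proof.
move=> C0 aa hh ah E.
set c : R[i] := real_complex R C.
have cJ : c^* = c by apply/CrealP; rewrite /c complex_real.
(* The unitization is not formed: [w e v] is the product of a + e (C - h) with an element v of A.
   The conditions on e in [nw] say that e is i or -i. *)
pose w e v : A := cmul a v + (e *: (c *: v - cmul h v)).
have nw e : e * e^* = 1 -> e^* = - e -> forall v : A, nrm (w e v) = C * nrm v.
  move=> e1 e2 v.
  apply/eqP; rewrite -(@eqrXn2 _ 2)// ?mulr_ge0 ?nrm_ge0//; apply/eqP.
  rewrite -nrm_adjM.
  have -> : cmul (cadj (w e v)) (w e v) = (c ^+ 2) *: cmul (cadj v) v.
    rewrite /w; set p := cmul a v; set b := c *: v - cmul h v.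
    have bJ : cadj b = c *: cadj v - cmul (cadj v) h.
      by rewrite cadjB cadjZ cadjM hh cJ.
    have pJ : cadj p = cmul (cadj v) a by rewrite cadjM aa.
    have pb : cmul (cadj p) b = cmul (cadj b) p.
      rewrite bJ pJ /b /p cmulBr cmulBl cmulZr cmulZl !cmulA; congr (_ - _).
      by rewrite -!(cmulA (cadj v)) ah.
    rewrite cadjD cadjZ e2 cmulDl !cmulDr !(cmulZl, cmulZr) pb !scaleNr addrA addrK scalerA.
    have -> : e * e = -1 by rewrite -[RHS]opprK -e1 e2 mulrN !opprK.
    rewrite scaleN1r opprK pJ bJ /p /b cmulBr !cmulBl !(cmulZl, cmulZr) -cmulA.
    rewrite (cmulA a) -{1}(addrK (cmul h h) (cmul a a)) E cmulBl cmulBr.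
    rewrite cmulZl cmulZr scalerA -expr2 -!cmulA.
    set X := cmul (cadj v) (cmul h v).
    have -> : real_complex R (2 * C) *: X = c *: X + c *: X.
      by rewrite mulr_natl mulr2n rmorphD scalerDl.
    rewrite opprB [_ + (_ - c *: X)]addrC !addrA.
    by rewrite subrK addrK addrAC subrr add0r.
  by rewrite nrmZ nrm_adjM -rmorphXn/= nrm_real ger0_norm ?exprn_ge0// exprMn.
have ha v : nrm (cmul a v) <= C * nrm v.
  have i1 : ('i : R[i]) * 'i^* = 1 by rewrite conjCi mulrN -expr2 sqrCi opprK.
  have n1 := nw 'i i1 (conjCi _) v.
  have n2 : nrm (w (- 'i) v) = C * nrm v.
    by apply: nw; rewrite rmorphN/= ?conjCi// mulrNN -conjCi.
  have := nrmD (w 'i v) (w (- 'i) v); rewrite n1 n2.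
  have -> : w 'i v + w (- 'i) v = real_complex R 2 *: cmul a v.
    by rewrite /w addrACA scaleNr subrr addr0 (_ : 2 = 1 + 1)// rmorphD scalerDl scale1r.
  rewrite nrmZ nrm_real ger0_norm//; lra.
(* With v = a, the bound |a v| <= C |v| becomes |a|^2 <= C |a|. *)
have := ha a; rewrite nrm_selfadj// => h1.
have := nrm_ge0 a => h0; nra.
Qed.

End CStarBasics.

(** * Contractivity of star-homomorphisms *)

Section Contraction.
Context {R : realType}.

Lemma geo_small (e : R) : 0 < e -> exists n : nat, 2^-1 ^+ n <= e.
Proof.
move=> e0; have [n ne] := invn_lt e0; exists n.
apply: le_trans (ltW ne); rewrite exprVn lef_pV2 ?posrE ?exprn_gt0//.
by rewrite -natrX ler_nat ltn_expl.
Qed.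

(** The equation is the fixed point equation y = (x^2 + y^2) / 2, with formal solution 1 - sqrt (1 -
    x^2). Since |x| <= 1/2, the iterates of [F] from 0 stay in the ball of radius 1/4, where [F]
    contracts distances at least by the factor 1/2. Self-adjointness and commutation with x pass
    from the iterates to the limit. *)
Lemma solve_circle (A : cstarAlgType R) (x : A) : cadj x = x -> nrm x <= 2^-1 ->
  exists y, [/\ cadj y = y, cmul x y = cmul y x &
    cmul x x + cmul y y = real_complex R (2 * 1) *: y].
Proof.
move=> xx nx.
set k := real_complex R 2^-1.
have nk : nrm (k : R[i]) = 2^-1 by rewrite nrm_real ger0_norm// invr_ge0.
have kJ : k^* = k by apply/CrealP; rewrite /k complex_real.
pose F y : A := k *: (cmul x x + cmul y y).
pose u n := iter n F 0.
have uS n : u n.+1 = k *: (cmul x x + cmul (u n) (u n)) by [].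
have usa n : cadj (u n) = u n.
  by elim: n => [|n IH]; rewrite ?cadj0// uS cadjZ cadjD !cadjM IH xx kJ.
have ux n : cmul x (u n) = cmul (u n) x.
  elim: n => [|n IH]; first by rewrite cmulr0 cmul0r.
  rewrite uS cmulZr cmulZl cmulDl cmulDr; congr (_ *: (_ + _)); rewrite ?cmulA//.
  by rewrite IH -!cmulA IH.
have un n : nrm (u n) <= 4^-1.
  elim: n => [|n IH]; first by rewrite nrm0 invr_ge0.
  rewrite uS nrmZ nk.
  have h1 := nrmD (cmul x x) (cmul (u n) (u n)).
  have h2 := nrmM x x; have h3 := nrmM (u n) (u n).
  have := nrm_ge0 x; have := nrm_ge0 (u n); nra.
have uc N m n : (N <= m)%N -> (N <= n)%N -> nrm (u m - u n) <= 2^-1 ^+ N.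
  elim: N m n => [|N IH] m n.
    by move=> _ _; rewrite expr0; have := nrmB (u m) (u n);
      have := un m; have := un n; lra.
  case: m => // m; case: n => // n Nm Nn.
  have -> : u m.+1 - u n.+1 = k *: (cmul (u m) (u m - u n) + cmul (u m - u n) (u n)).
    rewrite !uS -scalerBr cmulBl cmulBr; congr (_ *: _).
    by rewrite opprD addrACA subrr add0r addrA subrK.
  rewrite nrmZ nk exprS.
  have h1 := nrmD (cmul (u m) (u m - u n)) (cmul (u m - u n) (u n)).
  have h2 := nrmM (u m) (u m - u n); have h3 := nrmM (u m - u n) (u n).
  have := IH m n Nm Nn; have := un m; have := un n.
  have := nrm_ge0 (u m - u n); have := nrm_ge0 (u n); have := nrm_ge0 (u m).
  nra.
have [y hy] : exists a, forall e, 0 < e -> exists N : nat, forall n : nat, (N <= n)%N ->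
     nrm (a - u n) <= e.
  apply: cauchy_nrm => e /geo_small[N hN]; exists N => m n Nm Nn.
  exact: le_trans (uc _ _ _ Nm Nn) hN.
exists y; split.
- apply/eqP; rewrite -subr_eq0; apply/eqP/nrm_small => e e0.
  have [N hN] := hy (e / 2) ltac:(lra).
  have -> : cadj y - y = cadj (y - u N) - (y - u N).
    by rewrite cadjB usa opprB addrA subrK.
  have := nrmB (cadj (y - u N)) (y - u N); rewrite nrm_adj.
  have := hN N (leqnn _); lra.
- apply/eqP; rewrite -subr_eq0; apply/eqP/nrm_small => e e0.
  have [N hN] := hy e e0.
  have -> : cmul x y - cmul y x = cmul x (y - u N) - cmul (y - u N) x.
    by rewrite cmulBl cmulBr ux opprB addrA subrK.
  have h1 := nrmB (cmul x (y - u N)) (cmul (y - u N) x).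
  have h2 := nrmM (y - u N) x; have h3 := nrmM x (y - u N).
  have := hN N (leqnn _); have := nrm_ge0 (y - u N); have := nrm_ge0 x; nra.
- rewrite mulr1; apply/eqP; rewrite -subr_eq0; apply/eqP/nrm_small => e e0.
  have [N hN] := hy (e / 4) ltac:(lra).
  have k2 : real_complex R 2 *: u N.+1 = cmul x x + cmul (u N) (u N).
    have kk : real_complex R 2 * k = 1.
      by rewrite /k; apply/eqP; rewrite eq_complex/= !(mulr0, mul0r) subr0 addr0 divff ?pnatr_eq0// !eqxx.
    by rewrite uS scalerA kk scale1r.
  have -> : cmul x x + cmul y y - real_complex R 2 *: y =
    (cmul y (y - u N) + cmul (y - u N) (u N)) - real_complex R 2 *: (y - u N.+1).
    rewrite scalerBr k2 cmulBr cmulBl addrA subrK opprB.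
    by rewrite [RHS]addrA (addrC (cmul x x) (cmul (u N) _)) addrA subrK (addrC (cmul x x)).
  have h0 := nrmB (cmul y (y - u N) + cmul (y - u N) (u N)) (real_complex R 2 *: (y - u N.+1)).
  have h1 := nrmD (cmul y (y - u N)) (cmul (y - u N) (u N)).
  have h2 := nrmM y (y - u N); have h3 := nrmM (y - u N) (u N).
  have h4 : nrm (real_complex R 2 *: (y - u N.+1)) = 2 * nrm (y - u N.+1).
    by rewrite nrmZ nrm_real ger0_norm.
  have := hN N (leqnn _); have := hN N.+1 (leqnSn _).
  have := nrm_ge0 (y - u N); have := un N.
  have := nrm_ge0 (u N).
  have [N1 hN1] := hy (4^-1) ltac:(lra).
  have hy1 : nrm y <= 2^-1.
    have := nrmD (y - u N1) (u N1); rewrite subrK.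
    have := hN1 N1 (leqnn _); have := un N1; lra.
  have := nrm_ge0 y; nra.
Qed.

Lemma star_hom0 (A A' : cstarAlgType R) (h : A -> A') : is_star_hom h -> h 0 = 0.
Proof. by move=> hh; apply: (addIr (h 0)); rewrite -(star_homD hh) !add0r. Qed.

Lemma star_homB (A A' : cstarAlgType R) (h : A -> A') x y :
  is_star_hom h -> h (x - y) = h x - h y.
Proof.
move=> hh; rewrite (star_homD hh); congr (_ + _).
by apply: (addrI (h y)); rewrite -(star_homD hh) !subrr star_hom0.
Qed.

Lemma star_hom_sum (A A' : cstarAlgType R) (h : A -> A') (I : Type) (s : seq I)
  (F : I -> A) : is_star_hom h -> h (\sum_(i <- s) F i) = \sum_(i <- s) h (F i).
Proof. by move=> hh; exact: (big_morph h (star_homD hh) (star_hom0 hh)). Qed.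

(** A star-homomorphism preserves the circle equation, so [solve_circle] and [nrm_circle] bound |h
    z| by 1 for self-adjoint z with |z| <= 1/2. Scaling gives the constant 2, squaring improves it
    to 1 in the limit, and the general case follows from x^* x. *)
Lemma star_hom_contr (A A' : cstarAlgType R) (h : A -> A') x :
  is_star_hom h -> nrm (h x) <= nrm x.
Proof.
move=> hh.
have sa z : cadj z = z -> cadj (h z) = h z by move=> zz; rewrite -(star_homV hh) zz.
have h1 z : cadj z = z -> nrm z <= 2^-1 -> nrm (h z) <= 1.
  move=> zz nz; have [y [yy zy E]] := solve_circle zz nz.
  apply: (@nrm_circle _ _ _ (h y) 1) => //; [exact: sa|exact: sa| |].
    by rewrite -!(star_homM hh) zy.
  by rewrite -!(star_homM hh) -(star_homD hh) E (star_homZ hh).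
(* For n = 0 the constant is 2. Applying the bound to z^2 replaces a constant by its square root,
   and 1 + d <= (1 + d/2)^2. *)
have h2 n z : cadj z = z -> nrm (h z) <= (1 + 2^-1 ^+ n) * nrm z.
  elim: n z => [|n IH] z zz.
    have [z0|z0] := eqVneq (nrm z) 0.
      by rewrite (nrm_eq0 z0) (star_hom0 hh) !nrm0 mulr0.
    have {}z0 : 0 < nrm z by rewrite lt_def z0 nrm_ge0.
    set r := (2 * nrm z)^-1.
    have r0 : 0 < r by rewrite invr_gt0; lra.
    have rz : r * nrm z = 2^-1 by rewrite /r invfM mulfVK ?gt_eqF.
    have nr : nrm (real_complex R r : R[i]) = r by rewrite nrm_real gtr0_norm.
    have := h1 (real_complex R r *: z).
    rewrite cadjZ zz (star_homZ hh) !nrmZ !nr rz => /(_ _ _) h3.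
    have {}h3 : r * nrm (h z) <= 1.
      by apply: h3 => //; congr (_ *: _); apply/CrealP; rewrite complex_real.
    by rewrite expr0; nra.
  have z2 := IH (cmul z z).
  have := z2 ltac:(by rewrite cadjM zz); rewrite (star_homM hh) !nrm_selfadj ?sa//.
  rewrite (exprS _ n); set d := 2^-1 ^+ n; have d0 : 0 <= d by rewrite exprn_ge0// invr_ge0.
  have := nrm_ge0 z; have := nrm_ge0 (h z) => p1 p2 p3.
  have d1 : 0 <= 1 + 2^-1 * d by rewrite addr_ge0// mulr_ge0// invr_ge0.
  rewrite -(@ler_pXn2r _ 2)// ?nnegrE ?mulr_ge0//.
  apply: le_trans p3 _; rewrite exprMn ler_wpM2r ?exprn_ge0//.
  by rewrite sqrrD expr1n mul1r; have := sqr_ge0 (2^-1 * d); lra.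
have h3 z : cadj z = z -> nrm (h z) <= nrm z.
  move=> zz; apply/ler_addgt0Pl => e e0.
  have nz := nrm_ge0 z.
  have [|n hn] := @geo_small (e / (nrm z + 1)); first by rewrite divr_gt0//; lra.
  apply: le_trans (h2 n z zz) _; rewrite mulrDl mul1r addrC lerD2r.
  apply: le_trans (ler_wpM2r nz hn) _.
  by rewrite mulrAC ler_pdivrMr; [rewrite ler_pM2l//; lra|lra].
have := h3 (cmul (cadj x) x); rewrite cadjM cadjK (star_homM hh) (star_homV hh).
by rewrite !nrm_adjM => /(_ erefl); rewrite ler_pXn2r ?nnegrE ?nrm_ge0.
Qed.

End Contraction.

(** * The universal C*-algebra *)

Section Universal.
Context {R : realType} {d : Order.disp_t} {B : cbDistrLatticeType d} {L : choiceType}.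
Variable D : gbds B L.

Inductive sterm :=
| SProj of B | SIso of L & B | SZero | SAdd of sterm & sterm
| SMul of sterm & sterm | SScale of R[i] & sterm | SAdj of sterm.

Record sys_rep := SysRep {
  sys_alg : cstarAlgType R;
  sys_p : B -> sys_alg;
  sys_s : L -> B -> sys_alg;
  sys_ok : gbds_rep D sys_p sys_s
}.

Fixpoint seval (A : cstarAlgType R) (p : B -> A) (s : L -> B -> A) (t : sterm) : A :=
  match t with
  | SProj X => p X
  | SIso a X => if `[< ideal D a X >] then s a X else 0
  | SZero => 0
  | SAdd t1 t2 => seval p s t1 + seval p s t2
  | SMul t1 t2 => cmul (seval p s t1) (seval p s t2)
  | SScale k t1 => k *: seval p s t1
  | SAdj t1 => cadj (seval p s t1)
  end.

Local Notation ev r := (seval (@sys_p r) (@sys_s r)).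

(** Projections have norm at most 1 in every representation, hence so do the generators s, because
    s^* s is a projection. The uniform bound makes the supremum norm of a family finite. *)
Lemma seval_bounded t : exists M : R, forall r, nrm (ev r t) <= M.
Proof.
elim: t => [X|a X||t1 [M1 h1] t2 [M2 h2]|t1 [M1 h1] t2 [M2 h2]|k t1 [M1 h1]|t1 [M1 h1]] /=.
- by exists 1 => r; apply: nrm_proj; exact: (rep_proj (sys_ok r)).
- exists 1 => r; case: asboolP => [iX|_]; last by rewrite nrm0.
  have := nrm_adjM (sys_s r a X); rewrite (rep_adj (sys_ok r) iX iX) eqxx.
  have := nrm_proj (rep_proj (sys_ok r) (Order.meet X X)).
  have := nrm_ge0 (sys_s r a X); nra.
- by exists 0 => r; rewrite nrm0.
- exists (M1 + M2) => r; apply: le_trans (nrmD _ _) _; exact: lerD.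
- exists (M1 * M2) => r; apply: le_trans (nrmM _ _) _.
  exact: ler_pM (nrm_ge0 _) (nrm_ge0 _) (h1 r) (h2 r).
- by exists (nrm k * M1) => r; rewrite nrmZ ler_wpM2l ?nrm_ge0 ?h1.
- by exists M1 => r; rewrite nrm_adj.
Qed.

Definition family := forall r : sys_rep, sys_alg r.

Definition approx (a : family) :=
  forall e : R, 0 < e -> exists t, forall r, nrm (a r - ev r t) <= e.

Definition ballset (a : family) : set (sterm * R) :=
  [set tr | forall r, nrm (a r - ev r tr.1) <= tr.2].

(* A family indexed by the large type [sys_rep] is encoded by the set of pairs
   (term, radius) of which it is uniformly close, which lives in the right
   universe. *)
Definition ualg := {X : set (sterm * R) | exists a, approx a /\ X = ballset a}.

Definition uval (r : sys_rep) (x : ualg) : sys_alg r := sval (cid (svalP x)) r.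

Lemma uval_approx x : approx (fun r => uval r x).
Proof. by rewrite /uval; case: cid => a []. Qed.

Lemma uval_ballset x : sval x = ballset (fun r => uval r x).
Proof. by rewrite /uval; case: cid => a []. Qed.

Lemma uval_inj x y : (forall r, uval r x = uval r y) -> x = y.
Proof.
move=> h; have e : sval x = sval y.
  by rewrite !uval_ballset; congr ballset; apply: functional_extensionality_dep.
by case: x y e {h} => [X hX] [Y hY] /= e; exact: eq_exist.
Qed.

(** A family is recovered from its set of pairs: two families with the same set share, for every e,
    a term within e / 2 of both, hence they coincide. *)
Lemma uval_ex (a : family) : approx a -> exists x, forall r, uval r x = a r.
Proof.
move=> aa; exists (exist _ (ballset a) (ex_intro _ a (conj aa erefl))) => r.
set x := exist _ _ _.
apply/eqP; rewrite -subr_eq0; apply/eqP/nrm_small => e e0.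
have [t ht] := aa (e / 2) ltac:(lra).
have : sval x (t, e / 2) by exact: ht.
rewrite uval_ballset => /(_ r)/= h.
have := nrm_trans (ev r t) (uval r x) (a r).
rewrite (nrm_distrC (ev r t)); have := ht r; lra.
Qed.

Lemma uval_bounded x : exists M : R, forall r, nrm (uval r x) <= M.
Proof.
have [t ht] := uval_approx x ltr01.
have [M hM] := seval_bounded t; exists (1 + M) => r.
have := nrmD (uval r x - ev r t) (ev r t); rewrite subrK.
have := ht r; have := hM r; lra.
Qed.

Lemma approx_seval t : approx (fun r => ev r t).
Proof. by move=> e e0; exists t => r; rewrite subrr nrm0 ltW. Qed.

Lemma approxD x y : approx (fun r => uval r x + uval r y).
Proof.
move=> e e0; have [t ht] := @uval_approx x (e / 2) ltac:(lra).
have [u hu] := @uval_approx y (e / 2) ltac:(lra).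
exists (SAdd t u) => r /=; rewrite opprD addrACA.
apply: le_trans (nrmD _ _) _; have := ht r; have := hu r; lra.
Qed.

Lemma approxZ k x : approx (fun r => k *: uval r x).
Proof.
move=> e e0; have k0 : 0 < nrm k + 1 by have := nrm_ge0 k; lra.
have [t ht] := @uval_approx x (e / (nrm k + 1)) ltac:(by rewrite divr_gt0).
exists (SScale k t) => r /=; rewrite -scalerBr nrmZ.
have := ht r; rewrite ler_pdivlMr//.
have := nrm_ge0 k; have := nrm_ge0 (uval r x - ev r t); nra.
Qed.

Lemma approxJ x : approx (fun r => cadj (uval r x)).
Proof.
move=> e e0; have [t ht] := @uval_approx x e e0.
by exists (SAdj t) => r /=; rewrite -cadjB nrm_adj.
Qed.

Lemma approxM x y : approx (fun r => cmul (uval r x) (uval r y)).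
Proof.
move=> e e0; have [M hM] := uval_bounded x.
pose M' := `|M| + 1; have M0 : 0 < M' by rewrite /M'; have := normr_ge0 M; lra.
have {}hM r : nrm (uval r x) <= M'.
  by apply: le_trans (hM r) _; rewrite /M'; have := ler_norm M; lra.
have [u hu] := @uval_approx y (e / 2 / M') ltac:(by rewrite !divr_gt0).
have [N hN] := seval_bounded u.
pose N' := `|N| + 1; have N0 : 0 < N' by rewrite /N'; have := normr_ge0 N; lra.
have {}hN r : nrm (ev r u) <= N'.
  by apply: le_trans (hN r) _; rewrite /N'; have := ler_norm N; lra.
have [t ht] := @uval_approx x (e / 2 / N') ltac:(by rewrite !divr_gt0).
exists (SMul t u) => r /=.
have -> : cmul (uval r x) (uval r y) - cmul (ev r t) (ev r u) =
  cmul (uval r x) (uval r y - ev r u) + cmul (uval r x - ev r t) (ev r u).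
  by rewrite cmulBr cmulBl addrA subrK.
apply: le_trans (nrmD _ _) _.
have := hu r; have := ht r; rewrite !ler_pdivlMr// => h1 h2.
have := nrmM (uval r x) (uval r y - ev r u).
have := nrmM (uval r x - ev r t) (ev r u).
have := hM r; have := hN r.
have := nrm_ge0 (uval r x); have := nrm_ge0 (ev r u).
have := nrm_ge0 (uval r x - ev r t); have := nrm_ge0 (uval r y - ev r u).
nra.
Qed.

Definition uelt (a : family) (h : approx a) : ualg := sval (cid (uval_ex h)).

Lemma ueltE a (h : approx a) r : uval r (uelt h) = a r.
Proof. by rewrite /uelt; case: cid. Qed.

HB.instance Definition _ := gen_eqMixin ualg.
HB.instance Definition _ := gen_choiceMixin ualg.

Definition uterm t := uelt (approx_seval t).
Definition uadd x y := uelt (approxD x y).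
Definition uscale k x := uelt (approxZ k x).
Definition uopp x := uscale (-1) x.
Definition umul x y := uelt (approxM x y).
Definition uadj x := uelt (approxJ x).

Ltac uring := move=> *; apply: uval_inj => r; rewrite ?ueltE.

Fact uaddA : associative uadd. Proof. by uring; rewrite addrA. Qed.
Fact uaddC : commutative uadd. Proof. by uring; rewrite addrC. Qed.
Fact uadd0 : left_id (uterm SZero) uadd. Proof. by uring; rewrite add0r. Qed.
Fact uaddN : left_inverse (uterm SZero) uopp uadd.
Proof. by uring; rewrite scaleN1r addNr. Qed.

HB.instance Definition _ := GRing.isZmodule.Build ualg uaddA uaddC uadd0 uaddN.

Fact uscaleA k l x : uscale k (uscale l x) = uscale (k * l) x.
Proof. by uring; rewrite scalerA. Qed.
Fact uscale1 : left_id 1 uscale. Proof. by uring; rewrite scale1r. Qed.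
Fact uscaleDr : right_distributive uscale +%R.
Proof. by uring; rewrite scalerDr. Qed.
Fact uscaleDl x : {morph uscale^~ x : k l / k + l}.
Proof. by uring; rewrite scalerDl. Qed.

HB.instance Definition _ :=
  GRing.Zmodule_isLmodule.Build R[i] ualg uscaleA uscale1 uscaleDr uscaleDl.

Lemma uval0 r : uval r 0 = 0. Proof. exact: ueltE. Qed.
Lemma uvalD r x y : uval r (x + y) = uval r x + uval r y.
Proof. exact: ueltE. Qed.
Lemma uvalN r x : uval r (- x) = - uval r x.
Proof. by rewrite [LHS]ueltE scaleN1r. Qed.
Lemma uvalZ r k x : uval r (k *: x) = k *: uval r x.
Proof. exact: ueltE. Qed.

(** The value 0 makes the set non-empty without exhibiting a representation. *)
Definition unorms (x : ualg) : set R :=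
  [set v | v = 0 \/ exists r, v = nrm (uval r x)].

Definition unorm x : R := sup (unorms x).

Lemma unorms_sup x : has_sup (unorms x).
Proof.
split; first by exists 0; left.
have [M hM] := uval_bounded x; exists (`|M|) => v [->|[r ->]] //.
by apply: le_trans (hM r) _; exact: ler_norm.
Qed.

Lemma unorm_ge0 x : 0 <= unorm x.
Proof. by apply: ub_le_sup; [exact: (unorms_sup x).2|left]. Qed.

Lemma unorm_ge r x : nrm (uval r x) <= unorm x.
Proof. by apply: ub_le_sup; [exact: (unorms_sup x).2|right; exists r]. Qed.

Lemma unorm_le x M : 0 <= M -> (forall r, nrm (uval r x) <= M) -> unorm x <= M.
Proof.
by move=> M0 h; apply: ge_sup; [exact: (unorms_sup x).1|move=> v [->|[r ->]]].
Qed.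

Fact unormD x y : real_complex R (unorm (x + y)) <=
  real_complex R (unorm x) + real_complex R (unorm y).
Proof.
rewrite -rmorphD/= lecR; apply: unorm_le => [|r].
  by rewrite addr_ge0 ?unorm_ge0.
by rewrite uvalD (le_trans (nrmD _ _))// lerD ?unorm_ge.
Qed.

Fact unormZ (k : R[i]) x :
  real_complex R (unorm (k *: x)) = `|k| * real_complex R (unorm x).
Proof.
rewrite nrmE -rmorphM/=; congr (real_complex R _); apply/eqP; rewrite eq_le.
apply/andP; split.
  apply: unorm_le => [|r]; first by rewrite mulr_ge0 ?nrm_ge0 ?unorm_ge0.
  by rewrite uvalZ nrmZ ler_wpM2l ?nrm_ge0 ?unorm_ge.
have [->|k0] := eqVneq k 0; first by rewrite nrm0 mul0r unorm_ge0.
have nk : 0 < nrm k.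
  by rewrite lt_def nrm_ge0 andbT; apply: contra_neq k0; exact: nrm_eq0.
rewrite -ler_pdivlMl//; apply: unorm_le => [|r].
  by rewrite mulr_ge0 ?unorm_ge0// invr_ge0 nrm_ge0.
by rewrite ler_pdivlMl// -nrmZ -uvalZ unorm_ge.
Qed.

Fact unorm0_eq0 x : real_complex R (unorm x) = 0 -> x = 0.
Proof.
move=> h; have {}h : unorm x = 0 by apply: complexI.
apply: uval_inj => r; rewrite uval0; apply: nrm_eq0; apply/eqP.
by rewrite eq_le nrm_ge0 -h unorm_ge.
Qed.

HB.instance Definition _ := Lmodule_isNormed.Build R[i] ualg unormD unormZ unorm0_eq0.

Lemma unormE (x : ualg) : nrm x = unorm x. Proof. by []. Qed.

(** The Cauchy filter is replaced by a sequence at uniform rate 1 / (n + 1). The limits taken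
    separately in each representation keep this rate, so the limit family is again a uniform limit
    of terms. *)
Fact ualg_complete (F : set_system ualg) : ProperFilter F -> cauchy F -> cvg F.
Proof.
move=> FF cF.
have hx n : exists x : ualg, F (ball x (real_complex R n.+1%:R^-1)).
  by apply: (cauchyP F).1 => //; rewrite ltcR invr_gt0.
have [x Fx] := choice hx.
have dx (m n : nat) : unorm (x m - x n) <= m.+1%:R^-1 + n.+1%:R^-1.
  have [y [bm bn]] := @filter_ex _ F FF _ (filterI (Fx m) (Fx n)).
  have {}bm : nrm (x m - y) < m.+1%:R^-1 by apply/ball_nrmE; rewrite ?invr_gt0.
  have {}bn : nrm (x n - y) < n.+1%:R^-1 by apply/ball_nrmE; rewrite ?invr_gt0.
  rewrite -unormE; apply: le_trans (nrm_trans y _ _) _.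
  by rewrite lerD// ltW// nrm_distrC.
have hl r : exists a : sys_alg r, forall n, nrm (a - uval r (x n)) <= n.+1%:R^-1.
  have [|a ha] := @cauchy_nrm _ (sys_alg r) (fun n => uval r (x n)).
    move=> e e0; have [N hN] := @invn_lt R (e / 2) ltac:(lra).
    exists N => m n Nm Nn; rewrite -uvalN -uvalD.
    apply: le_trans (unorm_ge _ _) _; apply: le_trans (dx _ _) _.
    have := @le_invn R _ _ Nm; have := @le_invn R _ _ Nn.
    by move: (m.+1%:R^-1) (n.+1%:R^-1) (N.+1%:R^-1) hN => x1 x2 x3; lra.
  exists a => n; apply/ler_addgt0Pl => e e0.
  have [N hN] := ha (e / 2) ltac:(lra).
  have [N' hN'] := @invn_lt R (e / 2) ltac:(lra).
  have h1 := hN _ (leq_maxl N N').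
  have h2 := dx (maxn N N') n; have h3 := @le_invn R _ _ (leq_maxr N N').
  have h4 := unorm_ge r (x (maxn N N') - x n).
  have := nrm_trans (uval r (x (maxn N N'))) a (uval r (x n)).
  rewrite uvalD uvalN in h4; move: h2 h3 hN'.
  by move: ((maxn _ _).+1%:R^-1) (n.+1%:R^-1) (N'.+1%:R^-1) => x1 x2 x3; lra.
pose a : family := fun r => sval (cid (hl r)).
have ha r n : nrm (a r - uval r (x n)) <= n.+1%:R^-1.
  by rewrite /a; case: cid.
have aa : approx a.
  move=> e e0; have [N hN] := @invn_lt R (e / 2) ltac:(lra).
  have [t ht] := @uval_approx (x N) (e / 2) ltac:(lra).
  exists t => r; have := nrm_trans (uval r (x N)) (a r) (ev r t).
  have := ha r N; have := ht r; move: (N.+1%:R^-1) hN => x1; lra.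
apply/cvg_ex; exists (uelt aa) => /= X /nbhs_ballP[e /= e0 eX].
have [ee e1] := lt0_complex e0.
have [N hN] := @invn_lt R (complex.Re e / 2) ltac:(lra).
apply: filterS (Fx N) => y; rewrite ball_nrmE ?invr_gt0// => h.
apply: eX; apply/ball_nrm => //.
apply: le_lt_trans (nrm_trans (x N) _ _) _.
suff : nrm (uelt aa - x N) <= N.+1%:R^-1 by move: (N.+1%:R^-1) hN h => x1; lra.
rewrite unormE; apply: unorm_le => [|r]; first by rewrite invr_ge0.
by rewrite uvalD uvalN ueltE.
Qed.

HB.instance Definition _ := Uniform_isComplete.Build ualg ualg_complete.

Fact umulA : associative umul. Proof. by uring; rewrite cmulA. Qed.
Fact umulDl : left_distributive umul +%R.
Proof. by move=> x y z; uring; rewrite ?(uvalD, ueltE) cmulDl. Qed.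
Fact umulDr : right_distributive umul +%R.
Proof. by move=> x y z; uring; rewrite ?(uvalD, ueltE) cmulDr. Qed.
Fact umulZl (k : R[i]) x y : umul (k *: x) y = k *: umul x y.
Proof. by uring; rewrite ?(uvalZ, ueltE) cmulZl. Qed.
Fact umulZr (k : R[i]) x y : umul x (k *: y) = k *: umul x y.
Proof. by uring; rewrite ?(uvalZ, ueltE) cmulZr. Qed.
Fact uadjK : involutive uadj. Proof. by uring; rewrite cadjK. Qed.
Fact uadjD : {morph uadj : x y / x + y}.
Proof. by move=> x y; uring; rewrite ?(uvalD, ueltE) cadjD. Qed.
Fact uadjZ (k : R[i]) x : uadj (k *: x) = k^* *: uadj x.
Proof. by uring; rewrite ?(uvalZ, ueltE) cadjZ. Qed.
Fact uadjM x y : uadj (umul x y) = umul (uadj y) (uadj x).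
Proof. by uring; rewrite cadjM. Qed.

Fact unormM (x y : ualg) : `|umul x y| <= `|x| * `|y|.
Proof.
rewrite !nrmE -rmorphM/= lecR !unormE; apply: unorm_le => [|r].
  by rewrite mulr_ge0 ?unorm_ge0.
rewrite ueltE; apply: le_trans (nrmM _ _) _.
by rewrite ler_pM ?nrm_ge0 ?unorm_ge.
Qed.

Fact unorm_adjM (x : ualg) : `|umul (uadj x) x| = `|x| ^+ 2.
Proof.
rewrite !nrmE -rmorphXn/= !unormE; congr (real_complex R _).
apply/eqP; rewrite eq_le; apply/andP; split.
  apply: unorm_le => [|r]; first by rewrite exprn_ge0 ?unorm_ge0.
  by rewrite !ueltE nrm_adjM ler_pXn2r ?nnegrE ?nrm_ge0 ?unorm_ge0 ?unorm_ge.
rewrite -[leRHS]sqr_sqrtr ?unorm_ge0// ler_pXn2r ?nnegrE ?unorm_ge0 ?sqrtr_ge0//.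
apply: unorm_le => [|r]; first exact: sqrtr_ge0.
rewrite -[leLHS]ger0_norm ?nrm_ge0// -sqrtr_sqr ler_sqrt ?unorm_ge0//.
by rewrite -nrm_adjM; apply: le_trans (unorm_ge r _); rewrite !ueltE.
Qed.

HB.instance Definition _ := isCStarAlgebra.Build R ualg umulA umulDl umulDr
  umulZl umulZr uadjK uadjD uadjZ uadjM unormM unorm_adjM.

Lemma uval_hom r : is_star_hom (uval r : ualg -> sys_alg r).
Proof.
split=> [x y|k x|x y|x]; [exact: uvalD|exact: uvalZ|exact: ueltE|exact: ueltE].
Qed.

Definition uproj X : ualg := uterm (SProj X).
Definition uiso a X : ualg := uterm (SIso a X).

Lemma uprojE r X : uval r (uproj X) = sys_p r X. Proof. exact: ueltE. Qed.

Lemma uisoE r a X : ideal D a X -> uval r (uiso a X) = sys_s r a X.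
Proof. by move=> iX; rewrite ueltE /=; case: asboolP. Qed.

Lemma uval_eqM r (x y : ualg) : uval r (cmul x y) = cmul (uval r x) (uval r y).
Proof. exact: (star_homM (uval_hom r)). Qed.

Lemma uval_eqV r (x : ualg) : uval r (cadj x) = cadj (uval r x).
Proof. exact: (star_homV (uval_hom r)). Qed.

Lemma ualg_rep : gbds_rep D uproj uiso.
Proof.
split=> [X|a X iX||X Y|X Y|X a Y iY|a a' Y Y' iY iY'|X rX].
- by split; apply: uval_inj => r; rewrite ?(uval_eqV, uval_eqM) uprojE;
   have [] := rep_proj (sys_ok r) X.
- apply: uval_inj => r; rewrite !(uval_eqV, uval_eqM) uisoE//.
  exact: (rep_isometry (sys_ok r)).
- by apply: uval_inj => r; rewrite uprojE uval0 (rep_bot (sys_ok r)).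
- by apply: uval_inj => r; rewrite uval_eqM !uprojE (rep_meet (sys_ok r)).
- by apply: uval_inj => r; rewrite !uvalD uvalN !uprojE (rep_join (sys_ok r)).
- by apply: uval_inj => r; rewrite !uval_eqM !uprojE uisoE// (rep_comm (sys_ok r)).
- apply: uval_inj => r; rewrite uval_eqM uval_eqV !uisoE// (rep_adj (sys_ok r) iY iY').
  by case: eqP; rewrite ?uprojE ?uval0.
- have aX a : ideal D a (act D a X) by exact: (ideal_act (lexx _)).
  have fX : finite_set (Delta D X).
    have [->|/eqP X0] := eqVneq X \bot%O.
      by rewrite (_ : Delta D \bot%O = set0)// -subset0 => a; rewrite /Delta/= act_bot.
    by have [] := rX X X0 (lexx _).
  apply: uval_inj => r; rewrite uprojE (rep_regular (sys_ok r) rX).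
  rewrite !(fsbig_finite _ _ fX) (star_hom_sum _ _ (uval_hom r)).
  by apply: eq_bigr => a _; rewrite uval_eqM uval_eqV !uisoE.
Qed.

(** A closed star-subalgebra containing the generators contains all terms, which are dense by
    construction; the homomorphism to a given representation is the evaluation at that index. *)
Lemma gbds_cstar_exists : exists A : cstarAlgType R, is_gbds_cstar D A.
Proof.
exists ualg, uproj, uiso; split; first exact: ualg_rep.
  move=> X sX gX; have hX t : X (uterm t).
    have eqX (x y : ualg) : (forall r, uval r x = uval r y) -> X x -> X y.
      by move=> /uval_inj ->.
    elim: t => [Y|a Y||t1 h1 t2 h2|t1 h1 t2 h2|k t1 h1|t1 h1].
    - by apply: gX; left; exists Y.
    - case: (pselect (ideal D a Y)) => iY; first by apply: gX; right; exists a, Y.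
      apply: eqX (cstar_sub0 sX) => r; rewrite ?(ueltE, uval0) /=.
      by case: asboolP.
    - exact: (cstar_sub0 sX).
    - by apply: eqX (cstar_subD sX h1 h2) => r; rewrite ?(uvalD, ueltE).
    - by apply: eqX (cstar_subM sX h1 h2) => r; rewrite ?(uval_eqM, ueltE).
    - by apply: eqX (cstar_subZ sX k h1) => r; rewrite ?(uvalZ, ueltE).
    - by apply: eqX (cstar_subV sX h1) => r; rewrite ?(uval_eqV, ueltE).
  rewrite -subTset => x _; apply: (closed_nrm (cstar_sub_closed sX)) => e e0.
  have [t ht] := uval_approx x e0; exists (uterm t) => //.
  rewrite unormE; apply: unorm_le => [|r]; first exact: ltW.
  by rewrite ?(uvalD, uvalN, ueltE).
move=> A' q t qt; pose r := SysRep qt.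
exists (uval r); split; first exact (uval_hom r).
  by move=> X; rewrite uprojE.
by move=> a X iX; rewrite uisoE.
Qed.

End Universal.

(** * The inverse semigroup *)

Section Words.
Context {d : Order.disp_t} {B : cbDistrLatticeType d} {L : choiceType}.
Variable D : gbds B L.
Local Notation triple := (@triple d B L).
Local Notation bot := (\bot%O : B).
Local Notation "A /\' C" := (@Order.meet d B A C) (at level 48, left associativity).

Lemma actw_cat u v A : actw D (u ++ v) A = actw D v (actw D u A).
Proof. exact: foldl_cat. Qed.

Lemma actw_meet u A C : actw D u (A /\' C) = actw D u A /\' actw D u C.
Proof. by elim: u A C => //= a u IH A C; rewrite act_meet IH. Qed.

Lemma actw_bot u : actw D u bot = bot.
Proof. by elim: u => //= a u; rewrite act_bot. Qed.

Lemma actw_le u A C : (A <= C)%O -> (actw D u A <= actw D u C)%O.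
Proof. by rewrite !leEmeet => /eqP hAC; rewrite -actw_meet hAC. Qed.

Lemma idealw_le u A C : (A <= C)%O -> idealw D u C -> idealw D u A.
Proof.
by case: u => //= a u hAC [X iX CX]; exists X => //; exact: le_trans hAC CX.
Qed.

Lemma idealw_meetl u A C : idealw D u A -> idealw D u (A /\' C).
Proof. by apply: idealw_le; exact: leIl. Qed.

Lemma idealw_meetr u A C : idealw D u C -> idealw D u (A /\' C).
Proof. by apply: idealw_le; exact: leIr. Qed.

Lemma idealw_act u v A : idealw D u A -> idealw D (u ++ v) (actw D v A).
Proof.
case: u => [_|a u [X iX AX]] /=.
  case: v => //= a v; exists (act D a A) => //; exact: ideal_act (lexx _).
by exists X => //; rewrite actw_cat actw_le.
Qed.

Lemma idealw_suffix u v A : idealw D (u ++ v) A -> idealw D v A.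
Proof.
case: v => // b v; case: u => // a u [X iX]; rewrite actw_cat /= => AX.
by exists (act D b (actw D u X)) => //; exact: ideal_act (lexx _).
Qed.

(** The empty [u] is excluded because an element of the ideal of [v] need not lie below any image
    under [actw D v]. *)
Lemma idealw_prefix u v A : u <> [::] -> idealw D (u ++ v) A ->
  exists2 Y, idealw D u Y & (A <= actw D v Y)%O.
Proof.
case: u => // a u _ [X iX]; rewrite actw_cat => AX.
by exists (actw D u X) => //; exists X.
Qed.

(** The suffix [m] may be empty, so the case of equal words is included. Together with [smul_r],
    [smul_inc] and the trichotomy [word_cmpP] this replaces the nested tests of [smul]. *)
Lemma smul_l a A b m C e :
  smul D (Some (a, A, b)) (Some (b ++ m, C, e)) =
  mk_triple (a ++ m) (actw D m A /\' C) e.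
Proof.
rewrite /=; case: eqP => [|_]; last first.
  by rewrite prefix_prefix drop_size_cat.
rewrite -{1}(cats0 b) => /eqP; rewrite eqseq_cat// => /andP[_ /eqP <-].
by rewrite cats0.
Qed.

Lemma smul_r a A c m C e :
  smul D (Some (a, A, c ++ m)) (Some (c, C, e)) =
  mk_triple a (A /\' actw D m C) (e ++ m).
Proof.
have [->|m0] := eqVneq m [::]; first by rewrite !cats0 /= eqxx.
have n1 : (c ++ m == c) = false.
  by apply/negbTE; apply: contra_neq m0 => h; apply: size0nil;
     have := congr1 size h; rewrite size_cat => /eqP; rewrite -{2}(addn0 (size c)) eqn_add2l => /eqP.
rewrite /= n1 prefix_prefix drop_size_cat//.
case: ifP => // /prefixP[n]; rewrite -catA -{1}(cats0 c) => /eqP.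
by rewrite eqseq_cat// => /andP[_]; case: m m0 {n1}.
Qed.

Lemma smul_inc a A b c C e : ~~ prefix b c -> ~~ prefix c b ->
  smul D (Some (a, A, b)) (Some (c, C, e)) = None.
Proof.
move=> /= /negbTE h1 /negbTE h2; rewrite h1 h2.
by case: eqP h1 => // ->; rewrite prefix_refl.
Qed.

Variant word_cmp (b c : seq L) : Prop :=
| WordL m of c = b ++ m
| WordR m of b = c ++ m & m <> [::]
| WordN of ~~ prefix b c & ~~ prefix c b.

Lemma word_cmpP b c : word_cmp b c.
Proof.
have [/prefixP[m ->]|h1] := boolP (prefix b c); first exact: (WordL (m:=m)).
have [/prefixP[m E]|h2] := boolP (prefix c b); last exact: WordN.
by apply: (WordR (m:=m) E) => m0; move: h1; rewrite E m0 cats0 prefix_refl.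
Qed.

Lemma smulx0 x : smul D x None = None. Proof. by case: x => [[[]]|]. Qed.

Lemma mk_tripleE (a : seq L) A (b : seq L) : A <> bot -> mk_triple a A b = Some (a, A, b).
Proof. by move=> /eqP/negbTE h; rewrite /mk_triple h. Qed.

Lemma mk_triple0 (a b : seq L) : mk_triple a bot b = None.
Proof. by rewrite /mk_triple eqxx. Qed.

(* Left multiplication acts faithfully on pairs (word, element); associativity
   is read off from this action. *)
Definition pmk (w : seq L) (F : B) : option (seq L * B) :=
  if F == bot then None else Some (w, F).

Definition pact (s : triple) (p : option (seq L * B)) : option (seq L * B) :=
  match s, p with
  | Some (a, A, b), Some (w, F) =>
      if prefix b w then pmk (a ++ drop (size b) w) (actw D (drop (size b) w) A /\' F)
      else None
  | _, _ => None
  end.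

Lemma pactE a A b m F :
  pact (Some (a, A, b)) (Some (b ++ m, F)) = pmk (a ++ m) (actw D m A /\' F).
Proof. by rewrite /= prefix_prefix drop_size_cat. Qed.

Lemma pact_pmk a A b m F :
  pact (Some (a, A, b)) (pmk (b ++ m) F) = pmk (a ++ m) (actw D m A /\' F).
Proof.
rewrite /pmk; case: eqP => [->|_]; last exact: pactE.
by rewrite meetx0 eqxx.
Qed.

Lemma pact_mk a A b m F :
  pact (mk_triple a A b) (Some (b ++ m, F)) = pmk (a ++ m) (actw D m A /\' F).
Proof.
rewrite /mk_triple; case: eqP => [->|_]; last exact: pactE.
by rewrite actw_bot meet0x /pmk eqxx.
Qed.

Lemma pact_mkN a A b w F : ~~ prefix b w ->
  pact (mk_triple a A b) (Some (w, F)) = None.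
Proof. by rewrite /mk_triple; case: eqP => // _ /negbTE /= ->. Qed.

Lemma pact_pmkN a A b w F : ~~ prefix b w ->
  pact (Some (a, A, b)) (pmk w F) = None.
Proof. by rewrite /pmk; case: eqP => // _ /negbTE /= ->. Qed.

Lemma prefix_cat2 (a b m n : seq L) : a ++ m = b ++ n -> prefix a b || prefix b a.
Proof.
move=> E; have [ab|ba] := leqP (size a) (size b).
  apply/orP; left; apply/prefixP; exists (take (size b - size a) m).
  by have := congr1 (take (size b)) E; rewrite take_cat ltnNge ab/= take_size_cat.
apply/orP; right; apply/prefixP; exists (take (size a - size b) n).
by have := congr1 (take (size a)) E; rewrite take_size_cat// take_cat ltnNge ltnW.
Qed.

Lemma cat_cancel (a m n : seq L) : a ++ m = a ++ n -> m = n.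
Proof. by move/eqP; rewrite eqseq_cat// eqxx => /eqP. Qed.

Lemma pact_smul s t p : pact (smul D s t) p = pact s (pact t p).
Proof.
have pN x : pact x None = None by case: x => [[[]]|].
case: p => [[w F]|]; last by rewrite !pN.
case: s => [[[a A] b]|]; last by case: t => [[[? ?] ?]|].
case: t => [[[c C] e]|]; last by [].
have [/prefixP[n ->{w}]|nw] := boolP (prefix e w); last first.
  have -> : pact (Some (c, C, e)) (Some (w, F)) = None by rewrite /= (negbTE nw).
  rewrite pN.
  case: (word_cmpP b c) => [m ->|m -> _|h1 h2].
  - by rewrite smul_l pact_mkN.
  - rewrite smul_r pact_mkN//; apply: contra nw => /prefixP[k ->].
    by rewrite -catA prefix_prefix.
  - by rewrite smul_inc.
rewrite pactE; case: (word_cmpP b c) => [m ->|m -> m0|h1 h2].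
- by rewrite smul_l pact_mk -!catA pact_pmk actw_cat actw_meet meetA.
- rewrite smul_r; have [/prefixP[k E]|h] := boolP (prefix m n).
    rewrite E !catA pact_mk pact_pmk.
    by rewrite actw_meet actw_cat !meetA.
  rewrite pact_mkN; last first.
    apply: contra h => /prefixP[k]; rewrite -catA => /cat_cancel ->.
    exact: prefix_prefix.
  rewrite pact_pmkN//; apply: contra h => /prefixP[k]; rewrite -catA => /cat_cancel ->.
  exact: prefix_prefix.
- rewrite smul_inc// pact_pmkN//; apply/negP => /prefixP[k /prefix_cat2].
  by rewrite (negbTE h1) (negbTE h2).
Qed.

(** Raw triples with an empty middle entry act as zero and have to be excluded for the action to be
    faithful; products are always normal. *)
Definition normal (s : triple) := if s is Some (_, A, _) then A <> bot else True.

Lemma normal_mk a A b : normal (mk_triple a A b).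
Proof. by rewrite /mk_triple; case: eqP. Qed.

Lemma normal_smul s t : normal (smul D s t).
Proof.
case: s => [[[a A] b]|] //; case: t => [[[c C] e]|] //.
by case: (word_cmpP b c) => [m ->|m -> _|h1 h2]; rewrite ?smul_l ?smul_r ?smul_inc//;
  exact: normal_mk.
Qed.

(** The triple (a, A, b) is detected at (b, A), which it sends to (a, A). Testing s and t on each
    other's points makes each second word a prefix of the other. *)
Lemma pact_faithful s t : normal s -> normal t ->
  (forall p, pact s p = pact t p) -> s = t.
Proof.
have pid a A b : A <> bot -> pact (Some (a, A, b)) (Some (b, A)) = Some (a, A).
  by move=> A0; rewrite -{2}(cats0 b) pactE /= meetxx cats0 /pmk; case: eqP A0.
case: s => [[[a A] b]|]; case: t => [[[c C] e]|] // nA nC h; last 2 first.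
- by have := h (Some (b, A)); rewrite pid.
- by have := h (Some (e, C)); rewrite pid.
have h1 := h (Some (b, A)); have h2 := h (Some (e, C)).
rewrite pid// in h1; rewrite pid// in h2; move: h1 h2 => /esym + h2.
rewrite /=; case: ifP => // /prefixP[m Em]; move: h2.
rewrite /=; case: ifP => // /prefixP[n En].
have [m0 n0] : m = [::] /\ n = [::].
  move: En; rewrite Em -catA -{1}(cats0 e) => /cat_cancel.
  by case: m {Em} => //; case: n.
rewrite {}m0 {}n0 !cats0 in Em En *; rewrite {}Em in h *.
rewrite drop_size /= !cats0 /pmk; case: eqP => // _ [_ EC]; case: eqP => // _ [-> EA].
by rewrite -EA -{2}EC meetC.
Qed.

Lemma smulA s t u : smul D s (smul D t u) = smul D (smul D s t) u.
Proof.
by apply: pact_faithful => [||p]; [exact: normal_smul|exact: normal_smul|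
  rewrite !pact_smul].
Qed.

Lemma sadjK (s : triple) : sadj (sadj s) = s. Proof. by case: s => [[[]]|]. Qed.

Lemma sadj_mk (a : seq L) (A : B) (b : seq L) : sadj (mk_triple a A b) = mk_triple b A a.
Proof. by rewrite /mk_triple; case: eqP. Qed.

Lemma sadjM s t : sadj (smul D s t) = smul D (sadj t) (sadj s).
Proof.
case: s => [[[a A] b]|]; last by rewrite smulx0.
case: t => [[[c C] e]|] //.
rewrite [sadj (Some (a, _, _))]/= [sadj (Some (c, _, _))]/=.
case: (word_cmpP b c) => [m ->|m -> _|h1 h2].
- by rewrite smul_l smul_r sadj_mk meetC.
- by rewrite smul_l smul_r sadj_mk meetC.
- by rewrite !smul_inc.
Qed.

Lemma S_mk a A b : idealw D a A -> idealw D b A -> S_set D (mk_triple a A b).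
Proof. by move=> ia ib; rewrite /mk_triple; case: eqP. Qed.

Lemma S_smul s t : S_set D s -> S_set D t -> S_set D (smul D s t).
Proof.
case: s => [[[a A] b]|] //; case: t => [[[c C] e]|]; last by [].
move=> [nA ia ib] [nC ic ie]; case: (word_cmpP b c) => [m E|m E _|h1 h2].
- subst c; rewrite smul_l; apply: S_mk; last exact: idealw_meetr.
  by apply: idealw_meetl; exact: idealw_act.
- subst b; rewrite smul_r; apply: S_mk; first exact: idealw_meetl.
  by apply: idealw_meetr; exact: idealw_act.
- by rewrite smul_inc.
Qed.

Lemma S_sadj s : S_set D s -> S_set D (sadj s).
Proof. by case: s => [[[a A] b]|] //= []. Qed.

Lemma E_S e : E_set D e -> S_set D e.
Proof. by case: e => [[[a A] b]|] //= [-> ? ?]. Qed.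

Lemma smul_diag a A C b c : smul D (Some (a, A, b)) (Some (b, C, c)) =
  mk_triple a (A /\' C) c.
Proof. by rewrite -{2}(cats0 b) smul_l cats0. Qed.

Lemma smulVK s : S_set D s -> smul D (smul D s (sadj s)) s = s.
Proof.
case: s => [[[a A] b]|] //= [nA ia ib]; rewrite eqxx meetxx mk_tripleE//.
by rewrite smul_diag meetxx mk_tripleE.
Qed.

Lemma E_mk a A : idealw D a A -> E_set D (mk_triple a A a).
Proof. by move=> ia; rewrite /mk_triple; case: eqP. Qed.

Lemma E_smul e f : E_set D e -> E_set D f -> E_set D (smul D e f).
Proof.
case: e => [[[a A] b]|] //; case: f => [[[c C] g]|]; last by [].
move=> [ab nA ia] [cg nC ic]; subst b g.
case: (word_cmpP a c) => [m E|m E _|h1 h2].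
- by subst c; rewrite smul_l; apply: E_mk; exact: idealw_meetr.
- by subst a; rewrite smul_r; apply: E_mk; exact: idealw_meetl.
- by rewrite smul_inc.
Qed.

Lemma E_smulC e f : E_set D e -> E_set D f -> smul D e f = smul D f e.
Proof.
case: e => [[[a A] b]|]; last by rewrite smulx0.
case: f => [[[c C] g]|] //.
move=> [ab nA ia] [cg nC ic]; subst b g.
case: (word_cmpP a c) => [m E|m E _|h1 h2].
- by subst c; rewrite smul_l smul_r meetC.
- by subst a; rewrite smul_l smul_r meetC.
- by rewrite !smul_inc.
Qed.

Lemma E_smulxx e : E_set D e -> smul D e e = e.
Proof.
by case: e => [[[a A] b]|] //= [-> nA _]; rewrite eqxx meetxx mk_tripleE.
Qed.

Lemma E_sadj e : E_set D e -> sadj e = e.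
Proof. by case: e => [[[a A] b]|] //= [->]. Qed.

Lemma E_conj s e : S_set D s -> E_set D e -> E_set D (smul D (sadj s) (smul D e s)).
Proof.
case: s => [[[a A] b]|]; last by [].
case: e => [[[c C] g]|]; last by rewrite smulx0.
move=> [nA ia ib] [<- nC ic]; rewrite [sadj _]/=.
case: (word_cmpP a c) => [m E|m E _|h1 h2].
- subst c; rewrite smul_r; rewrite /mk_triple; case: eqP => [_|n0].
    by rewrite smulx0.
  rewrite smul_l; apply: E_mk; apply: idealw_meetl; exact: idealw_act.
- subst a; rewrite smul_l; rewrite /mk_triple; case: eqP => [_|n0].
    by rewrite smulx0.
  rewrite smul_diag; apply: E_mk; exact: idealw_meetl.
- by rewrite (smul_inc _ _ _ _ h2 h1) smulx0.
Qed.

End Words.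

(** * Tight filters *)

Section Points.
Context {d : Order.disp_t} {B : cbDistrLatticeType d} {L : choiceType}.
Variable D : gbds B L.
Local Notation triple := (@triple d B L).

Definition sgp := {s : triple | S_set D s}.
HB.instance Definition _ := gen_eqMixin sgp.
HB.instance Definition _ := gen_choiceMixin sgp.

Implicit Types (s t u e f g : sgp).

Definition sm s t : sgp := exist _ _ (S_smul (svalP s) (svalP t)).
Definition sj s : sgp := exist _ _ (S_sadj (svalP s)).
Definition s0 : sgp := exist (S_set D) None I.
Definition idem e : Prop := E_set D (sval e).
Definition mkE (e : triple) (h : E_set D e) : sgp := exist _ e (E_S h).

Lemma sgp_inj s t : sval s = sval t -> s = t.
Proof. by case: s t => [s hs] [t ht] /= h; exact: eq_exist. Qed.

Lemma smA s t u : sm s (sm t u) = sm (sm s t) u.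
Proof. by apply: sgp_inj; exact: smulA. Qed.
Lemma sjK s : sj (sj s) = s. Proof. by apply: sgp_inj; exact: sadjK. Qed.
Lemma sjM s t : sj (sm s t) = sm (sj t) (sj s).
Proof. by apply: sgp_inj; exact: sadjM. Qed.
Lemma smVK s : sm (sm s (sj s)) s = s.
Proof. by apply: sgp_inj; exact: (smulVK (svalP s)). Qed.
Lemma sm0s s : sm s0 s = s0. Proof. by apply: sgp_inj. Qed.
Lemma sms0 s : sm s s0 = s0. Proof. by apply: sgp_inj; exact: smulx0. Qed.
Lemma idemM e f : idem e -> idem f -> idem (sm e f). Proof. exact: E_smul. Qed.
Lemma idemC e f : idem e -> idem f -> sm e f = sm f e.
Proof. by move=> he hf; apply: sgp_inj; exact: E_smulC. Qed.
Lemma idemxx e : idem e -> sm e e = e.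
Proof. by move=> he; apply: sgp_inj; exact: E_smulxx. Qed.
Lemma idemV e : idem e -> sj e = e.
Proof. by move=> he; apply: sgp_inj; exact: (E_sadj he). Qed.
Lemma idem_conj s e : idem e -> idem (sm (sj s) (sm e s)).
Proof. by move=> he; apply: E_conj => //; exact: (svalP s). Qed.
Lemma idem_conj' s e : idem e -> idem (sm s (sm e (sj s))).
Proof. by move=> he; have := idem_conj (sj s) he; rewrite sjK. Qed.

Lemma idem_dom s : idem (sm (sj s) s).
Proof.
case: s => [[[[a A] b]|] hs] //; case: (hs) => [nA ia ib].
rewrite /idem; set x := sval _.
have -> : x = mk_triple b (Order.meet A A) b by rewrite /x [LHS]/= eqxx.
by apply: E_mk; exact: idealw_meetl.
Qed.

Lemma idem_ran s : idem (sm s (sj s)).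
Proof. by have := idem_dom (sj s); rewrite sjK. Qed.

Definition dom s := sm (sj s) s.

Lemma sm_dom s : sm s (dom s) = s. Proof. by rewrite smA smVK. Qed.

Lemma dom_idem e : idem e -> dom e = e.
Proof. by move=> he; rewrite /dom idemV// idemxx. Qed.

Lemma domM s t : dom (sm s t) = sm (sj t) (sm (dom s) t).
Proof. by rewrite /dom sjM !smA. Qed.

Lemma domMe s e : idem e -> dom (sm s e) = sm (dom s) e.
Proof.
move=> he; rewrite domM idemV// smA (idemC he (idem_dom s)) -smA.
by rewrite (idemxx he).
Qed.

Lemma sm_e s e : idem e -> sm e s = sm s (sm (sj s) (sm e s)).
Proof.
move=> he; rewrite !smA -(smA _ e s) (smA _ e) (idemC (idem_ran s) he).
by rewrite -!smA (smA s) smVK.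
Qed.

Definition compat s t := exists e, [/\ idem e, sm s e = sm t e & sm s e <> s0].

Lemma cat_cancelr (a b m : seq L) : a ++ m = b ++ m -> a = b.
Proof.
by move=> /(congr1 rev); rewrite !rev_cat => /cat_cancel /(congr1 rev); rewrite !revK.
Qed.

(** A non-zero product with an idempotent extends both words by the same suffix [m], which is empty
    if the word of the idempotent is a prefix of [b]. *)
Lemma compat_form s e : idem e -> sm s e <> s0 -> exists a A b m X,
  sval s = Some (a, A, b) /\ sval (sm s e) = Some (a ++ m, X, b ++ m).
Proof.
move=> ie n0; have {}n0 : smul D (sval s) (sval e) <> None.
  by move=> h; apply: n0; exact: sgp_inj.
rewrite -[sval (sm _ _)]/(smul D (sval s) (sval e)); rewrite /idem in ie; move: ie n0.
case: (sval s) => [[[a A] b]|] //.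
case: (sval e) => [[[w F] w']|]; last by rewrite smulx0.
move=> [<- _ _] n0.
suff [m [X E]] : exists m X, smul D (Some (a, A, b)) (Some (w, F, w)) =
    mk_triple (a ++ m) X (b ++ m).
  exists a, A, b, m, X; split=> //; rewrite -[LHS]/(smul D (Some (a, A, b)) (Some (w, F, w))).
  move: n0; rewrite {}E /mk_triple.
  by case: eqP => [_ /(_ erefl)|].
move: n0; case: (word_cmpP b w) => [m ->|m -> _|h1 h2].
- by rewrite smul_l => _; exists m; eexists.
- by rewrite smul_r => _; exists [::]; rewrite !cats0; eexists.
- by rewrite smul_inc.
Qed.

(** Agreement below one non-zero idempotent gives the same extended words on both sides. After
    cancellation one element is (c k, A, g k) and the other (c, C, g), and both products have middle
    entry A meet the image of C under k. This rigidity of S is what gives it binary meets. *)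
Lemma compat_meet s t : compat s t -> sm s (dom t) = sm t (dom s).
Proof.
have aux s' t' (c k : seq L) A C (g : seq L) : sval s' = Some (c ++ k, A, g ++ k) ->
    sval t' = Some (c, C, g) -> sm s' (dom t') = sm t' (dom s').
  move=> Es Et; apply: sgp_inj; rewrite -[LHS]/(smul D (sval s') (smul D (sadj (sval t')) (sval t'))).
  rewrite -[RHS]/(smul D (sval t') (smul D (sadj (sval s')) (sval s'))) Es Et.
  have [nA ia ib] : S_set D (Some (c ++ k, A, g ++ k)) by rewrite -Es; exact: (svalP s').
  have [nC ic ig] : S_set D (Some (c, C, g)) by rewrite -Et; exact: (svalP t').
  rewrite -[sadj (Some (c, C, g))]/(Some (g, C, c)) -[sadj (Some (c ++ k, A, g ++ k))]/(Some (g ++ k, A, c ++ k)).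
  rewrite !smul_diag !meetxx !mk_tripleE//.
  by rewrite smul_r smul_l meetC.
move=> [e [ie E n0]].
have [a [A [b [m [X [Es EX]]]]]] := compat_form ie n0.
have n1 : sm t e <> s0 by rewrite -E.
have [c [C [g [n [Y [Et EY]]]]]] := compat_form ie n1.
have [ac bg] : a ++ m = c ++ n /\ b ++ m = g ++ n.
  by move: EX; rewrite E EY => -[-> _ ->].
case/orP: (prefix_cat2 bg) => /prefixP[k Ek]; subst.
  move: bg; rewrite -catA => /cat_cancel Em; subst m.
  move: ac; rewrite catA => /cat_cancelr Ea; subst c.
  by rewrite (aux t s a k C A b Et Es).
move: bg; rewrite -catA => /cat_cancel Em; subst n.
move: ac; rewrite catA => /cat_cancelr Ea; subst a.
exact: (aux s t c k A C g Es Et).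
Qed.

(* The largest idempotent below both domains on which s and t agree. *)
Definition sd s t : sgp :=
  if pselect (compat s t) is left _ then sm (dom s) (dom t) else s0.

Definition smeet s t := sm s (sd s t).

Lemma idem_sd s t : idem (sd s t).
Proof.
by rewrite /sd; case: pselect => // _; apply: idemM; exact: idem_dom.
Qed.

Lemma sm_sd s t : sm s (sd s t) = sm t (sd s t).
Proof.
rewrite /sd; case: pselect => [c|_]; last by rewrite !sms0.
rewrite {2}(idemC (idem_dom s) (idem_dom t)).
by rewrite (smA s) (smA t) !sm_dom (compat_meet c).
Qed.

Lemma sd_max s t e : idem e -> sm s e = sm t e ->
  sm (sd s t) (sm e (dom s)) = sm e (dom s).
Proof.
move=> ie E; have Ed : sm (dom s) e = sm (dom t) e by rewrite -!domMe// E.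
have [n0|n0] := pselect (sm s e = s0).
  have -> : sm e (dom s) = s0.
    by rewrite (idemC ie (idem_dom s)) /dom -smA n0 sms0.
  by rewrite sms0.
rewrite /sd; case: pselect => [c|]; last by case; exists e.
have hs := idem_dom s; have ht := idem_dom t; rewrite -/(dom s) -/(dom t) in hs ht.
rewrite (idemC ie hs) (idemC hs ht) -smA (smA (dom s)) (idemxx hs) Ed smA.
by rewrite (idemxx ht).
Qed.

Lemma sd_dom s t : sm (dom s) (sd s t) = sd s t.
Proof.
rewrite /sd; case: pselect => // _; last by rewrite sms0.
by rewrite smA (idemxx (idem_dom s)).
Qed.

Lemma dom_smeet s t : dom (smeet s t) = sd s t.
Proof. by rewrite /smeet domMe ?sd_dom//; exact: idem_sd. Qed.

Lemma smeet_le s t : s = sm t (dom s) -> smeet s t = s.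
Proof.
move=> E; have := @sd_max s t (dom s) (idem_dom s).
rewrite sm_dom => /(_ E); rewrite (idemxx (idem_dom s)) => Ed.
by rewrite /smeet (idemC (idem_sd _ _) (idem_dom s)) in Ed *; rewrite -{1}(sm_dom s) -smA Ed sm_dom.
Qed.

Lemma smeet_lel s t u : s = sm u (dom s) -> smeet s t = sm u (dom (smeet s t)).
Proof. by move=> E; rewrite dom_smeet -sd_dom smA -E. Qed.

(** In contrast to [is_cover], the members of [F] need not lie below [e]; [mem_covers] passes to the
    products [sm e f]. *)
Definition covers e (F : seq sgp) := forall f, idem f -> f <> s0 -> sm f e = f ->
  exists2 z, z \in F & sm f z <> s0.

Record pt := Pt { pt_set : set triple; pt_tight : tight_filter D pt_set }.

Definition pmem (x : pt) e := pt_set x (sval e).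

Implicit Types x y : pt.

Lemma mem_idem x e : pmem x e -> idem e.
Proof. by move=> xe; have [fx _] := pt_tight x; exact: (filter_sub fx). Qed.

Lemma mem0 x : ~ pmem x s0.
Proof. by have [fx _] := pt_tight x; exact: (filter_zero fx). Qed.

Lemma mem_ex x : exists e, pmem x e.
Proof.
have [fx _] := pt_tight x; have [e xe] := filter_neq0 fx.
by exists (mkE (filter_sub fx xe)).
Qed.

Lemma mem_up x e f : idem f -> pmem x e -> sm e f = e -> pmem x f.
Proof.
move=> hf xe E; have [fx _] := pt_tight x.
apply: (filter_up fx xe hf); rewrite /E_le.
by have := congr1 sval E.
Qed.

Lemma memM x e f : idem e -> idem f -> pmem x (sm e f) <-> pmem x e /\ pmem x f.
Proof.
move=> he hf; split=> [xef|[xe xf]].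
  split; apply: mem_up xef _ => //; last by rewrite -smA idemxx.
  by rewrite -smA (idemC hf he) smA idemxx.
have [fx _] := pt_tight x; have [g [xg ge gf]] := filter_down fx xe xf.
have hg := filter_sub fx xg.
apply: (@mem_up x (mkE hg)) => //; first exact: idemM.
by apply: sgp_inj; rewrite /= smulA ge gf.
Qed.

Lemma mem_covers x e F : pmem x e -> (forall f, f \in F -> idem f) -> covers e F ->
  exists2 f, f \in F & pmem x f.
Proof.
move=> xe iF cF; have ie := mem_idem xe.
pose Z : set triple := [set` [seq sval (sm e f) | f <- F]].
have [] := (pt_tight x).2 (sval e) Z xe.
  split; first exact: finite_seq.
    move=> _ /mapP[f /iF hf ->]; split; first exact: idemM.
    rewrite /E_le; have : sm (sm e f) e = sm e f.
      by rewrite -smA (idemC hf ie) smA idemxx.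
    by move/(congr1 sval).
  move=> y Ey n0 ye; have [||f fF nf] := cF (mkE Ey) Ey.
  - by move/(congr1 sval).
  - exact: sgp_inj.
  exists (sval (sm e f)); first by apply/mapP; exists f.
  move=> h; apply: nf; apply: sgp_inj.
  by have := h; rewrite [sval (sm e f)]/= smulA ye.
move=> _ [/mapP[f fF ->] xf]; exists f => //.
by have /(memM x ie (iF f fF))[] : pmem x (sm e f) by [].
Qed.

Lemma pt_eq x y : (forall e, idem e -> pmem x e <-> pmem y e) -> x = y.
Proof.
move=> h; have E : pt_set x = pt_set y.
  apply/seteqP; split=> e xe.
    by have [fx _] := pt_tight x; have := filter_sub fx xe => he;
       exact: (h (mkE he) he).1.
  by have [fx _] := pt_tight y; have := filter_sub fx xe => he;
     exact: (h (mkE he) he).2.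
case: x y E {h} => [X hX] [Y hY] /= E; subst; congr Pt; exact: Prop_irrelevance.
Qed.

(** Points are produced by this criterion: ultrafilters in [pt_exists], images under S in [cact_ex],
    and limits in [ultra_cvg_Th]. *)
Lemma pt_of (P : sgp -> Prop) : (forall e, P e -> idem e) -> (exists e, P e) -> ~ P s0 ->
  (forall e f, idem e -> idem f -> P (sm e f) <-> P e /\ P f) ->
  (forall e F, P e -> (forall f, f \in F -> idem f) -> covers e F ->
    exists2 f, f \in F & P f) ->
  exists x, forall e, pmem x e <-> P e.
Proof.
move=> Pi [e0 Pe0] P0 PM Pt'.
pose X : set triple := [set e | exists2 f, P f & e = sval f].
have XE e : X (sval e) <-> P e.
  by split=> [[f Pf /sgp_inj ->]//|Pe]; exists e.
suff tX : tight_filter D X by exists (Pt tX).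
split; first split.
- by move=> _ [f Pf ->]; exact: Pi.
- by exists (sval e0), e0.
- move=> _ f [e Pe ->] hf ef; have : P (sm e (mkE hf)).
    by rewrite (_ : sm _ _ = e)//; exact: sgp_inj.
  by move=> /(PM e (mkE hf) (Pi _ Pe) hf)[_ Pf]; exists (mkE hf).
- move=> _ _ [e Pe ->] [f Pf ->]; have ie := Pi _ Pe; have jf := Pi _ Pf.
  exists (sval (sm e f)); split.
  + by exists (sm e f) => //; apply/PM.
  + rewrite /E_le; have : sm (sm e f) e = sm e f.
      by rewrite -smA (idemC jf ie) smA idemxx.
    by move/(congr1 sval).
  + rewrite /E_le; have : sm (sm e f) f = sm e f by rewrite -smA idemxx.
    by move/(congr1 sval).
- by move=> [f Pf E]; apply: P0; rewrite (_ : s0 = f)//; apply: sgp_inj.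
move=> _ Z [e Pe ->] [/finite_seqP[zs EZ] Zs Zc].
have Z1 z : z \in zs -> E_set D z /\ E_le D z (sval e) by move=> hz; apply: Zs; rewrite EZ.
pose phi z := if pselect (E_set D z) is left h then mkE h else s0.
have phiE z : z \in zs -> sval (phi z) = z.
  by move=> /Z1[hz _]; rewrite /phi; case: pselect.
have [|f hf f0 fe|f /mapP[z hz ->] Pf] := Pt' e [seq phi z | z <- zs] Pe.
- by move=> f /mapP[z hz ->]; rewrite /idem phiE//; have [] := Z1 z hz.
- have [||z + zf] := Zc (sval f) hf.
  + by move=> h; apply: f0; apply: sgp_inj.
  + by rewrite /E_le; have /(congr1 sval) := fe.
  rewrite EZ => /= hz; exists (phi z); first by apply/mapP; exists z.
  by move=> /(congr1 sval)/=; rewrite phiE.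
exists z; split; first by rewrite EZ.
by exists (phi z) => //; rewrite phiE.
Qed.

(** If [F] does not cover [e], some non-zero y below [e] is orthogonal to all of [F]. A maximal
    filter containing y is tight, contains [e] and avoids [F]. *)
Lemma pt_exists e F : idem e -> (forall f, f \in F -> idem f) -> ~ covers e F ->
  exists x, pmem x e /\ forall f, f \in F -> ~ pmem x f.
Proof.
move=> ie iF nc.
have [y [iy y0 ye yF]] : exists y : sgp, [/\ idem y, y <> s0, sm y e = y &
    forall f, f \in F -> sm y f = s0].
  apply: contrapT => h; apply: nc => y iy y0 ye; apply: contrapT => h'.
  apply: h; exists y; split => // f fF; apply: contrapT => h; apply: h'.
  by exists f.
(* Membership of y is only required of non-empty sets, so that the union of the empty chain also
   satisfies [P]. *)
pose P (X : set sgp) := [/\ X `<=` idem, forall e f, X e -> X f -> X (sm e f),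
  ~ X s0 & forall e, X e -> X y].
have [|X [[Xi XM X0 Xy] Xmax]] := @Zorn_bigcup _ P.
  move=> C CP Ct; split.
  - by move=> f [X /CP[+ _ _ _]]; exact.
  - move=> f g [X CX Xf] [Y CY Yg]; have [XY|YX] := Ct _ _ CX CY.
      by exists Y => //; have [_ + _ _] := CP _ CY; apply => //; exact: XY.
    by exists X => //; have [_ + _ _] := CP _ CX; apply => //; exact: YX.
  - by move=> [X /CP[_ _ + _]]; exact.
  - by move=> f [X CX Xf]; exists X => //; have [_ _ _] := CP _ CX; apply; exact: Xf.
have {}Xy : X y.
  apply: contrapT => nX; apply: (Xmax [set y]).
    split; last by move=> /(_ y erefl).
    by move=> f Xf; case: nX; exact: Xy Xf.
  split=> [_ -> //|f g -> ->|E|f _] //; first by rewrite /= idemxx.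
  by apply: y0; rewrite E.
(* Maximality: if no member of X is orthogonal to z, the upward closure of the products of z with
   members of X still satisfies [P], hence equals X. *)
have dich z : idem z -> X z \/ exists2 f, X f & sm f z = s0.
  move=> iz; have [[f Xf fz]|h] := pselect (exists2 f, X f & sm f z = s0).
    by right; exists f.
  left; pose X' : set sgp := [set w | idem w /\ exists2 f, X f &
    sm (sm f z) w = sm f z].
  have XX' : X `<=` X'.
    move=> w Xw; split; first exact: Xi.
    exists w => //; rewrite -smA (idemC iz (Xi _ Xw)) smA idemxx//; exact: Xi.
  have X'z : X' z by split=> //; exists y => //; rewrite -smA idemxx.
  have : ~ X `<` X'.
    move=> h1; apply: Xmax h1 _; split.
    - by move=> w [].
    - move=> w1 w2 [i1 [f1 X1 E1]] [i2 [f2 X2 E2]]; split; first exact: idemM.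
      exists (sm f1 f2); first exact: XM.
      have if1 := Xi _ X1; have if2 := Xi _ X2.
      rewrite -(smA f1) (idemC if2 iz) (smA f1) -(smA _ f2) (smA f2) (idemC if2 i1).
      rewrite -(smA w1) (smA _ w1) E1 -smA (smA z).
      by rewrite (idemC iz if2) E2 -smA (idemC if2 iz).
    - move=> [_ [f Xf]]; rewrite sms0 => E; apply: h; exists f => //.
    - by move=> *; exact: XX'.
  by move=> nX; apply: contrapT => nz; apply: nX; split=> // /(_ z X'z).
have excl f z : X f -> X z -> sm f z <> s0.
  by move=> Xf Xz E; apply: X0; rewrite -E; exact: XM.
have up f g : X f -> idem g -> sm f g = f -> X g.
  move=> Xf ig fg; have [//|[w Xw wg]] := dich g ig.
  by case: (excl w f Xw Xf); rewrite -fg (idemC (Xi _ Xf) ig) smA wg sm0s.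
have [x hx] : exists x, forall e, pmem x e <-> X e.
  apply: pt_of => //; first by exists y.
    move=> f g hf hg; split=> [Xfg|[Xf Xg]]; last exact: XM.
    split; apply: up Xfg _ _ => //; last by rewrite -smA idemxx.
    by rewrite -smA (idemC hg hf) smA idemxx.
  move=> f G Xf iG cG; apply: contrapT => h.
  (* If no member of the cover belonged to X, each would be orthogonal to some member of X; the
     product of these is in X and orthogonal to the whole cover. *)
  have [g Xg gG] : exists2 g, X g & forall z, z \in G -> sm g z = s0.
    have nG z : z \in G -> ~ X z by move=> zG Xz; apply: h; exists z.
    elim: G iG nG {cG h} => [|z G IH] iG nG; first by exists y.
    have [||g Xg gG] := IH.
    - by move=> w wG; apply: iG; rewrite inE wG orbT.
    - by move=> w wG; apply: nG; rewrite inE wG orbT.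
    have [|Xz|[w Xw wz]] := dich z; first by apply: iG; rewrite inE eqxx.
      by case: (nG z) => //; rewrite inE eqxx.
    exists (sm g w); first exact: XM.
    move=> v; rewrite inE => /orP[/eqP ->|vG]; first by rewrite -smA wz sms0.
    by rewrite (idemC (Xi _ Xg) (Xi _ Xw)) -smA gG// sms0.
  have [|||z zG nz] := cG (sm f g).
  - by apply: idemM; exact: Xi.
  - exact: excl.
  - by rewrite -smA (idemC (Xi _ Xg) (Xi _ Xf)) smA idemxx//; exact: Xi.
  by apply: nz; rewrite -smA gG// sms0.
exists x; split; first by apply/hx; apply: up Xy _ ye.
move=> f fF /hx Xf; apply: X0; rewrite -(yF f fF); exact: XM.
Qed.

Definition cact s x := exists y, forall e, pmem y e <-> idem e /\ pmem x (sm (sj s) (sm e s)).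

(** Conjugation by s is multiplicative on idempotents. For tightness, a cover of e is carried by f
    -> s^* f s to a cover of s^* e s: an idempotent f below s^* e s is tested through s f s^*, which
    is non-zero and below e. *)
Lemma cact_ex s x : pmem x (dom s) -> cact s x.
Proof.
move=> xs; have conjM e f : idem e -> idem f -> sm (sj s) (sm (sm e f) s) =
    sm (sm (sj s) (sm e s)) (sm (sj s) (sm f s)).
  by move=> ie jf; rewrite -!smA {1}(sm_e s jf).
apply: pt_of.
- by move=> e [].
- exists (sm s (sj s)); split; first exact: idem_ran.
  by rewrite smVK.
- by move=> [_]; rewrite sm0s sms0; exact: mem0.
- move=> e f ie jf; rewrite conjM//.
  have cM := memM x (idem_conj s ie) (idem_conj s jf).
  split=> [[_ /cM[xe xf]]|[[_ xe] [_ xf]]] //.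
  by split; [exact: idemM|exact/cM].
- move=> e F [ie xe] iF cF.
  have [|f hf nf fe|_ /mapP[f fF ->] xf] :=
    @mem_covers x (sm (sj s) (sm e s)) [seq sm (sj s) (sm f s) | f <- F] xe.
  + by move=> _ /mapP[f /iF hf ->]; exact: idem_conj.
  + have fd : sm f (dom s) = f.
      by rewrite -{1}fe /dom -!smA (smA s) smVK fe.
    have key g : idem g -> sm (sm s (sm f (sj s))) g = sm s (sm (sm f (sm (sj s) (sm g s))) (sj s)).
      move=> ig; rewrite -!smA; congr (sm s (sm f _)).
      have := congr1 sj (sm_e s ig); rewrite !sjM sjK (idemV ig) => ->.
      by rewrite -!smA.
    have [|E|| z zF nz] := cF (sm s (sm f (sj s))).
    * exact: idem_conj'.
    * apply: nf; rewrite -fd (idemC hf (idem_dom s)).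
      have -> : sm (dom s) f = sm (sj s) (sm (sm s (sm f (sj s))) s).
        by rewrite -!smA -[sm (sj s) s]/(dom s) fd smA.
      by rewrite E sm0s sms0.
    * by rewrite key// fe.
    exists (sm (sj s) (sm z s)); first by apply/mapP; exists z.
    by move=> E; apply: nz; rewrite (key z (iF z zF)) E sm0s sms0.
  + by exists f => //; split => //; exact: iF.
Qed.

End Points.

(** * The action of S on points, germs, and groupoids of germs *)

Section Action.
Context {d : Order.disp_t} {B : cbDistrLatticeType d} {L : choiceType}.
Variable D : gbds B L.
Local Notation sgp := (sgp D).
Local Notation pt := (pt D).
Implicit Types (s t u e f g : sgp) (x y : pt).

Definition sact s x : pt :=
  if pselect (pmem x (dom s)) is left h then sval (cid (cact_ex h)) else x.

Lemma sactE s x e : pmem x (dom s) ->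
  pmem (sact s x) e <-> idem e /\ pmem x (sm (sj s) (sm e s)).
Proof. by rewrite /sact; case: pselect => // h _; case: cid => y hy /=. Qed.

Lemma mem_dom_sj s x : pmem x (dom s) -> pmem (sact s x) (dom (sj s)).
Proof.
move=> xs; apply/sactE => //; split; first exact: idem_dom.
by rewrite /dom sjK smVK.
Qed.

Lemma sactK s x : pmem x (dom s) -> sact (sj s) (sact s x) = x.
Proof.
move=> xs; apply: pt_eq => e ie; rewrite sactE; last exact: mem_dom_sj.
have ic : idem (sm (sj (sj s)) (sm e (sj s))) by exact: idem_conj.
have E : sm (sj s) (sm (sm (sj (sj s)) (sm e (sj s))) s) = sm (dom s) (sm e (dom s)).
  by rewrite sjK /dom !smA.
have ids := idem_dom s; rewrite -/(dom s) in ids.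
split=> [[_]|xe].
  rewrite sactE// E => -[_ /memM[]//]; first exact: idemM.
  by move=> _ /memM[].
split=> //; apply/sactE => //; split=> //; rewrite E.
apply/memM => //; first exact: idemM.
by split=> //; apply/memM.
Qed.

Lemma mem_dom_sm s t x : pmem x (dom (sm s t)) <->
  pmem x (dom t) /\ pmem (sact t x) (dom s).
Proof.
have ids := idem_dom s; have idt := idem_dom t; rewrite -/(dom s) -/(dom t) in ids idt.
rewrite domM; split=> [xst|[xt]].
  have xt : pmem x (dom t).
    by apply: mem_up xst _ => //; rewrite /dom -!smA (smA t) smVK.
  by split=> //; apply/sactE.
by move=> /(sactE _ xt)[].
Qed.

Lemma sact_sm s t x : pmem x (dom t) -> pmem (sact t x) (dom s) ->
  sact (sm s t) x = sact s (sact t x).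
Proof.
move=> xt xs; have xst : pmem x (dom (sm s t)) by apply/mem_dom_sm.
apply: pt_eq => e ie; rewrite (sactE _ xst) (sactE _ xs) (sactE _ xt).
rewrite sjM !smA; split=> [[_ h]|[_ [_ h]]]; split => //; split => //.
by rewrite -smA; exact: idem_conj.
Qed.

Lemma sact_idem e x : idem e -> pmem x e -> sact e x = x.
Proof.
move=> ie xe; apply: pt_eq => f jf; rewrite sactE; last by rewrite dom_idem.
rewrite idemV// (memM x ie (idemM jf ie)) (memM x jf ie).
by split=> [[_ [_ []]]|].
Qed.

Lemma sact_germ s t x e : pmem x (dom s) -> pmem x (dom t) -> pmem x e ->
  sm s e = sm t e -> sact s x = sact t x.
Proof.
move=> xs xt xe E; have ie := mem_idem xe.
have h u : pmem x (dom u) -> sact (sm u e) x = sact u x.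
  by move=> xu; have ex := sact_idem ie xe; rewrite sact_sm ?ex ?(dom_idem ie).
by rewrite -h// E h.
Qed.

Lemma mem_sd_dom s t x : pmem x (sd s t) -> pmem x (dom s) /\ pmem x (dom t).
Proof.
rewrite /sd; case: pselect => [_|_ /mem0//]; apply: (memM x _ _).1; exact: idem_dom.
Qed.

(** Equality of germs at x thus becomes membership of the single idempotent [sd s t], with no
    existential quantifier left. *)
Lemma mem_sd s t x e : pmem x (dom s) -> pmem x e -> sm s e = sm t e -> pmem x (sd s t).
Proof.
move=> xs xe E; have ie := mem_idem xe; have ids := idem_dom s; rewrite -/(dom s) in ids.
apply: (@mem_up _ _ _ D x (sm e (dom s))) => //; first exact: idem_sd.
  by apply/memM.
rewrite -{2}(sd_max ie E); apply: idemC; [exact: idemM|exact: idem_sd].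
Qed.

Lemma sd_eqs s x : pmem x (dom s) -> pmem x (sd s s).
Proof. by move=> xs; apply: (@mem_sd s s x (dom s)). Qed.

Lemma sd_sym s t x : pmem x (sd s t) -> pmem x (sd t s).
Proof.
move=> h; have [xs xt] := mem_sd_dom h.
by apply: (mem_sd xt h); rewrite sm_sd.
Qed.

Lemma sd_trans s t u x : pmem x (sd s t) -> pmem x (sd t u) -> pmem x (sd s u).
Proof.
move=> h1 h2; have [xs _] := mem_sd_dom h1.
have i1 := idem_sd s t; have i2 := idem_sd t u.
apply: (@mem_sd s u x (sm (sd s t) (sd t u))) => //; first by apply/memM.
by rewrite smA sm_sd -smA (idemC i1 i2) smA sm_sd -smA.
Qed.

Lemma sact_sd s t x : pmem x (sd s t) -> sact s x = sact t x.
Proof.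
by move=> h; have [xs xt] := mem_sd_dom h; apply: sact_germ h _ => //; exact: sm_sd.
Qed.

Lemma mem_sd_meet s t x : pmem x (sd s t) -> pmem x (sd (smeet s t) s).
Proof.
move=> h; apply: (@mem_sd _ _ x (sd s t)) => //; first by rewrite dom_smeet.
by rewrite /smeet -smA idemxx//; exact: idem_sd.
Qed.

Definition incell s (F : seq sgp) x : Prop :=
  pmem x (dom s) /\ forall f, f \in F -> ~ pmem x f.

(* A groupoid is recognised as the tight groupoid through the maps sending
   (s, x) to the germ of s at x. *)
Record model (G : groupoid) := Model {
  mk : sgp -> pt -> gamb G;
  mk_arr : forall z, garr z <-> exists s x, pmem x (dom s) /\ z = mk s x;
  mk_eq : forall s t x y, pmem x (dom s) -> pmem y (dom t) ->
    mk s x = mk t y <-> x = y /\ pmem x (sd s t);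
  mk_src : forall s t x y, pmem x (dom s) -> pmem y (dom t) ->
    gsrc (mk s x) = gsrc (mk t y) <-> x = y;
  mk_rng : forall s t x y, pmem x (dom s) -> pmem y (dom t) ->
    grng (mk s x) = grng (mk t y) <-> sact s x = sact t y;
  mk_srcrng : forall s t x y, pmem x (dom s) -> pmem y (dom t) ->
    gsrc (mk s x) = grng (mk t y) <-> x = sact t y;
  mk_mul : forall s t x, pmem x (dom t) -> pmem (sact t x) (dom s) ->
    gmul (mk s (sact t x)) (mk t x) = mk (sm s t) x;
  mk_inv : forall s x, pmem x (dom s) -> ginv (mk s x) = mk (sj s) (sact s x);
  mk_base : forall Z s x, gbase Z -> pmem x (dom s) -> Z (mk s x) ->
    exists t F, [/\ pmem x (sd s t), forall f, f \in F -> idem f, incell t F x &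
      forall y, incell t F y -> Z (mk t y)];
  mk_cell : forall s F, s <> s0 D -> (forall f, f \in F -> idem f) ->
    gbase [set z | exists2 x, incell s F x & z = mk s x]
}.

End Action.

(** * Representations of the inverse semigroup *)

Section TightRep.
Context {R : realType} {d : Order.disp_t} {B : cbDistrLatticeType d} {L : choiceType}.
Variable D : gbds B L.
Context {A : cstarAlgType R} {p : B -> A} {s : L -> B -> A}.
Hypothesis rep : gbds_rep D p s.
Local Notation sgp := (sgp D).
Local Notation meet := Order.meet.
Local Notation "x ** y" := (cmul x y) (at level 40, left associativity).
Local Notation "x ^+" := (cadj x) (at level 2).

Lemma cadjM0 (z : A) : cadj z ** z = 0 -> z = 0.
Proof.
move=> h; apply: nrm_eq0; apply/eqP; rewrite -sqrf_eq0.
by rewrite -nrm_adjM h nrm0.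
Qed.

Lemma projJ X : cadj (p X) = p X. Proof. by have [] := rep_proj rep X. Qed.

Lemma projM X Y : p X ** p Y = p (meet X Y).
Proof. by rewrite (rep_meet rep). Qed.

Lemma projMr X Y : (X <= Y)%O -> p Y ** p X = p X.
Proof. by rewrite projM leEmeet meetC => /eqP ->. Qed.

(** For the difference z of the two sides the relation for s^* s gives z^* z = 0, since all four
    terms equal p of the meet. *)
Lemma isoM a X Y : ideal D a X -> s a X ** p Y = s a (meet X Y).
Proof.
move=> iX; have iXY := ideal_meet Y iX.
have adj Z Z' : ideal D a Z -> ideal D a Z' -> cadj (s a Z) ** s a Z' = p (meet Z Z').
  by move=> iZ iZ'; rewrite (rep_adj rep) ?eqxx.
apply/eqP; rewrite -subr_eq0; apply/eqP/cadjM0.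
have adj' Z Z' W : ideal D a Z -> ideal D a Z' ->
    cadj (s a Z) ** (s a Z' ** W) = p (meet Z Z') ** W.
  by move=> iZ iZ'; rewrite cmulA adj.
rewrite cadjB cadjM projJ cmulBl !cmulBr -!cmulA !adj'// !adj// !projM meetxx.
have -> : meet Y (meet X Y) = meet X Y by rewrite meetC -meetA meetxx.
have -> : meet Y (meet X (meet X Y)) = meet X Y.
  by rewrite (meetA X) meetxx meetC -meetA meetxx.
have -> : meet (meet (meet X Y) X) Y = meet X Y.
  by rewrite (meetC (meet X Y)) meetA meetxx -meetA meetxx.
by rewrite meetxx !subrr.
Qed.

(** The partial isometry s_(w, theta_w(X)), multiplied out along the successive images of X. *)
Fixpoint gW (w : seq L) (X : B) : A :=
  if w is a :: w' then s a (act D a X) ** gW w' (act D a X) else p X.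

Let iact a X : ideal D a (act D a X). Proof. exact: ideal_act (lexx _). Qed.

Lemma gW_comm w X Z : p Z ** gW w X = gW w X ** p (actw D w Z).
Proof.
elim: w X Z => [|a w IH] X Z /=; first by rewrite !projM meetC.
by rewrite cmulA (rep_comm rep)// -cmulA IH cmulA.
Qed.

Lemma gW_meet w X Z : gW w (meet X Z) = p Z ** gW w X.
Proof.
elim: w X Z => [|a w IH] X Z /=; first by rewrite projM meetC.
rewrite act_meet -isoM// IH cmulA -(cmulA (s _ _)) projM meetxx.
by rewrite -(rep_comm rep)// cmulA.
Qed.

Lemma gW_adj w X Z : cadj (gW w Z) ** gW w X = p (actw D w (meet Z X)).
Proof.
elim: w X Z => [|a w IH] X Z /=; first by rewrite projJ projM.
rewrite cadjM -cmulA (cmulA (cadj (s _ _))) (rep_adj rep)// eqxx gW_comm.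
by rewrite cmulA IH -act_meet projM meetxx.
Qed.

Lemma gW_cat u v X : gW (u ++ v) X = gW u X ** gW v (actw D u X).
Proof.
elim: u X => [|a u IH] X /=; last by rewrite IH cmulA.
by rewrite -gW_meet meetxx.
Qed.

(** The partial isometry s_(w, X) for X in the ideal of w. Below the first letter a witness Y of
    membership has to be chosen; [sW_cons] shows that any witness gives the same element. Off the
    ideal the value is 0. *)
Definition sW (w : seq L) (X : B) : A :=
  if w is a :: w' then
    if pselect (exists2 Y, ideal D a Y & (X <= actw D w' Y)%O) is left h
    then s a (sval (cid2 h)) ** gW w' (sval (cid2 h)) ** p X else 0
  else p X.

Lemma sW_cons a w X Y : ideal D a Y -> (X <= actw D w Y)%O ->
  sW (a :: w) X = s a Y ** gW w Y ** p X.
Proof.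
move=> iY XY; rewrite /sW; case: pselect => [h|]; last by case; exists Y.
case: cid2 => Z /= iZ XZ.
(* Two witnesses are compared through their meet. *)
have key U V : ideal D a U -> (X <= actw D w V)%O ->
    s a (meet U V) ** gW w (meet U V) ** p X = s a U ** gW w U ** p X.
  move=> iU XV; rewrite -isoM// gW_meet !cmulA -(cmulA (s a U)) projM meetxx.
  by rewrite -(cmulA (s a U)) gW_comm -!cmulA projMr.
by rewrite -(key Z Y)// -(key Y Z)// meetC.
Qed.

Lemma sW_gW w X Z : (X <= actw D w Z)%O -> gW w Z ** p X = sW w X.
Proof.
case: w => [|a w] XZ /=; first by rewrite projMr.
by rewrite -(sW_cons (Y := act D a Z)).
Qed.

Lemma sW_p w X Z : idealw D w X -> sW w X ** p Z = sW w (meet X Z).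
Proof.
case: w => [_|a w [Y iY XY]]; first by rewrite /= projM.
rewrite (sW_cons iY XY) (sW_cons (Y := Y))//; last exact: le_trans (leIl _ _) XY.
by rewrite -cmulA projM.
Qed.

Lemma p_sW w X Z : idealw D w X -> p Z ** sW w X = sW w (meet (actw D w Z) X).
Proof.
case: w => [_|a w [Y iY XY]]; first by rewrite /= projM.
rewrite (sW_cons iY XY) (sW_cons (Y := Y))//; last exact: le_trans (leIr _ _) XY.
by rewrite !cmulA (rep_comm rep)// -(cmulA (s a Y)) gW_comm -!cmulA projM.
Qed.

Lemma sW_adj w X Z : idealw D w X -> idealw D w Z ->
  cadj (sW w X) ** sW w Z = p (meet X Z).
Proof.
case: w => [_ _|a w [Y iY XY] [Y' iY' ZY]]; first by rewrite /= projJ projM.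
rewrite (sW_cons iY XY) (sW_cons iY' ZY) !cadjM projJ !cmulA.
rewrite -(cmulA _ (cadj _) (s a Y')) (rep_adj rep)// eqxx.
rewrite -(cmulA _ (p _) (gW _ _)) gW_comm !cmulA -(cmulA (p X)) gW_adj.
rewrite -!cmulA !projM; congr p.
rewrite actw_meet.
have -> : meet (meet (actw D w Y) (actw D w Y')) Z = meet (actw D w Y) Z.
  by rewrite -meetA (meet_r ZY).
rewrite -meetA (meetA (actw D w Y')) (meetC (actw D w Y')) -(meetA (actw D w Y)).
rewrite (meet_r ZY) !meetA (meet_l XY) -meetA.
by rewrite meetA (meet_l XY).
Qed.

Lemma sW_cat u v X Y : idealw D u Y -> (X <= actw D v Y)%O -> idealw D v X ->
  sW (u ++ v) X = sW u Y ** sW v X.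
Proof.
move=> iY XY iX; case: u iY => [_|a u [Z iZ YZ]].
  by rewrite /= p_sW// (meet_r XY).
have XZ : (X <= actw D (u ++ v) Z)%O.
  by rewrite actw_cat; apply: le_trans XY _; exact: actw_le.
rewrite cat_cons (sW_cons iZ XZ) (sW_cons iZ YZ) gW_cat -!cmulA p_sW// (meet_r XY).
by rewrite sW_gW// -actw_cat.
Qed.

Lemma sW_bot w X : idealw D w X -> sW w \bot%O = 0.
Proof.
by move=> iX; rewrite -[\bot%O](meetx0 X) -sW_p// (rep_bot rep) cmulr0.
Qed.

Lemma incomparable (b c : seq L) : ~~ prefix b c -> ~~ prefix c b ->
  exists u x y v w, [/\ b = u ++ x :: v, c = u ++ y :: w & x <> y].
Proof.
elim: b c => [|x b IH] [|y c] //.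
have [<-|xy] := eqVneq x y; last first.
  by move=> _ _; exists [::], x, y, b, c; split => //; exact/eqP.
by rewrite !prefix_cons eqxx /= => h1 h2; have [u [x' [y' [v [w [-> -> n]]]]]] := IH c h1 h2;
  exists (x :: u), x', y', v, w.
Qed.

(** The words are cut at their first difference. The common prefix contributes only a projection,
    which is absorbed by the right factor, and the differing letters are orthogonal. *)
Lemma sW_inc b c X Y : ~~ prefix b c -> ~~ prefix c b -> idealw D b X ->
  idealw D c Y -> cadj (sW b X) ** sW c Y = 0.
Proof.
move=> h1 h2; have [u [x [y [v [w [-> -> xy]]]]]] := incomparable h1 h2 => iX iY.
have base Y' : idealw D (y :: w) Y' -> cadj (sW (x :: v) X) ** sW (y :: w) Y' = 0.
  move=> [Z iZ YZ]; have [U iU XU] := idealw_suffix iX.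
  rewrite (sW_cons iZ YZ) (sW_cons iU XU) !cadjM !cmulA -(cmulA _ (cadj _) (s y Z)).
  by rewrite (rep_adj rep)//; case: eqP => //; rewrite cmulr0 !cmul0r.
have [u0|/eqP u0] := eqVneq u [::].
  by subst u; apply: base.
have [U iU XU] := idealw_prefix u0 iX; have [V iV YV] := idealw_prefix u0 iY.
rewrite (sW_cat iU XU (idealw_suffix iX)) (sW_cat iV YV (idealw_suffix iY)) cadjM.
rewrite -cmulA (cmulA (cadj (sW u U))) sW_adj// p_sW; last exact: idealw_suffix iY.
by apply: base; apply: idealw_meetr; exact: idealw_suffix iY.
Qed.

Definition Traw (x : triple) : A :=
  if x is Some (a, X, b) then sW a X ** cadj (sW b X) else 0.

Definition Trep (x : sgp) : A := Traw (sval x).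

Lemma Traw_mk a X b : idealw D a X -> Traw (mk_triple a X b) = sW a X ** cadj (sW b X).
Proof.
move=> iX; rewrite /mk_triple; case: eqP => //= ->.
by rewrite (sW_bot iX) cmul0r.
Qed.

Lemma Trep0 : Trep (s0 D) = 0. Proof. by []. Qed.

Lemma TrepV x : Trep (sj x) = cadj (Trep x).
Proof.
rewrite /Trep /=; case: (sval x) => [[[a X] b]|] /=; last by rewrite cadj0.
by rewrite cadjM cadjK.
Qed.

Let TrepMl x y a X b m Y c : sval x = Some (a, X, b) -> sval y = Some (b ++ m, Y, c) ->
  Trep (sm x y) = Trep x ** Trep y.
Proof.
move=> Ex Ey; rewrite /Trep -[sval (sm x y)]/(smul D (sval x) (sval y)) Ex Ey smul_l.
have [_ iaX ibX] : S_set D (Some (a, X, b)) by rewrite -Ex; exact: (svalP x).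
have [_ ibY icY] : S_set D (Some (b ++ m, Y, c)) by rewrite -Ey; exact: (svalP y).
have imY := idealw_suffix ibY.
have iamZ : idealw D (a ++ m) (meet (actw D m X) Y).
  by apply: idealw_meetl; exact: idealw_act.
rewrite Traw_mk//= -!cmulA (cmulA (cadj _)).
have -> : cadj (sW b X) ** sW (b ++ m) Y = sW m (meet (actw D m X) Y).
  have [b0|/eqP b0] := eqVneq b [::].
    by subst b; rewrite /= projJ p_sW.
  have [U iU YU] := idealw_prefix b0 ibY.
  rewrite (sW_cat iU YU imY) cmulA sW_adj// p_sW// actw_meet -meetA.
  by rewrite (meet_r YU).
have imZ := idealw_suffix iamZ.
rewrite cmulA -(sW_cat iaX _ imZ) ?leIl//.
(* A copy of the projection is split off on the left in order to cut Y down to the same set in the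
   adjoint factor. *)
have {2}-> : sW (a ++ m) (meet (actw D m X) Y) =
   sW (a ++ m) (meet (actw D m X) Y) ** p (meet (actw D m X) Y).
  by rewrite sW_p// meetxx.
rewrite -!cmulA; congr (_ ** _).
rewrite -[p _]projJ -cadjM sW_p//.
by rewrite (meetC Y) -meetA meetxx.
Qed.

Lemma TrepM x y : Trep (sm x y) = Trep x ** Trep y.
Proof.
case Ex : (sval x) => [[[a X] b]|]; last first.
  have -> : x = s0 D by apply: sgp_inj; rewrite Ex.
  by rewrite sm0s Trep0 cmul0r.
case Ey : (sval y) => [[[c Y] g]|]; last first.
  have -> : y = s0 D by apply: sgp_inj; rewrite Ey.
  by rewrite sms0 Trep0 cmulr0.
case: (word_cmpP b c) => [m E|m E _|h1 h2].
- by subst c; exact: TrepMl Ex Ey.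
(* Taking adjoints exchanges the two prefix cases. *)
- subst b; apply: (can_inj (@cadjK _ A)).
  rewrite cadjM -!TrepV sjM; apply: (TrepMl (a := g) (X := Y) (b := c) (m := m) (Y := X) (c := a)).
    by rewrite /= Ey.
  by rewrite /= Ex.
- have [_ iaX ibX] : S_set D (Some (a, X, b)) by rewrite -Ex; exact: (svalP x).
  have [_ ibY icY] : S_set D (Some (c, Y, g)) by rewrite -Ey; exact: (svalP y).
  rewrite /Trep -[sval (sm x y)]/(smul D (sval x) (sval y)) Ex Ey smul_inc//=.
  by rewrite -!cmulA (cmulA (cadj _)) sW_inc// cmul0r cmulr0.
Qed.

End TightRep.

(** * Finite covers of idempotents and relation (iv) *)

Section TightCover.
Context {R : realType} {d : Order.disp_t} {B : cbDistrLatticeType d} {L : choiceType}.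
Variable D : gbds B L.
Context {A : cstarAlgType R} {p : B -> A} {s : L -> B -> A}.
Hypothesis rep : gbds_rep D p s.
Local Notation sgp := (sgp D).
Local Notation meet := Order.meet.
Local Notation diff := Order.diff.
Local Notation bot := (\bot%O : B).
Local Notation "x ** y" := (cmul x y) (at level 40, left associativity).
Local Notation T := (@Trep _ _ _ _ D A p s).
Local Notation W := (@sW _ _ _ _ D A p s).

(** The product of x with all factors 1 - T f, written without a unit. A cover is respected when
    this product vanishes. *)
Definition Qm (x : A) (F : seq sgp) : A := foldl (fun z f => z - z ** T f) x F.

Lemma QmD x y F : Qm (x + y) F = Qm x F + Qm y F.
Proof.
elim: F x y => //= f F IH x y.
by rewrite -IH cmulDl opprD addrACA.
Qed.

Lemma Qm0 F : Qm 0 F = 0.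
Proof. by elim: F => //= f F; rewrite cmul0r subr0. Qed.

Lemma Qm_sum (I : Type) (r : seq I) (G : I -> A) F :
  Qm (\sum_(i <- r) G i) F = \sum_(i <- r) Qm (G i) F.
Proof. by apply: (big_morph (Qm^~ F)) => [x y|]; [exact: QmD|exact: Qm0]. Qed.

Lemma QmZ k x F : Qm (k *: x) F = k *: Qm x F.
Proof. by elim: F x => //= f F IH x; rewrite cmulZl -scalerBr IH. Qed.

Lemma TidemC (e f : sgp) : idem e -> idem f -> T e ** T f = T f ** T e.
Proof. by move=> ie jf; rewrite -!(TrepM rep) idemC. Qed.

Lemma Qm_kill x (F : seq sgp) f : (forall g, g \in F -> idem g) -> f \in F ->
  x ** T f = x -> Qm x F = 0.
Proof.
elim: F x => // g F IH x iF; rewrite inE => /orP[/eqP <- xf|fF xf] /=.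
  by rewrite xf subrr Qm0.
have hF h : h \in F -> idem h by move=> hF; apply: iF; rewrite inE hF orbT.
have ig : idem g by apply: iF; rewrite inE eqxx.
by apply: IH => //; rewrite cmulBl -cmulA (TidemC ig (hF _ fF)) cmulA xf.
Qed.

Definition sword (f : sgp) : seq L := if sval f is Some (w, _, _) then w else [::].

Definition short (a : seq L) (f : sgp) : bool := (size (sword f) <= size a)%N.

(** The element of B by which a short idempotent cuts down elements at the word [a], see
    [smul_short]; it is empty if the two are orthogonal. *)
Definition tailat (a : seq L) (f : sgp) : B :=
  if sval f is Some (w, C, _) then
    if prefix w a then actw D (drop (size w) a) C else bot
  else bot.

Lemma smul_short a X f : idem f -> short a f ->
  smul D (mk_triple a X a) (sval f) = mk_triple a (meet X (tailat a f)) a.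
Proof.
rewrite /idem /short /sword /tailat; case: (sval f) => [[[w C] w']|]; last first.
  by rewrite smulx0 meetx0 mk_triple0.
move=> [<- nC iC] wa; rewrite {1}/mk_triple; case: eqP => [->|X0].
  by rewrite meet0x mk_triple0.
case: (word_cmpP a w) => [m E|m -> m0|h1 h2]; last first.
- by rewrite smul_inc// (negbTE h2) meetx0 mk_triple0.
- by rewrite smul_r prefix_prefix drop_size_cat.
move: wa; rewrite E size_cat -{2}(addn0 (size a)) leq_add2l leqn0 size_eq0 => /eqP ->.
by rewrite smul_l !cats0 prefix_refl addn0 drop_size.
Qed.

Definition eW a X (h : idealw D a X) : sgp := mkE (E_mk h).

Lemma eW_idem a X (h : idealw D a X) : idem (eW h).
Proof. exact: E_mk. Qed.

Lemma eW_le a X Y (h : idealw D a X) (h' : idealw D a Y) :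
  (X <= Y)%O -> sm (eW h) (eW h') = eW h.
Proof.
move=> XY; apply: sgp_inj => /=.
rewrite /mk_triple; case: eqP => [//|X0]; case: eqP => [Y0|Y0].
  by case: X0; apply/eqP; rewrite -lex0 -Y0.
by rewrite smul_diag (meet_l XY) mk_tripleE.
Qed.

Lemma eW_neq0 a X (h : idealw D a X) : eW h <> s0 D <-> X <> bot.
Proof.
split=> [h1 X0|X0 /(congr1 sval)]; last by rewrite /= mk_tripleE.
by apply: h1; apply: sgp_inj; rewrite /= X0 mk_triple0.
Qed.

Lemma covers_le (e f : sgp) F : idem e -> sm f e = f -> covers e F -> covers f F.
Proof.
move=> ie fe cF g ig g0 gf; apply: cF => //.
by rewrite -gf -smA fe.
Qed.

Lemma TeW a X (h : idealw D a X) : T (eW h) = W a X ** cadj (W a X).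
Proof. exact: Traw_mk. Qed.

Lemma TeW_bot a X (h : idealw D a X) : X = bot -> T (eW h) = 0.
Proof. by move=> X0; rewrite /Trep /= X0 mk_triple0. Qed.

Lemma TeW_split a X C (h : idealw D a X) (h1 : idealw D a (diff X C))
    (h2 : idealw D a (meet X C)) : T (eW h) = T (eW h1) + T (eW h2).
Proof.
have key Y (hY : idealw D a Y) : (Y <= X)%O ->
    T (eW hY) = W a X ** p Y ** cadj (W a X).
  move=> YX; rewrite TeW.
  have -> : W a Y = W a X ** p Y by rewrite (sW_p rep)// (meet_r YX).
  by rewrite cadjM (projJ rep) -!cmulA (cmulA (p Y)) (projM rep) meetxx.
rewrite (key _ h (lexx _)) (key _ h1 (leBx _ _)) (key _ h2 (leIl _ _)) -cmulDl -cmulDr.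
congr (_ ** _ ** _).
rewrite -{1}(joinIB C X) (rep_join rep) (_ : meet (meet X C) (diff X C) = bot).
  by rewrite (rep_bot rep) subr0 addrC.
by rewrite meetC meetBI.
Qed.

(** Idempotents whose words are no longer than [a] merely split X inside B. The part of X below such
    an f is annihilated by the factor 1 - T f, so only the part disjoint from all of them
    matters. *)
Lemma short_reduce a X (h : idealw D a X) (F G : seq sgp) : (forall f, f \in F -> idem f) ->
  (forall f, f \in G -> f \in F) -> exists Y (hY : idealw D a Y),
  [/\ (Y <= X)%O, forall f, f \in G -> short a f -> meet Y (tailat a f) = bot &
      Qm (T (eW h)) F = Qm (T (eW hY)) F].
Proof.
move=> iF; elim: G => [|f G IH] GF; first by exists X, h.
have [|Y [hY [YX Yd YQ]]] := IH; first by move=> g gG; apply: GF; rewrite inE gG orbT.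
have fF : f \in F by apply: GF; rewrite inE eqxx.
have [sf|nf] := boolP (short a f); last first.
  exists Y, hY; split=> // g; rewrite inE => /orP[/eqP ->|gG] sg; last exact: Yd.
  by rewrite sg in nf.
have h1 : idealw D a (diff Y (tailat a f)) by exact (idealw_le (leBx _ _) hY).
have h2 : idealw D a (meet Y (tailat a f)) by exact (idealw_meetl _ hY).
exists _, h1; split.
- exact: le_trans (leBx _ _) YX.
- move=> g; rewrite inE => /orP[/eqP ->|gG] sg; first by rewrite diffIK.
  by apply/eqP; rewrite -lex0 -(Yd g gG sg); apply: leI2 => //; exact: leBx.
rewrite YQ (TeW_split hY h1 h2) QmD.
rewrite [X in _ + X](@Qm_kill _ _ f) ?addr0// -(TrepM rep); congr T.
apply: sgp_inj; rewrite [LHS](smul_short _ (iF f fF) sf) /=.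
by rewrite -meetA meetxx.
Qed.

(** Induction on the excess length of the words of F over a. Once short idempotents are removed,
    every non-empty Z below Y must meet members of F with longer words. Their next letters form a
    finite set which contains Delta of Z and meets it, so Y is regular and relation (iv) splits T at
    (a, Y, a) into the summands at the words a b, still covered by F. *)
Lemma tight_aux n a X (h : idealw D a X) F : (forall f, f \in F -> idem f) ->
  (forall f, f \in F -> (size (sword f) <= size a + n)%N) ->
  covers (eW h) F -> Qm (T (eW h)) F = 0.
Proof.
elim: n a X h => [|n IH] a X h iF szF cF;
  have [Y [hY [YX Yd ->]]] := short_reduce h iF (fun f (hf : f \in F) => hf);
  have cY : covers (eW hY) F by apply: covers_le cF; [exact: eW_idem|exact: eW_le].
  (* Without excess length all of F is short, hence disjoint from Y; a non-empty Y could not be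
     covered. *)
  have [Y0|/eqP Y0] := eqVneq Y bot; first by rewrite TeW_bot// Qm0.
  have [||f fF] := cY (eW hY) (eW_idem hY); first exact/eW_neq0.
    by apply: idemxx; exact: eW_idem.
  have sf : short a f by have := szF f fF; rewrite addn0.
  by case; apply: sgp_inj; rewrite [LHS](smul_short _ (iF f fF) sf) Yd// mk_triple0.
have [Y0|/eqP Y0] := eqVneq Y bot; first by rewrite TeW_bot// Qm0.
have iaY b Z : (Z <= Y)%O -> idealw D (a ++ [:: b]) (act D b Z).
  by move=> ZY; apply: (@idealw_act _ _ _ D a [:: b]); exact (idealw_le ZY hY).
(* A short idempotent disjoint from Y stays disjoint after any further letters [b], so whatever
   meets Z or its image is long. *)
have longf Z b f : Z <> bot -> (Z <= Y)%O -> f \in F ->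
    smul D (mk_triple (a ++ b) (actw D b Z) (a ++ b)) (sval f) <> None -> ~~ short a f.
  move=> Z0 ZY fF nf; apply/negP => sf; apply: nf.
  have Zf : meet Z (tailat a f) = bot.
    by apply/eqP; rewrite -lex0 -(Yd f fF sf); apply: leI2.
  have sf' : short (a ++ b) f by apply: leq_trans sf _; rewrite size_cat leq_addr.
  rewrite (smul_short _ (iF f fF) sf').
  have [E|E] := eqVneq (tailat (a ++ b) f) bot; first by rewrite E meetx0 mk_triple0.
  have -> : tailat (a ++ b) f = actw D b (tailat a f).
    move: sf E; rewrite /short /sword /tailat; case: (sval f) => [[[w C] w']|]; last first.
      by rewrite eqxx.
    move=> wa; have [/prefixP[k]|_] := boolP (prefix w (a ++ b)); last by rewrite eqxx.
    move=> E _; have [k' Ea] : exists k', a = w ++ k'.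
      exists (drop (size w) a); rewrite -{1}(cat_take_drop (size w) a); congr (_ ++ _).
      by have := congr1 (take (size w)) E; rewrite take_size_cat// takel_cat.
    by rewrite Ea -catA !prefix_prefix !drop_size_cat// actw_cat.
  by rewrite -actw_meet Zf actw_bot mk_triple0.
have meetf Z : Z <> bot -> (Z <= Y)%O -> exists2 f, f \in F &
    smul D (mk_triple a Z a) (sval f) <> None.
  move=> Z0 ZY; have hZ := idealw_le ZY hY.
  have [||f fF nf] := cY (eW hZ) (eW_idem hZ); first exact/eW_neq0.
    exact: eW_le.
  by exists f => // E; apply: nf; apply: sgp_inj.
have meetfb Z b : (Z <= Y)%O -> act D b Z <> bot -> exists2 f, f \in F &
    smul D (mk_triple (a ++ [:: b]) (act D b Z) (a ++ [:: b])) (sval f) <> None.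
  move=> ZY Z0; have hZ := iaY b Z ZY.
  have [||f fF nf] := cY (eW hZ) (eW_idem hZ); first exact/eW_neq0.
    apply: sgp_inj; rewrite /= !mk_tripleE// smul_r meet_l ?mk_tripleE//.
    exact: (actw_le D [:: b] ZY).
  by exists f => // E; apply: nf; apply: sgp_inj.
have rY : regular D Y.
  move=> Z Z0 ZY; split.
    (* The bounding finite set consists of the letters that follow the first |a| letters in the
       words of F. *)
    apply: (@sub_finite_set _ _ [set` pmap (fun f => ohead (drop (size a) (sword f))) F]).
      move=> b /= Zb; have [f fF nf] := meetfb Z b ZY Zb.
      have Z0' : Z <> bot by move=> E; apply: Zb; rewrite E act_bot.
      have lf := longf Z [:: b] f Z0' ZY fF nf.
      rewrite mem_pmap; apply/mapP; exists f => //.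
      move: nf lf; rewrite mk_tripleE// /short /sword.
      have := iF f fF; rewrite /idem; case: (sval f) => [[[w C] w']|]; last by rewrite smulx0.
      move=> [<- _ _]; rewrite -ltnNge => nf lf.
      case: (word_cmpP (a ++ [:: b]) w) => [m E|m E m0|h1 h2].
      + by rewrite E -catA drop_size_cat.
      + move: lf; have := congr1 size E; rewrite !size_cat /=.
        by case: m m0 {E} => // x m _ /= E; rewrite ltnNge; move: E; rewrite addn1 addnS => -[->]; rewrite leq_addr.
      + by move: nf; rewrite smul_inc.
    exact: finite_seq.
  have [f fF nf] := meetf Z Z0 ZY.
  have lf : ~~ short a f by apply: (longf Z [::] f Z0 ZY fF); rewrite cats0.
  move: nf lf; rewrite mk_tripleE// /short /sword.
  have := iF f fF; rewrite /idem; case: (sval f) => [[[w C] w']|]; last by rewrite smulx0.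
  move=> [<- _ _]; rewrite -ltnNge => nf lf.
  case: (word_cmpP a w) => [m E|m E m0|h1 h2].
  + move: nf; rewrite E smul_l; case: m E => [|b m] E nf.
      by move: lf; rewrite E cats0 ltnn.
    exists b => Eb; apply: nf; rewrite [actw _ _ _]/= Eb.
    by rewrite -/(actw D m bot) actw_bot meet0x mk_triple0.
  + by move: lf; rewrite E size_cat ltnNge leq_addr.
  + by move: nf; rewrite smul_inc.
have [fY _] := rY Y Y0 (lexx _).
(* Relation (iv), conjugated by the isometry of the word a. *)
have -> : T (eW hY) = \sum_(b <- finmap.enum_fset (fset_set (Delta D Y))) T (eW (iaY b Y (lexx _))).
  rewrite TeW -{1}(meetxx Y) -(sW_p rep)// (rep_regular rep rY) (fsbig_finite _ _ fY).
  rewrite cmul_sumr cmul_suml; apply: eq_bigr => b _.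
  rewrite TeW (sW_cat rep (u := a) (v := [:: b]) (X := act D b Y) (Y := Y))//; last first.
    by exists (act D b Y) => //; exact: ideal_act (lexx _).
  have -> : W [:: b] (act D b Y) = s b (act D b Y).
    rewrite (sW_cons rep (ideal_act (lexx _) : ideal D b (act D b Y))) /=; last exact: lexx.
    by rewrite -cmulA (projM rep) meetxx (isoM rep)// ?meetxx//; exact: ideal_act (lexx _).
  by rewrite cadjM !cmulA.
rewrite Qm_sum big1// => b _; apply: IH => //.
  by move=> f /szF; rewrite size_cat addn1 addSnnS.
apply: covers_le cY; first exact: eW_idem.
apply: sgp_inj; rewrite /= [mk_triple a Y a]mk_tripleE//.
have [->|/eqP bY] := eqVneq (act D b Y) bot; first by rewrite mk_triple0.
rewrite [X in smul D X]mk_tripleE// smul_r.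
by rewrite -[actw D [:: b] Y]/(act D b Y) meetxx mk_tripleE.
Qed.

Lemma Trep_tight e F : idem e -> (forall f, f \in F -> idem f) -> covers e F ->
  Qm (T e) F = 0.
Proof.
move=> ie iF cF.
have [e0|e0] := pselect (e = s0 D); first by rewrite e0 Trep0 Qm0.
have [a [X [h E]]] : exists a X (h : idealw D a X), e = eW h.
  move: ie e0; case: e {cF} => [[[[a X] b]|] he]; last first.
    by move=> _ []; exact: sgp_inj.
  move=> [ab X0 iX] _; move: iX => /= iX.
  by exists a, X, iX; apply: sgp_inj; rewrite /= mk_tripleE// -ab.
rewrite E in cF *; apply: (@tight_aux (\max_(f <- F) size (sword f))) => //.
by move=> f fF; apply: leq_trans (leq_addl _ _); exact: leq_bigmax_seq.
Qed.

End TightCover.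

(** * Simple functions on a groupoid of germs *)

Section Arrows.
Context {d : Order.disp_t} {B : cbDistrLatticeType d} {L : choiceType}.
Variable D : gbds B L.
Local Notation sgp := (sgp D).
Local Notation pt := (pt D).
Context {G : groupoid}.
Variable M : model D G.
Local Notation arr := (garrow G).
Implicit Types (s t e : sgp) (x y : pt) (a b c z : arr).

(** The basic slice Theta(s, D_(s^* s)), read through the model. *)
Definition Th s z := exists2 x, pmem x (dom s) & sval z = mk M s x.

Lemma arr_eq a b : sval a = sval b -> a = b.
Proof. by case: a b => [a ha] [b hb] /= h; exact: eq_exist. Qed.

Lemma sr_ex z : exists x s, pmem x (dom s) /\ sval z = mk M s x.
Proof. by have [s [x [xs E]]] := (mk_arr M (sval z)).1 (svalP z); exists x, s. Qed.

Definition sr z : pt := sval (cid (sr_ex z)).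

Lemma Th_ex z : exists s, Th s z.
Proof. by have [x [s [xs E]]] := sr_ex z; exists s, x. Qed.

Lemma Th_sr s z : Th s z -> pmem (sr z) (dom s) /\ sval z = mk M s (sr z).
Proof.
rewrite /sr; case: cid => x [t [xt Et]] /= [y ys Es].
have [<- _] : y = x /\ pmem y (sd s t) by apply/(mk_eq M); rewrite // -Es.
by [].
Qed.

Lemma Th_sd s t z : Th s z -> Th t z <-> pmem (sr z) (sd t s).
Proof.
move=> /Th_sr[xs Es]; split=> [/Th_sr[xt Et]|h].
  by have [] : sr z = sr z /\ pmem (sr z) (sd t s) by apply/(mk_eq M); rewrite // -Et.
have [xt _] := mem_sd_dom h; exists (sr z) => //.
by rewrite Es; apply/(mk_eq M) => //; split=> //; exact: sd_sym.
Qed.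

Definition rg z : pt := sact (sval (cid (Th_ex z))) (sr z).

Lemma Th_rg s z : Th s z -> rg z = sact s (sr z).
Proof.
move=> sz; rewrite /rg; case: cid => t tz /=.
by apply: sact_sd; apply/(Th_sd t sz).
Qed.

Lemma gsrcE a b : gsrc (sval a) = gsrc (sval b) <-> sr a = sr b.
Proof.
have [s /Th_sr[xs Ea]] := Th_ex a; have [t /Th_sr[xt Eb]] := Th_ex b.
by rewrite Ea Eb (mk_src M).
Qed.

Lemma grngE a b : grng (sval a) = grng (sval b) <-> rg a = rg b.
Proof.
have [s sa] := Th_ex a; have [t tb] := Th_ex b.
rewrite (Th_rg sa) (Th_rg tb).
have [xs Ea] := Th_sr sa; have [xt Eb] := Th_sr tb.
by rewrite {1}Ea {1}Eb (mk_rng M).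
Qed.

Lemma gsrcrngE a b : gsrc (sval a) = grng (sval b) <-> sr a = rg b.
Proof.
have [s sa] := Th_ex a; have [t tb] := Th_ex b.
rewrite (Th_rg tb).
have [xs Ea] := Th_sr sa; have [xt Eb] := Th_sr tb.
by rewrite {1}Ea {1}Eb (mk_srcrng M).
Qed.

Lemma Th_inj s a b : Th s a -> Th s b -> sr a = sr b -> a = b.
Proof. by move=> /Th_sr[_ Ea] /Th_sr[_ Eb] E; apply: arr_eq; rewrite Ea Eb E. Qed.

Lemma Th_inj_rg s a b : Th s a -> Th s b -> rg a = rg b -> a = b.
Proof.
move=> sa sb; rewrite (Th_rg sa) (Th_rg sb) => E; apply: (Th_inj sa sb).
have [xs _] := Th_sr sa; have [xt _] := Th_sr sb.
by rewrite -(sactK xs) E sactK.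
Qed.

Lemma Th_of s x : pmem x (dom s) -> exists2 z, Th s z & sr z = x.
Proof.
move=> xs; have h : garr (mk M s x) by apply/(mk_arr M); exists s, x.
have hz : Th s (exist _ _ h) by exists x.
exists (exist _ _ h) => //; have [ys E] := Th_sr hz.
by apply: esym; exact: ((mk_eq M xs ys).1 E).1.
Qed.

Lemma Th_meet s t z : Th (smeet s t) z <-> Th s z /\ Th t z.
Proof.
split=> [mz|[sz tz]].
  have [xm _] := Th_sr mz; rewrite dom_smeet in xm.
  have sz : Th s z by apply/(Th_sd s mz); apply: sd_sym; exact: mem_sd_meet.
  by split=> //; apply/(Th_sd t sz); exact: sd_sym.
by apply/(Th_sd _ sz); apply: mem_sd_meet; apply: sd_sym; apply/(Th_sd t sz).
Qed.

Lemma Th0 z : ~ Th (s0 D) z.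
Proof. by move=> /Th_sr[]; rewrite dom_idem// => /mem0. Qed.

Definition acomp a b c := gsrc (sval a) = grng (sval b) /\ gmul (sval a) (sval b) = sval c.

Lemma acomp_sr a b c : acomp a b c -> sr a = rg b.
Proof. by move=> [/gsrcrngE]. Qed.

Lemma Th_comp s t a b c : Th s a -> Th t b -> acomp a b c ->
  [/\ Th (sm s t) c, sr c = sr b & rg c = rg a].
Proof.
move=> sa tb ab; have E := acomp_sr ab; rewrite (Th_rg tb) in E.
have [xs Ea] := Th_sr sa; have [xt Eb] := Th_sr tb; rewrite E in xs Ea.
have Ec : sval c = mk M (sm s t) (sr b) by rewrite -ab.2 Ea Eb (mk_mul M).
have stc : Th (sm s t) c by exists (sr b) => //; apply/mem_dom_sm.
have [y Ec'] := Th_sr stc.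
have [E' _] : sr b = sr c /\ pmem (sr b) (sd (sm s t) (sm s t)).
  by apply/(mk_eq M); rewrite -?Ec -?Ec'//; apply/mem_dom_sm.
by split=> //; rewrite (Th_rg stc) (Th_rg sa) -E' sact_sm// E.
Qed.

Lemma acomp_ex a b : sr a = rg b -> exists c, acomp a b c.
Proof.
move=> E; have [s sa] := Th_ex a; have [t tb] := Th_ex b.
have E1 := E; rewrite (Th_rg tb) in E1.
have [xs Ea] := Th_sr sa; have [xt Eb] := Th_sr tb; rewrite E1 in xs Ea.
have h : garr (mk M (sm s t) (sr b)).
  by apply/(mk_arr M); exists (sm s t), (sr b); split=> //; apply/mem_dom_sm.
exists (exist _ _ h); split; first exact/gsrcrngE.
by rewrite /= Ea Eb (mk_mul M).
Qed.

Lemma Th_factor s t c : Th (sm s t) c -> exists a b, [/\ Th s a, Th t b & acomp a b c].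
Proof.
move=> stc; have [/mem_dom_sm[xt xs] Ec] := Th_sr stc.
have [b tb Eb] := Th_of xt; have [a sa Ea] := Th_of xs.
have [|c' ab] := @acomp_ex a b; first by rewrite (Th_rg tb) Ea Eb.
have [stc' E' _] := Th_comp sa tb ab.
exists a, b; split=> //; suff -> : c = c' by [].
by apply: (Th_inj stc stc'); rewrite E' Eb.
Qed.

Lemma inv_val s a : Th s a -> sval (arrow_inv a) = mk M (sj s) (rg a).
Proof.
move=> sa; have [xs Ea] := Th_sr sa; rewrite (Th_rg sa) /arrow_inv.
case: pselect => [h|]; first by rewrite /= {1}Ea (mk_inv M).
case; apply/(mk_arr M); exists (sj s), (sact s (sr a)).
by rewrite {1}Ea (mk_inv M)//; split=> //; exact: mem_dom_sj.
Qed.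

Lemma Th_inv s a : Th s a ->
  [/\ Th (sj s) (arrow_inv a), sr (arrow_inv a) = rg a & rg (arrow_inv a) = sr a].
Proof.
move=> sa; have E := inv_val sa; have [xs Ea] := Th_sr sa.
have y : pmem (rg a) (dom (sj s)) by rewrite (Th_rg sa); exact: mem_dom_sj.
have sa' : Th (sj s) (arrow_inv a) by exists (rg a).
have [y' E'] := Th_sr sa'.
have [E1 _] : rg a = sr (arrow_inv a) /\ pmem (rg a) (sd (sj s) (sj s)).
  by apply/(mk_eq M); rewrite -?E -?E'.
by split=> //; rewrite (Th_rg sa') -E1 (Th_rg sa) sactK.
Qed.

Lemma arrow_invK a : arrow_inv (arrow_inv a) = a.
Proof.
have [s sa] := Th_ex a; have [sa' E1 E2] := Th_inv sa.
have [sa'' E3 E4] := Th_inv sa'; rewrite sjK in sa''.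
by apply: (Th_inj sa'' sa); rewrite E3 E2.
Qed.

Lemma Th_invE s a : Th (sj s) (arrow_inv a) <-> Th s a.
Proof.
split=> [h|/Th_inv[]//]; have [] := Th_inv h.
by rewrite sjK arrow_invK.
Qed.

Definition isunit z := exists2 e, idem e & Th e z.

Lemma unit_rg z : isunit z -> rg z = sr z.
Proof.
move=> [e ie ez]; rewrite (Th_rg ez) sact_idem//.
by have [+ _] := Th_sr ez; rewrite dom_idem.
Qed.

Lemma unit_inj a b : isunit a -> isunit b -> sr a = sr b -> a = b.
Proof.
move=> [e ie ea] [f jf fb] E.
have [xe Ea] := Th_sr ea; have [xf Eb] := Th_sr fb; rewrite -E in xf Eb.
apply: arr_eq; rewrite Ea Eb; apply/(mk_eq M) => //; split=> //.
apply: (@mem_sd _ _ _ _ e f (sr a) (sm e f)) => //.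
  by rewrite !dom_idem// in xe xf; apply/memM.
by rewrite smA idemxx// (idemC ie jf) smA idemxx.
Qed.

Lemma unit_inv z : isunit z -> arrow_inv z = z.
Proof.
move=> uz; have [e ie ez] := uz; have [ez' E1 E2] := Th_inv ez.
apply: unit_inj => //; first by exists e => //; rewrite -{1}(idemV ie).
by rewrite E1 unit_rg.
Qed.

Lemma inv_unit z : isunit (arrow_inv z) <-> isunit z.
Proof. by split=> h; have := unit_inv h; [rewrite arrow_invK => -> |move=> ->]. Qed.

Lemma acomp_inv a : exists2 u, isunit u & acomp (arrow_inv a) a u.
Proof.
have [s sa] := Th_ex a; have [sa' E1 E2] := Th_inv sa.
have [u cu] := acomp_ex E1; exists u => //.
by exists (dom s); [exact: idem_dom|have [] := Th_comp sa' sa cu].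
Qed.

Lemma acomp_unit a b c : isunit a -> isunit b -> acomp a b c -> a = b /\ c = b.
Proof.
move=> ua ub ab; have E := acomp_sr ab; rewrite unit_rg// in E.
have Eab := unit_inj ua ub E; split=> //.
have [[e ie ea] [f jf fb]] := (ua, ub); have [efc Ec _] := Th_comp ea fb ab.
by apply: unit_inj => //; exists (sm e f) => //; exact: idemM.
Qed.

Lemma acomp_unitxx a : isunit a -> acomp a a a.
Proof.
move=> ua; have [|c cc] := @acomp_ex a a; first by rewrite unit_rg.
by have [_ E] := acomp_unit ua ua cc; rewrite E in cc.
Qed.

(** The injectivity conditions of [bisection], in terms of points. Openness is kept apart: it is
    automatic for supports of simple functions. *)
Definition slice (U : set arr) :=
  (forall a b, U a -> U b -> sr a = sr b -> a = b) /\
  (forall a b, U a -> U b -> rg a = rg b -> a = b).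

Lemma slice_le U V : U `<=` V -> slice V -> slice U.
Proof. by move=> UV [h1 h2]; split=> a b /UV Ua /UV Ub; [exact: h1|exact: h2]. Qed.

Lemma slice_Th s : slice (Th s).
Proof. by split=> a b; [exact: Th_inj|exact: Th_inj_rg]. Qed.

Lemma slice_unit : slice isunit.
Proof.
by split=> a b ua ub; [|rewrite !unit_rg//]; exact: unit_inj.
Qed.

Lemma slice_inv U : slice U -> slice [set z | U (arrow_inv z)].
Proof.
have h z : sr (arrow_inv z) = rg z /\ rg (arrow_inv z) = sr z.
  by have [s sz] := Th_ex z; have [] := Th_inv sz.
move=> [h1 h2]; split=> a b Ua Ub E; rewrite -[a]arrow_invK -[b]arrow_invK; congr arrow_inv.
  by apply: h2 => //; rewrite !(h _).2.
by apply: h1 => //; rewrite !(h _).1.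
Qed.

Lemma acomp_srrg a b c : acomp a b c -> sr c = sr b /\ rg c = rg a.
Proof.
by move=> ab; have [s sa] := Th_ex a; have [t tb] := Th_ex b; have [] := Th_comp sa tb ab.
Qed.

Definition sprod U V : set arr := [set c | exists a b, [/\ U a, V b & acomp a b c]].

Lemma slice_prod U V : slice U -> slice V -> slice (sprod U V).
Proof.
have cu a b c c' : acomp a b c -> acomp a b c' -> c = c'.
  by move=> [_ h] [_ h']; apply: arr_eq; rewrite -h -h'.
move=> [U1 U2] [V1 V2]; split=> c c' [a [b [Ua Vb abc]]] [a' [b' [Ua' Vb' abc']]] E.
  have Eb : b = b' by apply: V1 => //; rewrite -(acomp_srrg abc).1 -(acomp_srrg abc').1.
  rewrite -Eb in abc' *; have Ea : a = a'.
    by apply: U1 => //; rewrite (acomp_sr abc) (acomp_sr abc').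
  by rewrite -Ea in abc'; exact: cu abc abc'.
have Ea : a = a' by apply: U2 => //; rewrite -(acomp_srrg abc).2 -(acomp_srrg abc').2.
rewrite -Ea in abc' *; have Eb : b = b'.
  by apply: V2 => //; rewrite -(acomp_sr abc) -(acomp_sr abc').
by rewrite -Eb in abc'; exact: cu abc abc'.
Qed.

End Arrows.

(** * Convolution and combinations of indicators of slices *)

Section Functions.
Context {R : realType} {d : Order.disp_t} {B : cbDistrLatticeType d} {L : choiceType}.
Variable D : gbds B L.
Local Notation sgp := (sgp D).
Local Notation pt := (pt D).
Context {G : groupoid}.
Variable M : model D G.
Local Notation arr := (garrow G).
Local Notation fct := (garrow G -> R[i]).
Implicit Types (s t e : sgp) (x y : pt) (a b c z : arr) (f g : fct).

Definition supp f : set arr := [set z | f z <> 0].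

(** Finiteness over each range and each source makes the convolution sums finite, and convolution
    bilinear; a sum with infinite support would be 0 by convention. *)
Definition ffin f :=
  (forall x, finite_set [set z | supp f z /\ rg M z = x]) /\
  (forall x, finite_set [set z | supp f z /\ sr M z = x]).

Lemma finite_sub1 (T : choiceType) (X : set T) :
  (forall a b : T, X a -> X b -> a = b) -> finite_set X.
Proof.
move=> h; have [[a Xa]|n] := pselect (X !=set0).
  by apply: (@sub_finite_set _ _ [set a]) (finite_set1 _) => b Xb; exact: h.
by apply: (@sub_finite_set _ _ set0) (finite_set0 _) => b Xb; case: n; exists b.
Qed.

Lemma ffin_slice f : slice M (supp f) -> ffin f.
Proof.
by move=> [h1 h2]; split=> x; apply: finite_sub1 => a b [sa Ea] [sb Eb];
   [apply: h2|apply: h1] => //; rewrite Ea Eb.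
Qed.

Lemma ffinD f g : ffin f -> ffin g -> ffin (fun z => f z + g z).
Proof.
have h z : supp (fun z => f z + g z) z -> supp f z \/ supp g z.
  rewrite /supp /= => n; have [f0|] := pselect (f z = 0); last by left.
  by right => g0; apply: n; rewrite f0 g0 addr0.
move=> [f1 f2] [g1 g2]; split=> x.
  apply: (@sub_finite_set _ _ ([set z | supp f z /\ rg M z = x] `|` [set z | supp g z /\ rg M z = x])).
    by move=> z [/h[] ? ?]; [left|right].
  by rewrite finite_setU.
apply: (@sub_finite_set _ _ ([set z | supp f z /\ sr M z = x] `|` [set z | supp g z /\ sr M z = x])).
  by move=> z [/h[] ? ?]; [left|right].
by rewrite finite_setU.
Qed.

Definition pairs f g c : set (arr * arr) :=
  [set ab | [/\ acomp ab.1 ab.2 c, supp f ab.1 & supp g ab.2]].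

Lemma finite_pairs f g c : ffin f -> ffin g -> finite_set (pairs f g c).
Proof.
move=> [f1 _] [_ g2].
apply: (@sub_finite_set _ _ ([set z | supp f z /\ rg M z = rg M c] `*`
   [set z | supp g z /\ sr M z = sr M c])); last exact: finite_setX.
move=> [a b] [/= ab fa gb]; have [E1 E2] := acomp_srrg M ab.
by split.
Qed.

Lemma conv_wide f g c (P : set (arr * arr)) : pairs f g c `<=` P ->
  P `<=` [set ab | acomp ab.1 ab.2 c] ->
  convolution f g c = \sum_(ab \in P) f ab.1 * g ab.2.
Proof.
move=> fP PA; rewrite /convolution; apply/esym/fsbig_widen => // ab [cab nP] /=.
have [f0|f0] := eqVneq (f ab.1) 0; first by rewrite f0 mul0r.
have [g0|g0] := eqVneq (g ab.2) 0; first by rewrite g0 mulr0.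
by case: nP; apply: fP; split=> //; exact/eqP.
Qed.

Lemma convDl f1 f2 g : ffin f1 -> ffin f2 -> ffin g ->
  convolution (fun z => f1 z + f2 z) g = fun c => convolution f1 g c + convolution f2 g c.
Proof.
move=> h1 h2 h3; apply/funext => c.
pose P := pairs f1 g c `|` pairs f2 g c.
have fP : finite_set P by rewrite finite_setU; split; exact: finite_pairs.
have PA : P `<=` [set ab | acomp ab.1 ab.2 c] by move=> ab [[]|[]].
have P1 : pairs f1 g c `<=` P by move=> ab; left.
have P2 : pairs f2 g c `<=` P by move=> ab; right.
rewrite (conv_wide P1 PA) (conv_wide P2 PA).
rewrite (@conv_wide _ g c P)// => [|ab [cab nf gb]].
  rewrite -fsbig_split//=; apply: eq_fsbigr => ab _; exact: mulrDl.
have [f0|f0] := pselect (f1 ab.1 = 0); last by left.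
by right; split=> // f0'; apply: nf; rewrite f0 f0' addr0.
Qed.

Lemma convDr f g1 g2 : ffin f -> ffin g1 -> ffin g2 ->
  convolution f (fun z => g1 z + g2 z) = fun c => convolution f g1 c + convolution f g2 c.
Proof.
move=> h1 h2 h3; apply/funext => c.
pose P := pairs f g1 c `|` pairs f g2 c.
have fP : finite_set P by rewrite finite_setU; split; exact: finite_pairs.
have PA : P `<=` [set ab | acomp ab.1 ab.2 c] by move=> ab [[]|[]].
have P1 : pairs f g1 c `<=` P by move=> ab; left.
have P2 : pairs f g2 c `<=` P by move=> ab; right.
rewrite (conv_wide P1 PA) (conv_wide P2 PA).
rewrite (@conv_wide f _ c P)// => [|ab [cab fa ng]].
  rewrite -fsbig_split//=; apply: eq_fsbigr => ab _; exact: mulrDr.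
have [f0|f0] := pselect (g1 ab.2 = 0); last by left.
by right; split=> // f0'; apply: ng; rewrite f0 f0' addr0.
Qed.

Lemma conv0l g : convolution (fun _ => 0 : R[i]) g = fun _ => 0.
Proof. by apply/funext => c; rewrite /convolution fsbig1// => ab _; rewrite mul0r. Qed.

Lemma conv0r f : convolution f (fun _ => 0 : R[i]) = fun _ => 0.
Proof. by apply/funext => c; rewrite /convolution fsbig1// => ab _; rewrite mulr0. Qed.

Lemma conv_slice f g a b c : slice M (supp f) -> slice M (supp g) -> acomp a b c ->
  supp f a -> supp g b -> convolution f g c = f a * g b.
Proof.
move=> [f1 f2] [g1 g2] ab fa gb.
rewrite (@conv_wide f g c [set (a, b)]) ?fsbig_set1//; last by move=> _ ->.
move=> [a' b'] [/= ab' fa' gb']; have [E1 E2] := acomp_srrg M ab.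
have [E1' E2'] := acomp_srrg M ab'.
by congr (_, _); [apply: f2|apply: g1]; rewrite // -?E1 -?E2.
Qed.

Lemma conv_out f g c : (forall a b, acomp a b c -> supp f a -> supp g b -> False) ->
  convolution f g c = 0.
Proof.
move=> h; rewrite (@conv_wide f g c set0) ?fsbig_set0// => ab [h1 h2 h3].
exact: h h1 h2 h3.
Qed.

Lemma conv_supp f g : supp (convolution f g) `<=` sprod (supp f) (supp g).
Proof.
move=> c nc; apply: contrapT => h; apply: nc; apply: conv_out => a b h1 h2 h3.
by apply: h; exists a, b.
Qed.

Lemma supp0 f z : ~ supp f z -> f z = 0.
Proof. by move=> /contrapT. Qed.

Definition unitfun f := supp f `<=` isunit M.

Lemma conv_unit f g : unitfun f -> unitfun g -> convolution f g = fun z => f z * g z.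
Proof.
move=> uf ug; have sf := slice_le uf (slice_unit M); have sg := slice_le ug (slice_unit M).
apply/funext => z; have [[fz gz]|n] := pselect (supp f z /\ supp g z).
  by apply: conv_slice => //; apply: (acomp_unitxx (M := M)); exact: uf.
rewrite conv_out => [|a b ab fa gb]; last first.
  by have [E1 E2] := acomp_unit (uf _ fa) (ug _ gb) ab; apply: n; rewrite E2 -{1}E1.
have [f0|f0] := pselect (f z = 0); first by rewrite f0 mul0r.
by have [->|g0] := pselect (g z = 0); [rewrite mulr0|case: n].
Qed.

Lemma involution_unit f : unitfun f -> (forall z, (f z)^* = f z) -> involution f = f.
Proof.
move=> uf fr; apply/funext => z; rewrite /involution fr.
have [uz|nz] := pselect (isunit M z); first by rewrite (unit_inv uz).
have f0 w : ~ isunit M w -> f w = 0 by move=> nw; apply: supp0 => /uf.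
by rewrite !f0//; apply: contra_not nz => /inv_unit.
Qed.

Lemma involution_supp f : supp (involution f) = [set z | supp f (arrow_inv z)].
Proof.
apply/seteqP; split=> z; rewrite /supp /involution /= => h h'; apply: h.
  by rewrite h' conjC0.
by apply/eqP; rewrite -conjC_eq0 h'.
Qed.

Lemma slice_involution f : slice M (supp f) -> slice M (supp (involution f)).
Proof. by rewrite involution_supp; exact: slice_inv. Qed.

(* [f^* * f] lives on the units, with value [|f a|^2] at the source of [a]. *)
Lemma conv_adj f : slice M (supp f) -> forall z,
  (exists2 a, supp f a & acomp (arrow_inv a) a z /\
     convolution (involution f) f z = real_complex R (nrm (f a) ^+ 2)) \/
  convolution (involution f) f z = 0.
Proof.
move=> sf z; have [nz|] := pselect (supp (convolution (involution f) f) z); last first.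
  by move=> /supp0; right.
have [a' [a [fa' fa ab]]] := conv_supp nz; left; exists a => //.
have E : arrow_inv a' = a.
  rewrite involution_supp /= in fa'; apply: sf.2 => //.
  have [s sa] := Th_ex M a'; have [_ _ ->] := Th_inv sa.
  exact: acomp_sr ab.
have E' : a' = arrow_inv a by rewrite -E (arrow_invK M).
rewrite -E'; split=> //.
rewrite (conv_slice (slice_involution sf) sf ab)//.
by rewrite /involution E sqr_nrm.
Qed.

Lemma conv_adj_unit f : slice M (supp f) -> unitfun (convolution (involution f) f).
Proof.
move=> sf z nz; have [[a fa [ab _]]|//] := conv_adj sf z.
have [u uu cu] := acomp_inv M a; suff -> : z = u by [].
by case: ab cu => _ h [_ h']; apply: arr_eq; rewrite -h -h'.
Qed.

Definition ind s : fct := fun z => (`[< Th M s z >])%:R.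

Lemma ind1 s z : Th M s z -> ind s z = 1.
Proof. by move=> h; rewrite /ind asboolT. Qed.

Lemma ind0 s z : ~ Th M s z -> ind s z = 0.
Proof. by move=> h; rewrite /ind asboolF. Qed.

Lemma supp_ind s : supp (ind s) = Th M s.
Proof.
apply/seteqP; split=> z; rewrite /supp /=.
  by move=> h; apply: contrapT => /ind0.
by move=> /ind1 ->; apply/eqP; exact: oner_neq0.
Qed.

Lemma slice_ind s : slice M (supp (ind s)).
Proof. by rewrite supp_ind; exact: slice_Th. Qed.

Lemma ind_s0 z : ind (s0 D) z = 0. Proof. by apply: ind0; exact: Th0. Qed.

Lemma ind_meet s t z : ind (smeet s t) z = ind s z * ind t z.
Proof.
have [sz|sz] := pselect (Th M s z); have [tz|tz] := pselect (Th M t z).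
- by rewrite !ind1 ?mulr1//; apply/Th_meet.
- by rewrite (ind0 tz) mulr0 ind0// => /Th_meet[].
- by rewrite (ind0 sz) mul0r ind0// => /Th_meet[].
- by rewrite (ind0 sz) mul0r ind0// => /Th_meet[].
Qed.

Lemma conv_ind s t : convolution (ind s) (ind t) = ind (sm s t).
Proof.
apply/funext => c; have [stc|stc] := pselect (Th M (sm s t) c).
  have [a [b [sa tb ab]]] := Th_factor stc.
  rewrite (conv_slice (slice_ind s) (slice_ind t) ab) ?supp_ind// !ind1//.
  exact: mulr1.
rewrite (ind0 stc); apply: conv_out => a b ab; rewrite !supp_ind => sa tb.
by apply: stc; have [] := Th_comp sa tb ab.
Qed.

Lemma involution_ind s : involution (ind s) = ind (sj s).
Proof.
apply/funext => z; rewrite /involution /ind conjC_nat; congr (_%:R).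
congr (nat_of_bool _); apply/asbool_equiv_eq.
by rewrite -[X in Th M X _]sjK Th_invE.
Qed.

(** Combinations stay formal, since independence of T from the chosen combination is only
    established in [Tl_wd]. On functions [lmul] is the convolution and [lmeet] the pointwise
    product. *)
Definition slist := seq (R[i] * sgp).
Implicit Type l : slist.

Definition evl l : fct := fun z => \sum_(q <- l) q.1 * ind q.2 z.

Definition lscale (k : R[i]) l : slist := [seq (k * q.1, q.2) | q <- l].
Definition lmul l l' : slist := [seq (q.1 * q'.1, sm q.2 q'.2) | q <- l, q' <- l'].
Definition lmeet l l' : slist := [seq (q.1 * q'.1, smeet q.2 q'.2) | q <- l, q' <- l'].
Definition ladj l : slist := [seq (q.1^*, sj q.2) | q <- l].

Lemma evl_nil z : evl [::] z = 0. Proof. by rewrite /evl big_nil. Qed.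

Lemma evl_cons q l z : evl (q :: l) z = q.1 * ind q.2 z + evl l z.
Proof. by rewrite /evl big_cons. Qed.

Lemma evl_cat l l' z : evl (l ++ l') z = evl l z + evl l' z.
Proof. by rewrite /evl big_cat. Qed.

Lemma evl_scale k l z : evl (lscale k l) z = k * evl l z.
Proof. by rewrite /evl big_map mulr_sumr; apply: eq_bigr => q _; rewrite mulrA. Qed.

Lemma evl_meet l l' z : evl (lmeet l l') z = evl l z * evl l' z.
Proof.
rewrite /evl big_allpairs_dep mulr_suml; apply: eq_bigr => q _.
rewrite mulr_sumr; apply: eq_bigr => q' _ /=.
by rewrite ind_meet mulrACA.
Qed.

Lemma evl_adj l : evl (ladj l) = involution (evl l).
Proof.
apply/funext => z; rewrite /involution /evl rmorph_sum big_map.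
apply: eq_bigr => q _ /=; rewrite rmorphM/= -involution_ind.
by rewrite /involution.
Qed.

Lemma ffin_evl l : ffin (evl l).
Proof.
elim: l => [|q l IH].
  apply: ffin_slice; split=> a b /= h; case: h; exact: evl_nil.
rewrite (_ : evl _ = fun z => q.1 * ind q.2 z + evl l z); last first.
  by apply/funext => z; exact: evl_cons.
apply: ffinD => //; apply: ffin_slice; apply: slice_le (slice_ind q.2).
by move=> z; rewrite /supp /= => h h'; apply: h; rewrite h' mulr0.
Qed.

Lemma convZ_slice k k' f g : slice M (supp f) -> slice M (supp g) ->
  convolution (fun z => k * f z) (fun z => k' * g z) =
  fun z => k * k' * convolution f g z.
Proof.
have sZ k1 f1 : supp (fun z => k1 * f1 z) `<=` supp f1.
  by move=> z; rewrite /supp /= => h h'; apply: h; rewrite h' mulr0.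
move=> sf sg; apply/funext => q.
have [[a [b [fa gb ab]]]|h] := pselect (sprod (supp f) (supp g) q); last first.
  rewrite !conv_out ?mulr0// => a b ab fa gb; apply: h; exists a, b; split=> //.
    exact: sZ fa.
  exact: sZ gb.
rewrite (conv_slice sf sg ab)//.
have [k0|k0] := eqVneq k 0.
  by rewrite conv_out ?k0 ?mul0r// => a' b' _; rewrite /supp /= mul0r.
have [k0'|k0'] := eqVneq k' 0.
  by rewrite conv_out ?k0' ?(mulr0, mul0r)// => a' b' _ _; rewrite /supp /= mul0r.
rewrite (conv_slice (slice_le (@sZ _ _) sf) (slice_le (@sZ _ _) sg) ab).
- by rewrite mulrACA.
- by apply/eqP; rewrite mulf_neq0//; exact/eqP.
- by apply/eqP; rewrite mulf_neq0//; exact/eqP.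
Qed.

Lemma evl_mul l l' : convolution (evl l) (evl l') = evl (lmul l l').
Proof.
have ffZ q : ffin (fun z => q.1 * ind q.2 z).
  apply: ffin_slice; apply: slice_le (slice_ind q.2) => z.
  by rewrite /supp /= => h h'; apply: h; rewrite h' mulr0.
have evlE q l1 : evl (q :: l1) = fun z => q.1 * ind q.2 z + evl l1 z.
  by apply/funext => z; exact: evl_cons.
have evl0 : evl [::] = fun _ => 0 by apply/funext => z; exact: evl_nil.
elim: l => [|q l IH]; first by rewrite evl0 conv0l -evl0.
rewrite evlE convDl//; try exact: ffin_evl.
apply/funext => z; rewrite IH [lmul _ _]/= evl_cat; congr (_ + _) => {IH}.
elim: l' => [|q' l' IH]; first by rewrite /= evl0 conv0r.
rewrite evlE convDr//; last exact: ffin_evl.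
rewrite IH [map _ _]/= evl_cons; congr (_ + _).
by rewrite convZ_slice ?conv_ind//; exact: slice_ind.
Qed.

(** The function h is arbitrary, since a simple function takes finitely many values. Induction on
    the list: on the slice of the first term the value is h (k + v), off it h v. Subtracting h 0
    makes the result vanish where the combination does. *)
Lemma evl_compose (h : R[i] -> R[i]) l : exists l', forall z, evl l' z = h (evl l z) - h 0.
Proof.
elim: l h => [|[k s] l IH] h.
  by exists [::] => z; rewrite !evl_nil subrr.
have [l1 h1] := IH (fun v => h (k + v)); have [l2 h2] := IH h.
exists (lmeet [:: (1, s)] (l1 ++ [:: (h k - h 0, s)] ++ lscale (-1) l2) ++ l2) => z.
rewrite !(evl_cat, evl_meet, evl_scale, evl_cons, evl_nil) h1 h2 /= !addr0 mul1r.
have [sz|sz] := pselect (Th M s z).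
  by rewrite (ind1 sz) !mulr1 mul1r; ring.
by rewrite (ind0 sz) !mulr0 mul0r !add0r.
Qed.

End Functions.

(** * The supremum norm bound on a slice *)

Section CircleBound.
Context {R : realType} {d : Order.disp_t} {B : cbDistrLatticeType d} {L : choiceType}.
Variable D : gbds B L.
Context {G : groupoid}.
Variable M : model D G.
Local Notation fct := (garrow G -> R[i]).

(** Stated for a variable class F of functions, so that one bound serves both simple functions and
    C_c(G). *)
Record rep_on (A : cstarAlgType R) (F : set fct) (pi : fct -> A) : Prop := RepOn {
  rep_onD : forall f g, F f -> F g -> pi (fun z => f z + g z) = pi f + pi g;
  rep_onZ : forall (k : R[i]) f, F f -> pi (fun z => k * f z) = k *: pi f;
  rep_onM : forall f g, F f -> F g -> pi (convolution f g) = cmul (pi f) (pi g);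
  rep_onV : forall f, F f -> pi (involution f) = cadj (pi f)
}.

(** The function f^* * f lives on the units and takes values in [0, c^2], and there convolution is
    the pointwise product. A pointwise solution of the circle equation thus gives one for the images
    under pi, and [nrm_circle] bounds |pi f|^2. Only continuous h are asked for, so that the class
    C_c(G) qualifies. *)
Lemma circle_bound (A : cstarAlgType R) (F : set fct) (pi : fct -> A) (f : fct) (c : R) :
  rep_on F pi -> F f -> slice M (supp f) -> F (involution f) ->
  (forall h : R -> R, continuous h -> h 0 = 0 ->
     F (fun z => real_complex R (h (complex.Re (convolution (involution f) f z))))) ->
  0 <= c -> (forall z, nrm (f z) <= c) -> nrm (pi f) <= c.
Proof.
move=> [pD pZ pM pV] Ff sf Fif Fh c0 fc.
set psi := convolution (involution f) f.
have upsi : unitfun M psi by exact: conv_adj_unit.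
have rpsi z : exists2 r : R, 0 <= r <= c ^+ 2 & psi z = real_complex R r.
  have := conv_adj sf z; rewrite -/psi => -[[a fa [_ ->]]|->]; last first.
    by exists 0 => //; rewrite lexx exprn_ge0.
  exists (nrm (f a) ^+ 2) => //.
  by rewrite exprn_ge0 ?nrm_ge0//= ler_pXn2r ?nnegrE ?nrm_ge0.
pose Rp z := complex.Re (psi z).
have Rpsi z : psi z = real_complex R (Rp z).
  by rewrite /Rp; have [r _ ->] := rpsi z.
have Rpb z : 0 <= Rp z <= c ^+ 2.
  by rewrite /Rp; have [r rb ->] := rpsi z.
pose lift (h : R -> R) : fct := fun z => real_complex R (h (Rp z)).
have Flift h : continuous h -> h 0 = 0 -> F (lift h) by move=> hc h0; exact: Fh.
have ulift h : h 0 = 0 -> unitfun M (lift h).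
  move=> h0 z nz; apply: upsi => E; apply: nz.
  by rewrite /lift /Rp E h0.
have Mlift h k : h 0 = 0 -> k 0 = 0 ->
    convolution (lift h) (lift k) = lift (fun x => h x * k x).
  move=> h0 k0; rewrite (@conv_unit _ _ _ _ _ _ M); [|exact: ulift|exact: ulift].
  by apply/funext => z; rewrite /lift rmorphM.
have Vlift h : h 0 = 0 -> involution (lift h) = lift h.
  move=> h0; apply: (involution_unit (M := M)); first exact: ulift.
  by move=> z; apply/CrealP; rewrite /lift complex_real.
pose C := c ^+ 2.
have C0 : 0 <= C by exact: exprn_ge0.
pose h1 (x : R) := x.
(* The solution of x^2 + h^2 = 2 C h that vanishes at 0. Beyond |x| = C the square root is 0 by
   convention, so [h2] is continuous on all of R. *)
pose h2 (x : R) := C - Num.sqrt (C ^+ 2 - x ^+ 2).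
have ch1 : continuous h1 by move=> x; exact: cvg_id.
have ch2 : continuous h2.
  move=> x; apply: cvgB; first exact: cvg_cst.
  apply: continuous_comp; last exact: sqrt_continuous.
  by apply: cvgB; [exact: cvg_cst|apply: cvgM; exact: cvg_id].
have h10 : h1 0 = 0 by [].
have h20 : h2 0 = 0 by rewrite /h2 expr0n /= subr0 sqrtr_sqr ger0_norm ?subrr.
have E1 : psi = lift h1 by apply/funext => z; rewrite Rpsi.
have bpsi : nrm (pi psi) <= C.
  rewrite E1; apply: (@nrm_circle _ _ _ (pi (lift h2)) C) => //.
  - by rewrite -pV ?Vlift//; exact: Flift.
  - by rewrite -pV ?Vlift//; exact: Flift.
  - rewrite -!pM ?Mlift//; try exact: Flift.
    by congr pi; apply/funext => z; rewrite /lift mulrC.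
  rewrite -!pM ?Mlift//; try exact: Flift.
  have c1 : continuous (fun x => h1 x * h1 x) by move=> x; apply: cvgM; exact: ch1.
  have c2 : continuous (fun x => h2 x * h2 x) by move=> x; apply: cvgM; exact: ch2.
  rewrite -pD; [|by apply: Flift; rewrite ?h10 ?mulr0|by apply: Flift; rewrite ?h20 ?mulr0].
  rewrite -pZ; last exact: Flift.
  congr pi; apply/funext => z; rewrite /lift -rmorphD -rmorphM; congr (real_complex R _).
  have /andP[r0 rC] := Rpb z; set r := Rp z in r0 rC *; rewrite -/C in rC.
  have q : 0 <= C ^+ 2 - r ^+ 2 by rewrite subr_ge0 ler_pXn2r.
  rewrite /h1 /h2; have := sqr_sqrtr q; rewrite !expr2; set S := Num.sqrt _ => hS.
  by rewrite mulrBl !mulrBr hS; ring.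
move: bpsi; rewrite pM// pV// nrm_adjM => h.
by rewrite -(@ler_pXn2r _ 2)// ?nnegrE ?nrm_ge0.
Qed.

End CircleBound.

(** * The representation T on simple functions *)

Section SimpleRep.
Context {R : realType} {d : Order.disp_t} {B : cbDistrLatticeType d} {L : choiceType}.
Variable D : gbds B L.
Context {A : cstarAlgType R} {p : B -> A} {s : L -> B -> A}.
Hypothesis rep : gbds_rep D p s.
Context {G : groupoid}.
Variable M : model D G.
Local Notation sgp := (sgp D).
Local Notation pt := (pt D).
Local Notation slist := (@slist R _ _ _ D).
Local Notation fct := (garrow G -> R[i]).
Local Notation "x ** y" := (cmul x y) (at level 40, left associativity).
Local Notation T := (@Trep _ _ _ _ D A p s).
Local Notation Qm := (@Qm _ _ _ _ D A p s).
Local Notation evl := (@evl R _ _ _ D G M).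

Definition Tl (l : slist) : A := \sum_(q <- l) q.1 *: T q.2.

Lemma Tl_nil : Tl [::] = 0. Proof. by rewrite /Tl big_nil. Qed.

Lemma Tl_cons q l : Tl (q :: l) = q.1 *: T q.2 + Tl l.
Proof. by rewrite /Tl big_cons. Qed.

Lemma Tl_cat l l' : Tl (l ++ l') = Tl l + Tl l'.
Proof. by rewrite /Tl big_cat. Qed.

Lemma Tl_scale k l : Tl (lscale k l) = k *: Tl l.
Proof. by rewrite /Tl big_map scaler_sumr; apply: eq_bigr => q _; rewrite scalerA. Qed.

Lemma Tl_mul l l' : Tl (lmul l l') = Tl l ** Tl l'.
Proof.
rewrite /Tl big_allpairs_dep cmul_suml; apply: eq_bigr => q _.
rewrite cmul_sumr; apply: eq_bigr => q' _ /=.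
by rewrite (TrepM rep) cmulZl cmulZr scalerA.
Qed.

Lemma Tl_adj l : Tl (ladj l) = cadj (Tl l).
Proof.
rewrite /Tl big_map cadj_sum; apply: eq_bigr => q _ /=.
by rewrite TrepV cadjZ.
Qed.

Definition inpt (x : pt) (e : sgp) : R[i] := (`[< pmem x e >])%:R.

(** Each idempotent f of the list splits the cell of (e, F) into those of (e f, F) and (e, f :: F),
    on which its coefficient does or does not count. When the list is exhausted, an empty cell means
    that F covers e, and [Trep_tight] makes its contribution 0. *)
Lemma Qm_local (l : slist) (e : sgp) (F : seq sgp) (c : R[i]) :
  (forall q, q \in l -> idem q.2) -> idem e -> (forall f, f \in F -> idem f) ->
  (forall x, incell e F x -> \sum_(q <- l) q.1 * inpt x q.2 = c) ->
  Qm (\sum_(q <- l) q.1 *: (T e ** T q.2)) F = c *: Qm (T e) F.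
Proof.
elim: l e F c => [|[k f] l IH] e F c il ie iF h.
  rewrite big_nil Qm0; have [[x xF]|n] := pselect (exists x, incell e F x).
    by rewrite -(h x xF) big_nil scale0r.
  rewrite (Trep_tight rep ie iF) ?scaler0//.
  apply: contrapT => nc; have [x [xe xF]] := pt_exists ie iF nc.
  by apply: n; exists x; split=> //; rewrite dom_idem.
have jf : idem f by exact: (il (k, f) (mem_head _ _)).
have il' q : q \in l -> idem q.2 by move=> ql; apply: il; rewrite inE ql orbT.
have ief : idem (sm e f) by exact: idemM.
have iF' g : g \in f :: F -> idem g by rewrite inE => /orP[/eqP ->//|]; exact: iF.
have h1 := IH (sm e f) F (c - k) il' ief iF.
rewrite big_cons.
set S := \sum_(q <- l) _.
have hA : Qm (S ** T f) F = (c - k) *: Qm (T e ** T f) F.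
  rewrite -(TrepM rep) -h1 => [|x [xef xF]].
    congr (Qm _ F); rewrite /S cmul_suml; apply: eq_big_seq => q ql.
    by rewrite cmulZl -!(TrepM rep) -!smA (idemC (il' _ ql) jf).
  rewrite dom_idem// in xef; have [xe xf] := (memM x ie jf).1 xef.
  have := h x (conj (_ : pmem x (dom e)) xF); rewrite dom_idem// => /(_ xe).
  by rewrite big_cons /= /inpt (asboolT xf) mulr1 => <-; rewrite addrC addKr.
have hB : Qm S (f :: F) = c *: Qm (T e) (f :: F).
  apply: IH => // x [xe xF].
  have nf : ~ pmem x f by apply: xF; rewrite mem_head.
  rewrite -(h x); last by split=> // g gF; apply: xF; rewrite inE gF orbT.
  by rewrite big_cons /= /inpt (asboolF nf) mulr0 add0r.
have QB x y : Qm (x - y) F = Qm x F - Qm y F.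
  by rewrite QmD -scaleN1r QmZ scaleN1r.
rewrite [Qm S _]/= [Qm (T e) _]/= !QB hA in hB.
rewrite QmD QmZ; apply: (addIr (- ((c - k) *: Qm (T e ** T f) F))).
rewrite -addrA hB scalerBr scalerBl opprB.
by rewrite addrCA; congr (_ + _); rewrite addrC.
Qed.

(** Restricted to the slice of t, the combination is T t times a combination of the idempotents
    [sd q t], whose values at points below [dom t] are those of the function. [Qm_local] with the
    empty list F concludes. *)
Lemma Tl_meet0 l t : (forall z, Th M t z -> evl l z = 0) -> Tl (lmeet l [:: (1, t)]) = 0.
Proof.
move=> h.
have E : Tl (lmeet l [:: (1, t)]) =
   T t ** \sum_(q <- [seq (q.1, sd q.2 t) | q <- l]) q.1 *: (T (dom t) ** T q.2).
  rewrite /Tl big_allpairs_dep big_map cmul_sumr; apply: eq_bigr => q _.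
  rewrite big_seq1 /= mulr1 cmulZr; congr (_ *: _).
  rewrite /smeet sm_sd -!(TrepM rep) smA sm_dom.
  by [].
rewrite E; set S := \sum_(q <- _) _; suff -> : S = 0 by rewrite cmulr0.
have := @Qm_local [seq (q.1, sd q.2 t) | q <- l] (dom t) [::] 0; rewrite scale0r; apply => //.
- by move=> _ /mapP[q _ ->]; exact: idem_sd.
- exact: idem_dom.
move=> x [xt _]; rewrite dom_idem in xt; last exact: idem_dom.
have [z tz Ez] := Th_of M xt; apply: etrans (h z tz); rewrite /evl big_map.
apply: eq_bigr => q _ /=; congr (_ * _); rewrite /inpt /ind; congr (_%:R).
by congr (nat_of_bool _); apply/asbool_equiv_eq; rewrite -Ez (Th_sd q.2 tz).
Qed.

(** The value of T on the part of [t] outside the slices of [js], by inclusion-exclusion. *)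
Fixpoint Tj (js : seq sgp) (t : sgp) : A :=
  if js is j :: js' then Tj js' t - Tj js' (smeet t j) else T t.

Definition Tjl js (l : slist) : A := \sum_(q <- l) q.1 *: Tj js q.2.

Lemma Tjl_eq js l : (forall z, evl l z = 0) -> Tjl js l = Tl l.
Proof.
elim: js l => [|j js IH] l h //.
have -> : Tjl (j :: js) l = Tjl js l - Tjl js (lmeet l [:: (1, j)]).
  rewrite /Tjl [X in _ - X]big_allpairs_dep -sumrB; apply: eq_bigr => q _.
  by rewrite big_seq1 /= mulr1 scalerBr.
rewrite IH// IH => [|z]; last by rewrite evl_meet h mul0r.
by rewrite Tl_meet0 ?subr0.
Qed.

Lemma Tj_kill js (t u : sgp) : t \in js -> u = sm t (dom u) -> Tj js u = 0.
Proof.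
elim: js u => //= j js IH u; rewrite inE => /orP[/eqP <- E|tj E].
  by rewrite smeet_le// subrr.
by rewrite !IH ?subr0//; exact: smeet_lel.
Qed.

(** The slices of all elements occurring in l are removed. By [Tjl_eq] this leaves [Tl l] unchanged,
    because the function vanishes on each of them; by [Tj_kill] nothing is left. *)
Lemma Tl_wd0 l : (forall z, evl l z = 0) -> Tl l = 0.
Proof.
move=> h; rewrite -(Tjl_eq [seq q.2 | q <- l] h) /Tjl big1_seq// => q /andP[_ ql].
by rewrite (@Tj_kill _ q.2) ?scaler0 ?sm_dom//; apply/mapP; exists q.
Qed.

Lemma Tl_wd l l' : (forall z, evl l z = evl l' z) -> Tl l = Tl l'.
Proof.
move=> h; apply/eqP; rewrite -subr_eq0; apply/eqP.
rewrite -scaleN1r -Tl_scale -Tl_cat; apply: Tl_wd0 => z.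
by rewrite evl_cat evl_scale h mulN1r subrr.
Qed.

Definition SF : set fct := range evl.

Definition Tf (f : fct) : A :=
  if pselect (exists l, evl l = f) is left h then Tl (sval (cid h)) else 0.

Lemma TfE l : Tf (evl l) = Tl l.
Proof.
rewrite /Tf; case: pselect => [h|]; last by case; exists l.
by case: cid => l' /= E; apply: Tl_wd => z; rewrite E.
Qed.

Lemma Tf_rep : rep_on SF Tf.
Proof.
split=> [_ _ [l _ <-] [l' _ <-]|k _ [l _ <-]|_ _ [l _ <-] [l' _ <-]|_ [l _ <-]].
- rewrite !TfE -Tl_cat -TfE; congr Tf; apply/funext => z; by rewrite evl_cat.
- rewrite !TfE -Tl_scale -TfE; congr Tf; apply/funext => z; by rewrite evl_scale.
- by rewrite evl_mul !TfE Tl_mul.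
- by rewrite -evl_adj !TfE Tl_adj.
Qed.

Lemma Tl_bound l (c : R) : slice M (supp (evl l)) -> 0 <= c ->
  (forall z, nrm (evl l z) <= c) -> nrm (Tl l) <= c.
Proof.
move=> sl c0 lc; rewrite -TfE; apply: (circle_bound (M := M) Tf_rep) => //.
- by exists l.
- by rewrite -evl_adj; exists (ladj l).
move=> h _ h0; rewrite -evl_adj evl_mul.
have [l' hl'] := evl_compose M (fun v : R[i] => real_complex R (h (complex.Re v))) (lmul (ladj l) l).
exists l' => //; apply/funext => z; rewrite hl' /= h0.
by rewrite (_ : real_complex R 0 = 0)// subr0.
Qed.

Lemma evl_indicator l : exists k, forall z, evl k z = (`[< supp (evl l) z >])%:R.
Proof.
have [k hk] := evl_compose M (fun v : R[i] => (v != 0)%:R) l; exists k => z.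
rewrite hk eqxx subr0; congr (_%:R); congr (nat_of_bool _).
apply/idP/asboolP => [/eqP//|h]; exact/eqP.
Qed.

(* The function is split along the supports of the members of [ls]. *)
Lemma Tl_bound_sum (ls : seq slist) (c : R) : 0 <= c ->
  (forall l, l \in ls -> slice M (supp (evl l))) ->
  (forall z, nrm (evl (flatten ls) z) <= c) ->
  nrm (Tl (flatten ls)) <= (size ls)%:R * c.
Proof.
move=> c0; move: {2}(size ls) (erefl (size ls)) => n.
elim: n ls => [|n IH] ls.
  by move=> /size0nil ->; rewrite Tl_nil nrm0 mul0r.
case: ls => // l ls [szn] sl b.
have [k hk] := evl_indicator l.
(* [chi] is the whole sum restricted to the support of the first member, a single slice with bound
   c; [co l'] is l' off that support, so the remaining sum keeps the bound c. *)
pose chi := lmeet k (flatten (l :: ls)).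
pose co l' := l' ++ lscale (-1) (lmeet k l').
have coE l' z : evl (co l') z = (1 - (`[< supp (evl l) z >])%:R) * evl l' z.
  by rewrite evl_cat evl_scale evl_meet hk; ring.
have cosE z : evl (flatten [seq co l' | l' <- ls]) z =
    (1 - (`[< supp (evl l) z >])%:R) * evl (flatten ls) z.
  elim: (ls) => [|l' ls' IHls] /=; first by rewrite evl_nil mulr0.
  by rewrite evl_cat IHls coE evl_cat mulrDr.
have E : Tl (flatten (l :: ls)) = Tl chi + Tl (flatten [seq co l' | l' <- ls]).
  rewrite -Tl_cat; apply: Tl_wd => z; rewrite evl_cat evl_meet hk cosE /= evl_cat.
  case: asboolP => [_|/supp0 ->]; first by rewrite subrr mul0r addr0 mul1r.
  by rewrite subr0 mul0r !add0r mul1r.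
rewrite E [size _]/= -natr1 mulrDl mul1r addrC.
apply: le_trans (nrmD _ _) _; apply: lerD.
  rewrite -(size_map co ls); apply: IH; first by rewrite size_map.
  - move=> _ /mapP[l' l'ls ->]; apply: slice_le (sl l' _); last by rewrite inE l'ls orbT.
    by move=> z; rewrite /supp /= coE => h h'; apply: h; rewrite h' mulr0.
  - move=> z; rewrite cosE; case: asboolP => [_|/supp0 l0]; first by rewrite subrr mul0r nrm0.
    by rewrite subr0 mul1r; have := b z; rewrite /= evl_cat l0 add0r.
apply: Tl_bound => //.
  apply: slice_le (sl l (mem_head _ _)) => z; rewrite /supp /= evl_meet hk.
  by case: asboolP => // _; rewrite mul0r.
move=> z; rewrite evl_meet hk; case: asboolP => _; first by rewrite mul1r; exact: b.
by rewrite mul0r nrm0.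
Qed.

End SimpleRep.

(** * Uniform approximation by simple functions *)

(** If P failed on K, the complements in K of the sets with P would generate a proper filter; a
    cluster point of it contradicts P near that point. *)
Lemma compact_ind (X : topologicalType) (K : set X) (P : set X -> Prop) :
  compact K -> P set0 -> (forall U V, U `<=` V -> P V -> P U) ->
  (forall U V, P U -> P V -> P (U `|` V)) ->
  (forall z, K z -> exists2 U, nbhs z U & P U) -> P K.
Proof.
move=> cK P0 Pm PU Pl; apply: contrapT => nP.
pose F : set_system X := [set A | exists2 U, P U & K `\` U `<=` A].
have FF : ProperFilter F.
  apply: Build_ProperFilter_ex.
    move=> A [U PU' KA]; apply: contrapT => nA; apply: nP; apply: Pm PU' => z Kz.
    by apply: contrapT => nU; apply: nA; exists z; apply: KA.
  split.
  - by exists set0.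
  - move=> A A' [U PU1 KA] [V PV KA']; exists (U `|` V); first exact: PU.
    by move=> z [Kz nUV]; split; [apply: KA|apply: KA']; split=> // h; apply: nUV; [left|right].
  - by move=> A A' AA' [U PU1 KA]; exists U => // z /KA /AA'.
have [|z [Kz cz]] := cK F FF; first by exists set0 => // z [].
have [U zU PU1] := Pl z Kz.
have [|w [[Kw nU] Uw]] := cz (K `\` U) U _ zU; first by exists U.
exact: nU.
Qed.

(** * Cells, compactness of slices, and continuous functions *)

Section Topology.
Context {R : realType} {d : Order.disp_t} {B : cbDistrLatticeType d} {L : choiceType}.
Variable D : gbds B L.
Context {G : groupoid}.
Variable M : model D G.
Local Notation sgp := (sgp D).
Local Notation pt := (pt D).
Local Notation arr := (garrow G).
Local Notation slist := (@slist R _ _ _ D).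
Local Notation fct := (garrow G -> R[i]).
Local Notation evl := (@evl R _ _ _ D G M).
Implicit Types (s t e : sgp) (x y : pt) (z w : arr) (l k : slist).

Definition cellset s (F : seq sgp) : set arr :=
  [set z | Th M s z /\ forall f, f \in F -> ~ pmem (sr M z) f].

Lemma open_cell s F : (forall f, f \in F -> idem f) -> open (cellset s F).
Proof.
move=> iF; have [->|/eqP s0] := eqVneq s (s0 D).
  by rewrite (_ : cellset _ _ = set0); [exact: open0|rewrite -subset0 => z [/Th0]].
pose Z := [set z | exists2 x, incell s F x & z = mk M s x].
have bZ : gbase Z by exact: mk_cell.
have EZ : cellset s F = [set z : arr | Z (sval z)].
  apply/seteqP; split=> z.
    by move=> [sz nF]; have [xs Ez] := Th_sr sz; exists (sr M z).
  move=> [x [xs nF] Ez]; have sz : Th M s z by exists x.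
  split=> //; have [ys Ez'] := Th_sr sz; suff -> : sr M z = x by [].
  by rewrite Ez' in Ez; have [] := (mk_eq M ys xs).1 Ez.
exists [set cellset s F]; last by rewrite bigcup_set1.
move=> _ ->; exists [fset (cellset s F)]%fset.
  by move=> X; rewrite !inE => /eqP ->; apply/mem_set; exists Z.
by apply/seteqP; split=> z /= h; [apply: h; rewrite /= inE|move=> X /=; rewrite inE => /eqP ->].
Qed.

Lemma cell_meet s F t F' z : cellset s F z -> cellset t F' z ->
  cellset (smeet s t) (F ++ F') z /\
  cellset (smeet s t) (F ++ F') `<=` cellset s F `&` cellset t F'.
Proof.
move=> [sz nF] [tz nF']; split.
  split; first exact/Th_meet.
  by move=> f; rewrite mem_cat => /orP[]; [exact: nF|exact: nF'].
move=> w [/Th_meet[sw tw] nw]; split; split=> // f fF; apply: nw;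
  by rewrite mem_cat fF ?orbT.
Qed.

(** The topology is generated by [gbase] as a subbase. Each member contains a cell around each of
    its arrows, and cells through a common arrow intersect in a cell around it. *)
Lemma nbhs_cell z (U : set arr) : nbhs z U -> exists t F,
  [/\ forall f, f \in F -> idem f, cellset t F z & cellset t F `<=` U].
Proof.
rewrite nbhsE => -[V [[D' sD' <-] [A D'A Az]] VU].
have [I' sI' EA] := sD' A D'A.
suff [t [F [iF zF cF]]] : exists t F, [/\ forall f, f \in F -> idem f, cellset t F z &
    cellset t F `<=` \bigcap_(i in [set` I']) i].
  by exists t, F; split=> // w /cF; rewrite EA => Aw; apply: VU; exists A.
have {Az} : (\bigcap_(i in [set` I']) i) z by rewrite EA.
have hI i : i \in I' -> exists2 Z, gbase Z & i = [set x : arr | Z (sval x)].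
  by move=> /sI' /set_mem.
have -> : \bigcap_(i in [set` I']) i = [set w | forall i, i \in finmap.enum_fset I' -> i w].
  by apply/seteqP; split=> w h i iI; exact: h.
have {}hI i : i \in finmap.enum_fset I' ->
    exists2 Z, gbase Z & i = [set x : arr | Z (sval x)] by exact: hI.
elim: (finmap.enum_fset I') hI => [_ _|i js IH hI zI].
  have [s sz] := Th_ex M z; exists s, [::]; split=> //.
have [||t [F [iF zF cF]]] := IH.
- by move=> j jI; apply: hI; rewrite inE jI orbT.
- by move=> j jI; apply: zI; rewrite inE jI orbT.
have [Z bZ Ei] := hI i (mem_head _ _).
have zi := zI i (mem_head _ _).
have [s sz] := Th_ex M z; have [xs Ez] := Th_sr sz.
have Zz : Z (mk M s (sr M z)) by rewrite Ei /= Ez in zi.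
have [u [F' [su iF' [ux nF'] hZ]]] := mk_base bZ xs Zz.
have uz : Th M u z by apply/(Th_sd u sz); exact: sd_sym.
have [zm cm] := cell_meet zF (conj uz nF').
exists (smeet t u), (F ++ F'); split=> //.
  by move=> f; rewrite mem_cat => /orP[]; [exact: iF|exact: iF'].
move=> w /cm[/cF tw [uw nw]] j; rewrite inE => /orP[/eqP ->|jI]; last exact: tw.
have [yu Ew] := Th_sr uw.
by rewrite Ei /= Ew; exact: hZ.
Qed.

Lemma open_Th s : open (Th M s).
Proof.
have -> : Th M s = cellset s [::] by apply/seteqP; split=> [z sz|z []//]; split.
exact: open_cell.
Qed.

(** Slices are clopen: off the slice of s, an arrow with germ t has the cell of t without [sd s t]
    as a neighbourhood disjoint from that slice. Here the meets in S are essential. *)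
Lemma evl_near l z : \forall w \near z, evl l w = evl l z.
Proof.
elim: l => [|[k s] l IH].
  by near=> w; rewrite !evl_nil.
have h : \forall w \near z, ind (R := R) M s w = ind M s z.
  have [sz|sz] := pselect (Th M s z).
    have : nbhs z (Th M s) by apply: open_nbhs_nbhs; split=> //; exact: open_Th.
    by apply: filterS => w sw; rewrite !ind1.
  have [t tz] := Th_ex M z.
  have : nbhs z (cellset t [:: sd s t]).
    apply: open_nbhs_nbhs; split.
      by apply: open_cell => f; rewrite inE => /eqP ->; exact: idem_sd.
    split=> // f; rewrite inE => /eqP -> h; apply: sz; exact/(Th_sd s tz).
  apply: filterS => w [tw nw]; rewrite (ind0 sz) ind0// => sw.
  by apply: (nw (sd s t)); [rewrite mem_head|apply/(Th_sd s tw)].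
near=> w; rewrite !evl_cons; congr (_ * _ + _).
  by near: w.
by near: w.
Unshelve. all: by end_near.
Qed.

Lemma open_supp l : open (supp (evl l)).
Proof.
rewrite openE => z lz; apply: filterS (evl_near l z) => w Ew.
by rewrite /supp /= Ew.
Qed.

(** The idempotents that contain the sources of U-almost all arrows form a filter, tight because U
    is prime. U converges to the arrow of the slice of s with this source. *)
Lemma ultra_cvg_Th (U : set_system arr) s : UltraFilter U -> U (Th M s) ->
  exists z, U --> z.
Proof.
move=> UU Us; pose S e : set arr := [set w | pmem (sr M w) e].
have uor (A C : set arr) : U (A `|` C) -> U A \/ U C.
  move=> UAC; have [|nA] := in_ultra_setVsetC A UU; first by left.
  by right; apply: filterS (filterI UAC nA) => w [[]].
have [x hx] : exists x, forall e, pmem x e <-> idem e /\ U (S e).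
  apply: pt_of.
  - by move=> e [].
  - exists (dom s); split; first exact: idem_dom.
    by apply: filterS Us => w /Th_sr[].
  - move=> [_ h]; have [w] := @filter_ex _ U _ _ h; exact: mem0.
  - move=> e f ie jf; have E w : S (sm e f) w <-> S e w /\ S f w by exact: memM.
    split=> [[_ h]|[[_ h1] [_ h2]]].
      by split; split=> //; apply: filterS h => w /E[].
    split; first exact: idemM.
    by apply: filterS (filterI h1 h2) => w [h3 h4]; apply/E.
  - move=> e F [ie Ue] iF cF.
    suff [f fF Uf] : exists2 f, f \in F & U (S f) by exists f => //; split=> //; exact: iF.
    have : U [set w | exists2 f, f \in F & S f w].
      by apply: filterS Ue => w we; exact: (mem_covers we iF cF).
    elim: (F) => [|f F' IH] h.
      by have [w [f]] := @filter_ex _ U _ _ h.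
    have [||/IH[g gF Ug]] := uor (S f) [set w | exists2 f, f \in F' & S f w].
    + apply: filterS h => w [g]; rewrite inE => /orP[/eqP ->|gF] gw; first by left.
      by right; exists g.
    + by move=> Uf; exists f => //; rewrite mem_head.
    + by exists g => //; rewrite inE gF orbT.
have Sin e : ~ pmem x e -> idem e -> U (~` S e).
  move=> nx ie; have [h|//] := in_ultra_setVsetC (S e) UU.
  by case: nx; apply/hx.
have xs : pmem x (dom s).
  by apply/hx; split; [exact: idem_dom|apply: filterS Us => w /Th_sr[]].
have [z sz Ez] := Th_of M xs; exists z => V /nbhs_cell[t [F [iF [tz nF] cV]]].
have Ut : U (Th M t).
  have : pmem x (sd t s) by rewrite -Ez; apply/(Th_sd t sz).
  by move=> /hx[_ h]; apply: filterS (filterI h Us) => w [h1 sw]; apply/(Th_sd t sw).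
rewrite Ez in nF.
have : U [set w | forall f, f \in F -> ~ S f w].
  elim: (F) iF nF => [|f F' IH] iF nF; first by apply: filterS Us.
  have h1 := Sin f (nF f (mem_head _ _)) (iF f (mem_head _ _)).
  have h2 : U [set w | forall f, f \in F' -> ~ S f w].
    by apply: IH => g gF; [apply: iF|apply: nF]; rewrite inE gF orbT.
  apply: filterS (filterI h1 h2) => w [h3 h4] g; rewrite inE => /orP[/eqP ->//|].
  exact: h4.
by move=> h; apply: filterS (filterI Ut h) => w [tw nw]; apply: cV.
Qed.

Lemma compact_supp l : compact (supp (evl l)).
Proof.
rewrite compact_ultra => U UU Ul.
suff [z Uz] : exists z, U --> z.
  exists z; split=> //.
  have [w [Ew lw]] := @filter_ex _ U _ _ (filterI (Uz _ (evl_near l z)) Ul).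
  by rewrite /supp /= -Ew.
suff [s Us] : exists s, U (Th M s) by exact: ultra_cvg_Th Us.
elim: l Ul => [|[k s] l IH] h.
  by have [w] := @filter_ex _ U _ _ h; case; rewrite evl_nil.
have [|ns] := in_ultra_setVsetC (Th M s) UU; first by exists s.
apply: IH; apply: filterS (filterI ns h) => w [nw]; rewrite /supp /= evl_cons.
by rewrite (ind0 nw) mulr0 add0r.
Qed.

Lemma bisection_slice (U : set arr) : bisection U -> slice M U.
Proof.
move=> [_ h1 h2]; split=> a b /mem_set Ua /mem_set Ub E; [apply: h1|apply: h2] => //.
  exact/(gsrcE M).
exact/(grngE M).
Qed.

Lemma slice_bisection (U : set arr) : open U -> slice M U -> bisection U.
Proof.
move=> oU [h1 h2]; split=> // a b /set_mem Ua /set_mem Ub E; [apply: h1|apply: h2] => //.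
  exact/(gsrcE M).
exact/(grngE M).
Qed.

Definition contf (f : fct) := forall z (e : R), 0 < e -> \forall w \near z, nrm (f z - f w) <= e.

Lemma Cc_intro f k : contf f -> supp f `<=` supp (evl k) -> slice M (supp (evl k)) -> Cc f.
Proof.
move=> cf fk sk; exists 1%N, (fun _ => f); split; last first.
  by apply/funext => z; rewrite big_ord1.
move=> _; exists (supp (evl k)); first exact: slice_bisection (@open_supp k) sk.
split; last first.
  exists (supp (evl k)); split=> //; first exact: compact_supp.
  by move=> z nz; apply: supp0 => /fk.
move=> z _ X /nbhs_ballP[e /= e0 eX].
have [ee e1] := lt0_complex e0.
have h := cf z (complex.Re e / 2) ltac:(lra).
suff : nbhs z (f @^-1` X) by [].
apply: filterS h => w h; apply: eX; apply/(@ball_nrm R R[i]^o) => //.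
by apply: le_lt_trans h _; lra.
Qed.

(** The uniform limits of simple functions with support in a fixed compact open set, namely the
    support of [evl k]. *)
Definition AF k (f : fct) := supp f `<=` supp (evl k) /\
  forall e : R, 0 < e -> exists l, forall z, nrm (f z - evl l z) <= e.

Lemma AF_contf k f : AF k f -> contf f.
Proof.
move=> [_ h] z e e0; have [l hl] := h (e / 2) ltac:(lra).
apply: filterS (evl_near l z) => w E.
have hw := hl w; rewrite E nrm_distrC in hw; have hz := hl z.
have := nrm_trans (evl l z) (f z) (f w); lra.
Qed.

Lemma AF_slice k (f : fct) (e : R) : AF k f -> 0 < e -> exists l,
  supp (evl l) `<=` supp (evl k) /\ forall z, nrm (f z - evl l z) <= e.
Proof.
move=> [fk h] e0; have [l hl] := h e e0; have [i hi] := evl_indicator M k.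
exists (lmeet i l); split=> z.
  by rewrite /supp /= evl_meet hi; case: asboolP => // _; rewrite mul0r.
rewrite evl_meet hi; case: asboolP => [_|nz]; first by rewrite mul1r.
have -> : f z = 0 by apply: supp0 => /fk.
by rewrite mul0r subrr nrm0 ltW.
Qed.

Lemma Th_sub t f z : idem f -> Th M (sm t f) z <-> Th M t z /\ pmem (sr M z) f.
Proof.
move=> jf; have sdt : sm t f = sm (sm t f) f by rewrite -smA idemxx.
split=> [tz|[tz zf]].
  have [+ _] := Th_sr tz; rewrite domMe//.
  have idt := idem_dom t; move=> /(memM _ idt jf)[xt xf]; split=> //.
  by apply/(Th_sd t tz); apply: (mem_sd xt xf).
have [xt _] := Th_sr tz.
apply/(Th_sd _ tz); apply: (mem_sd (e := f)) => //.
by rewrite domMe//; apply/memM => //; exact: idem_dom.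
Qed.

Lemma evl_cell t F : (forall f, f \in F -> idem f) ->
  exists k, forall z, evl k z = (`[< cellset t F z >])%:R.
Proof.
elim: F => [|f F IH] iF.
  exists [:: (1, t)] => z; rewrite evl_cons evl_nil addr0 mul1r /ind; congr (_%:R).
  by congr (nat_of_bool _); apply/asbool_equiv_eq; split=> [|[]].
have [|k hk] := IH; first by move=> g gF; apply: iF; rewrite inE gF orbT.
have jf := iF f (mem_head _ _).
exists (k ++ lscale (-1) (lmeet k [:: (1, sm t f)])) => z.
rewrite evl_cat evl_scale evl_meet evl_cons evl_nil /= addr0 mul1r hk.
have [[tz nz]|nc] := asboolP (cellset t F z); last first.
  rewrite mul0r mulr0 addr0 asboolF// => -[tz nz]; apply: nc; split=> // g gF.
  by apply: nz; rewrite inE gF orbT.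
have [fz|fz] := pselect (pmem (sr M z) f).
  rewrite ind1; last exact/Th_sub.
  rewrite mulr1 mulr1 subrr asboolF// => -[_ n]; apply: (n f) => //; exact: mem_head.
rewrite ind0 ?mulr0 ?addr0; last by move=> /(Th_sub _ _ jf)[].
rewrite asboolT//; split=> // g; rewrite inE => /orP[/eqP ->//|]; exact: nz.
Qed.

(** Compactness applied to the property of being coverable, inside U, by the support of a simple
    function on which g is e-close to a simple function. Locally the constant value of g on a cell
    serves; outside both supports g and the approximant vanish. *)
Lemma Cc_on_AF (U : set arr) g : bisection U -> Cc_on U g ->
  exists2 k, supp (evl k) `<=` U & AF k g.
Proof.
move=> bU [cg [K [cK KU gK]]].
pose P (e : R) (X : set arr) := exists k l, [/\ supp (evl k) `<=` U, X `<=` supp (evl k),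
  supp (evl l) `<=` supp (evl k) & forall z, supp (evl k) z -> nrm (g z - evl l z) <= e].
have PK (e : R) : 0 < e -> P e K.
  move=> e0; apply: compact_ind cK _ _ _ _.
  - by exists [::], [::]; split=> // z; rewrite /supp /= evl_nil.
  - by move=> X Y XY [k [l [h1 h2 h3 h4]]]; exists k, l; split=> // z /XY /h2.
  - move=> X Y [k [l [h1 h2 h3 h4]]] [k' [l' [h1' h2' h3' h4']]].
    have [i hi] := evl_indicator M k; have [i' hi'] := evl_indicator M k'.
    (* [u] is the indicator of the union of the two supports; the approximant is l on the first one
       and l' on the rest. *)
    pose u := i ++ i' ++ lscale (-1) (lmeet i i').
    have us z : supp (evl u) z <-> supp (evl k) z \/ supp (evl k') z.
      rewrite {1}/supp /= !evl_cat evl_scale evl_meet hi hi'.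
      case: asboolP => h; case: asboolP => h';
       rewrite ?(mulr0, mulr1, mul0r, addr0, add0r, subr0, addrN); split.
      + by left.
      + by move=> _; apply/eqP; rewrite oner_neq0.
      + by left.
      + by move=> _; apply/eqP; rewrite oner_neq0.
      + by right.
      + by move=> _; apply/eqP; rewrite oner_neq0.
      + by case.
      + by case.
    exists u, (l ++ l' ++ lscale (-1) (lmeet i l')); split.
    + by move=> z /us[/h1|/h1'].
    + by move=> z [/h2|/h2'] h; apply/us; [left|right].
    + move=> z; rewrite {1}/supp /= !evl_cat evl_scale evl_meet => n; apply/us.
      have [|nk] := pselect (supp (evl k) z); first by left.
      have [|nk'] := pselect (supp (evl k') z); first by right.
      case: n; rewrite (_ : evl l z = 0); last by apply: supp0 => /h3.
      rewrite (_ : evl l' z = 0); last by apply: supp0 => /h3'.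
      by rewrite !mulr0 !addr0.
    + move=> z; rewrite !evl_cat evl_scale evl_meet hi => /us.
      case: asboolP => [kz _|nk [//|k'z]].
        by rewrite mul1r mulN1r subrr addr0; exact: h4.
      rewrite mul0r mulr0 addr0 (_ : evl l z = 0) ?add0r; first exact: h4'.
      by apply: supp0 => /h3.
  - move=> z Kz; have Uz := KU z Kz; have [oU _ _] := bU.
    have [t [F [iF zF cF]]] : exists t F, [/\ forall f, f \in F -> idem f, cellset t F z &
        cellset t F `<=` U `&` [set w | nrm (g w - g z) <= e]].
      apply: nbhs_cell; apply: filterI; first exact: open_nbhs_nbhs.
      have e0' : (0 : R[i]) < real_complex R e by rewrite ltcR.
      have h := cg z Uz _ (@nbhsx_ballx _ R[i]^o (g z) _ e0').
      rewrite nbhs_filterE fmapE in h.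
      apply: (filterS _ h) => w h2.
      have : nrm (g z - g w) < e by exact: ((@ball_nrmE R R[i]^o (g z) (g w) e e0).1 h2).
      by rewrite /= nrm_distrC => /ltW.
    have [k hk] := evl_cell t iF.
    have ks w : supp (evl k) w <-> cellset t F w.
      rewrite /supp /= hk; case: asboolP => h; split=> //.
      by move=> _; apply/eqP; rewrite oner_neq0.
    exists (cellset t F); first by apply: open_nbhs_nbhs; split=> //; exact: open_cell.
    exists k, (lscale (g z) k); split.
    + by move=> w /ks/cF[].
    + by move=> w /ks.
    + by move=> w; rewrite /supp /= evl_scale => h h'; apply: h; rewrite h' mulr0.
    + move=> w /ks cw; rewrite evl_scale hk asboolT// mulr1; by have [] := cF w cw.
have [k [l [h1 h2 h3 h4]]] := PK 1 ltr01.
have gs : supp g `<=` K by move=> z gz; apply: contrapT => /gK.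
exists k => //; split; first by move=> z /gs/h2.
move=> e e0; have [k' [l' [h1' h2' h3' h4']]] := PK e e0; exists l' => z.
have [/h4'//|nk] := pselect (supp (evl k') z).
have g0 : g z = 0 by apply: gK => /h2'.
have l0 : evl l' z = 0 by apply: supp0 => /h3'.
by rewrite g0 l0 subrr nrm0 ltW.
Qed.

End Topology.

(** * Products, adjoints and sums of approximable functions *)

Section ConvApprox.
Context {R : realType} {d : Order.disp_t} {B : cbDistrLatticeType d} {L : choiceType}.
Variable D : gbds B L.
Context {G : groupoid}.
Variable M : model D G.
Local Notation arr := (garrow G).
Local Notation fct := (garrow G -> R[i]).
Local Notation slist := (@slist R _ _ _ D).
Local Notation evl := (@evl R _ _ _ D G M).

Lemma conv_sliceUV (U V : set arr) (f g : fct) a b c : slice M U -> slice M V ->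
  supp f `<=` U -> supp g `<=` V -> U a -> V b -> acomp a b c ->
  convolution f g c = f a * g b.
Proof.
move=> [U1 U2] [V1 V2] fU gV Ua Vb ab.
rewrite (@conv_wide R G f g c [set (a, b)]) ?fsbig_set1//; last by move=> _ ->.
move=> [a' b'] [/= ab' fa' gb']; have [E1 E2] := acomp_srrg M ab.
have [E1' E2'] := acomp_srrg M ab'.
by congr (_, _); [apply: U2|apply: V1]; rewrite // -?E1 -?E2//; [exact: fU|exact: gV].
Qed.

(** On slices the convolution has at most one term f a * g b, so approximation behaves as for
    pointwise products. The hypothesis e <= 1 bounds f' by C + 1. *)
Lemma conv_approx (U V : set arr) (f f' g g' : fct) (C e : R) : slice M U -> slice M V ->
  supp f `<=` U -> supp f' `<=` U -> supp g `<=` V -> supp g' `<=` V -> 0 <= e <= 1 ->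
  (forall z, nrm (f z) <= C) -> (forall z, nrm (g z) <= C) ->
  (forall z, nrm (f z - f' z) <= e) -> (forall z, nrm (g z - g' z) <= e) ->
  forall c, nrm (convolution f g c - convolution f' g' c) <= e * (2 * C + 1).
Proof.
move=> sU sV fU f'U gV g'V /andP[e0 e1] fC gC ff' gg' c.
have [[a [b [Ua Vb ab]]]|h] := pselect (sprod U V c); last first.
  have C0 : 0 <= C := le_trans (nrm_ge0 _) (fC c).
  rewrite !conv_out ?subrr ?nrm0; first by rewrite mulr_ge0//; lra.
    by move=> a b ab /f'U fa /g'V gb; apply: h; exists a, b.
  by move=> a b ab /fU fa /gV gb; apply: h; exists a, b.
rewrite !(conv_sliceUV sU sV _ _ Ua Vb ab)//.
have -> : f a * g b - f' a * g' b = (f a - f' a) * g b + f' a * (g b - g' b) by ring.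
apply: le_trans (nrmD _ _) _; rewrite !nrmMc.
have h1 := ff' a; have h2 := gg' b; have h3 := fC a; have h4 := gC b.
have h5 : nrm (f' a) <= C + 1.
  have := nrm_trans (f a) (f' a) 0; rewrite !subr0 nrm_distrC; lra.
have := nrm_ge0 (f a - f' a); have := nrm_ge0 (g b - g' b).
have := nrm_ge0 (f' a); have := nrm_ge0 (g b); nra.
Qed.

Lemma evl_bounded (l : slist) : exists C : R, forall z, nrm (evl l z) <= C.
Proof.
exists (\sum_(q <- l) nrm q.1) => z; apply: le_trans (nrm_sum _ _) _.
apply: ler_sum => q _; rewrite nrmMc ler_piMr ?nrm_ge0// /ind.
by case: asboolP => _; [rewrite /nrm normr1|rewrite nrm0].
Qed.

Lemma AF_bounded (k : slist) f : AF M k f -> exists C : R, forall z, nrm (f z) <= C.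
Proof.
move=> [_ h]; have [l hl] := h 1 ltr01; have [C hC] := evl_bounded l.
exists (1 + C) => z; have := nrmD (f z - evl l z) (evl l z); rewrite subrK.
have := hl z; have := hC z; lra.
Qed.

Lemma supp_conv (f g : fct) : slice M (supp f) -> slice M (supp g) ->
  supp (convolution f g) = sprod (supp f) (supp g).
Proof.
move=> sf sg; apply/seteqP; split=> c; first exact: conv_supp.
move=> [a [b [fa gb ab]]]; rewrite {1}/supp /= (conv_slice sf sg ab)//.
by apply/eqP; rewrite mulf_neq0//; exact/eqP.
Qed.

Lemma AF_conv k k' f g : slice M (supp (evl k)) -> slice M (supp (evl k')) ->
  AF M k f -> AF M k' g -> AF M (lmul k k') (convolution f g).
Proof.
move=> sk sk' hf hg; split.
  rewrite -evl_mul (supp_conv sk sk') => c /conv_supp[a [b [fa gb ab]]].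
  by exists a, b; split=> //; [exact: hf.1|exact: hg.1].
move=> e e0; have [C hC] := AF_bounded hf; have [C' hC'] := AF_bounded hg.
pose K := `|C| + `|C'|.
have K0 : 0 <= K by rewrite addr_ge0.
have fK z : nrm (f z) <= K.
  apply: le_trans (hC z) _; have := ler_norm C; rewrite /K; have := normr_ge0 C'; lra.
have gK z : nrm (g z) <= K.
  apply: le_trans (hC' z) _; have := ler_norm C'; rewrite /K; have := normr_ge0 C; lra.
pose e' := Num.min 1 (e / (2 * K + 1)).
have q0 : 0 < 2 * K + 1 by lra.
have e'0 : 0 < e' by rewrite lt_min ltr01 divr_gt0.
have e'1 : e' <= 1 by rewrite ge_min lexx.
have e'2 : e' * (2 * K + 1) <= e by rewrite -ler_pdivlMr// ge_min lexx orbT.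
have [l [lk hl]] := AF_slice hf e'0; have [l' [lk' hl']] := AF_slice hg e'0.
exists (lmul l l') => z; rewrite -evl_mul; apply: le_trans e'2.
apply: (conv_approx sk sk' hf.1 lk hg.1 lk') => //.
by rewrite ltW.
Qed.

Lemma supp_adj (k : slist) : supp (evl (ladj k)) = [set z | supp (evl k) (arrow_inv z)].
Proof. by rewrite evl_adj involution_supp. Qed.

Lemma AF_adj (k : slist) (f : fct) : AF M k f -> AF M (ladj k) (involution f).
Proof.
move=> [fk h]; split; first by rewrite supp_adj involution_supp => z /fk.
move=> e e0; have [l hl] := h e e0; exists (ladj l) => z.
by rewrite evl_adj /involution -rmorphB nrmJ.
Qed.

Lemma slice_adj (k : slist) : slice M (supp (evl k)) -> slice M (supp (evl (ladj k))).
Proof. by rewrite evl_adj; exact: slice_involution. Qed.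

Lemma slice_mul (k k' : slist) : slice M (supp (evl k)) -> slice M (supp (evl k')) ->
  slice M (supp (evl (lmul k k'))).
Proof. by move=> sk sk'; rewrite -evl_mul supp_conv//; exact: slice_prod. Qed.

Lemma AF_Cc (k : slist) (f : fct) : slice M (supp (evl k)) -> AF M k f -> Cc f.
Proof. by move=> sk hf; apply: (Cc_intro (AF_contf hf) hf.1 sk). Qed.

Lemma AF_evl (k : slist) : AF M k (evl k).
Proof. by split=> // e e0; exists k => z; rewrite subrr nrm0 ltW. Qed.

Lemma Cc_ind s : Cc (ind (R := R) M s).
Proof.
have E : ind (R := R) M s = evl [:: (1, s)].
  by apply/funext => z; rewrite evl_cons evl_nil addr0 mul1r.
rewrite E; apply: (@AF_Cc [:: (1, s)]); last exact: AF_evl.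
by rewrite -E; exact: slice_ind.
Qed.

Lemma AF_sub (k : slist) (f : fct) (l : slist) : AF M k f -> supp (evl l) `<=` supp (evl k) ->
  AF M k (fun z => f z - evl l z).
Proof.
move=> [fk h] lk; split.
  move=> z nz; have [/fk//|f0] := pselect (supp f z).
  apply: lk => l0; apply: nz; rewrite l0 (supp0 f0); exact: subrr.
move=> e e0; have [l' hl'] := h e e0; exists (l' ++ lscale (-1) l) => z.
rewrite evl_cat evl_scale mulN1r (_ : _ - _ = f z - evl l' z)//.
by rewrite opprD opprK addrACA addNr addr0.
Qed.

Lemma Cc_decomp (f : fct) : Cc f -> exists n (F : 'I_n -> fct) (k : 'I_n -> slist),
  (forall i, slice M (supp (evl (k i))) /\ AF M (k i) (F i)) /\
  f = fun z => \sum_(i < n) F i z.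
Proof.
move=> [n [F [hF Ef]]].
have hk i : exists k : slist, slice M (supp (evl k)) /\ AF M k (F i).
  have [U bU cU] := hF i; have [k kU hk] := Cc_on_AF M bU cU.
  by exists k; split=> //; apply: slice_le kU _; exact: bisection_slice.
have [k hk'] := choice hk.
by exists n, F, k.
Qed.

Lemma conv_suml (I : Type) (r : seq I) (F : I -> fct) (g : fct) :
  (forall i, ffin M (F i)) -> ffin M g ->
  ffin M (fun z => \sum_(i <- r) F i z) /\
  convolution (fun z => \sum_(i <- r) F i z) g =
  fun c => \sum_(i <- r) convolution (F i) g c.
Proof.
move=> hF hg; elim: r => [|i r [IH1 IH2]].
  have -> : (fun z : arr => \sum_(i <- [::]) F i z) = fun _ => 0.
    by apply/funext => z; rewrite big_nil.
  split; last by rewrite conv0l; apply/funext => z; rewrite big_nil.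
  by apply: ffin_slice; split=> a b [].
have -> : (fun z : arr => \sum_(i0 <- i :: r) F i0 z) =
    fun z => F i z + \sum_(i0 <- r) F i0 z.
  by apply/funext => z; rewrite big_cons.
split; first exact: ffinD.
rewrite (convDl (M := M))// IH2; apply/funext => z; by rewrite big_cons.
Qed.

Lemma conv_sumr (I : Type) (r : seq I) (F : I -> fct) (g : fct) :
  (forall i, ffin M (F i)) -> ffin M g ->
  ffin M (fun z => \sum_(i <- r) F i z) /\
  convolution g (fun z => \sum_(i <- r) F i z) =
  fun c => \sum_(i <- r) convolution g (F i) c.
Proof.
move=> hF hg; split; first by have [] := conv_suml r hF hg.
elim: r => [|i r IH].
  have -> : (fun z : arr => \sum_(i <- [::]) F i z) = fun _ => 0.
    by apply/funext => z; rewrite big_nil.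
  by rewrite conv0r; apply/funext => z; rewrite big_nil.
have -> : (fun z : arr => \sum_(i0 <- i :: r) F i0 z) =
    fun z => F i z + \sum_(i0 <- r) F i0 z.
  by apply/funext => z; rewrite big_cons.
rewrite (convDr (M := M))// ?IH; first by apply/funext => z; rewrite big_cons.
by have [] := conv_suml r hF hg.
Qed.

Lemma involution_sum (I : Type) (r : seq I) (F : I -> fct) :
  involution (fun z => \sum_(i <- r) F i z) = fun z => \sum_(i <- r) involution (F i) z.
Proof. by apply/funext => z; rewrite /involution rmorph_sum. Qed.

Section Bound.
Variables (A : cstarAlgType R) (pi : fct -> A).
Hypothesis rpi : Cc_rep pi.

Lemma Cc_rep_on : rep_on (@Cc R G) pi.
Proof. by case: rpi => h1 h2 h3 h4; split. Qed.

(** Nothing topological is assumed about pi. The hypothesis of [circle_bound] holds because h (Re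
    psi), for psi = f^* * f, is continuous and supported in the same compact open slice as psi. *)
Lemma Cc_bound (k : slist) (f : fct) (c : R) : slice M (supp (evl k)) -> AF M k f -> 0 <= c ->
  (forall z, nrm (f z) <= c) -> nrm (pi f) <= c.
Proof.
move=> sk hf c0 fc; have sf := slice_le hf.1 sk.
apply: (circle_bound (M := M) Cc_rep_on) => //.
- exact: AF_Cc hf.
- by apply: AF_Cc (AF_adj hf); exact: slice_adj.
move=> h hc h0.
have hpsi := AF_conv (slice_adj sk) sk (AF_adj hf) hf.
apply: (@Cc_intro _ _ _ _ _ _ M _ (lmul (ladj k) k)); last 1 first.
- by apply: slice_mul => //; exact: slice_adj.
- move=> z e e0; set psi := convolution _ _ in hpsi *.
  have /cvgrPdist_le/(_ _ e0)/nbhs_ballP[r /= r0 hr] := hc (complex.Re (psi z)).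
  apply: filterS (AF_contf hpsi z (_ : 0 < r / 2)) => [w hw|]; last by rewrite divr_gt0.
  rewrite -rmorphB /= nrm_real; apply: hr; rewrite -ball_normE /=.
  apply: le_lt_trans (_ : r / 2 < r); last by lra.
  by apply: le_trans hw; rewrite -raddfB; exact: nrm_ge_Re.
move=> z nz; apply: hpsi.1 => E; apply: nz.
by rewrite E /= h0.
Qed.

End Bound.

End ConvApprox.

(** * The integrated form *)

Section Integrated.
Context {R : realType} {d : Order.disp_t} {B : cbDistrLatticeType d} {L : choiceType}.
Variable D : gbds B L.
Context {A : cstarAlgType R} {p : B -> A} {s : L -> B -> A}.
Hypothesis rep : gbds_rep D p s.
Context {G : groupoid}.
Variable M : model D G.
Local Notation arr := (garrow G).
Local Notation fct := (garrow G -> R[i]).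
Local Notation slist := (@slist R _ _ _ D).
Local Notation evl := (@evl R _ _ _ D G M).
Local Notation Tl := (@Tl R _ _ _ D A p s).

(* [T] is only known to be bounded by the supremum norm on combinations of a
   fixed number of slices, so the approximants are kept below one slice here,
   and are a bounded number of slices in [apr]. *)
Definition apr1 (k : slist) (f : fct) (a : A) := [/\ slice M (supp (evl k)), AF M k f &
  forall e : R, 0 < e -> exists l, [/\ supp (evl l) `<=` supp (evl k),
    forall z, nrm (f z - evl l z) <= e & nrm (a - Tl l) <= e]].

Definition apr (f : fct) (a : A) := exists m : nat, forall e : R, 0 < e ->
  exists ls : seq slist, [/\ (size ls <= m)%N,
    forall l, l \in ls -> slice M (supp (evl l)),
    forall z, nrm (f z - evl (flatten ls) z) <= e & nrm (a - Tl (flatten ls)) <= e].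

(** The difference of two approximants is supported on at most m + n slices, whatever the precision;
    this is why the number of slices is fixed before e. *)
Lemma apr_uniq f a b : apr f a -> apr f b -> a = b.
Proof.
move=> [m hm] [n hn]; apply/eqP; rewrite -subr_eq0; apply/eqP/nrm_small => e e0.
pose c : R := (m + n)%:R; have c0 : 0 <= c by exact: ler0n.
(* The approximants differ by at most 2 e' as functions, hence by 2 e' c under T; two further errors
   e' lead to a and b. *)
pose e' := e / (2 * c + 2).
have e'0 : 0 < e' by rewrite divr_gt0//; lra.
have [ls [szl sl fl al]] := hm e' e'0; have [ls' [szl' sl' fl' bl']] := hn e' e'0.
pose js : seq slist := ls ++ [seq lscale (-1) l | l <- ls'].
have flE (r : seq slist) : flatten [seq lscale (-1) l | l <- r] = lscale (-1) (flatten r).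
  by elim: r => // l r IH /=; rewrite IH /lscale map_cat.
have hjs : nrm (Tl (flatten js)) <= (size js)%:R * (2 * e').
  apply: (Tl_bound_sum rep (M := M)); first by rewrite mulr_ge0// ltW.
    move=> l; rewrite mem_cat => /orP[/sl//|/mapP[l' /sl' h ->]].
    apply: slice_le h => z; rewrite /supp /= evl_scale => h h'; apply: h.
    by rewrite h' mulr0.
  move=> z; rewrite /js flatten_cat flE evl_cat evl_scale mulN1r.
  have := nrm_trans (f z) (evl (flatten ls) z) (evl (flatten ls') z).
  have := fl z; have := fl' z; rewrite [nrm (evl _ _ - f z)]nrm_distrC; lra.
have szj : (size js)%:R <= c :> R by rewrite ler_nat size_cat size_map leq_add.
have hT : nrm (Tl (flatten ls) - Tl (flatten ls')) <= c * (2 * e').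
  rewrite /js flatten_cat flE Tl_cat Tl_scale scaleN1r in hjs.
  by apply: le_trans hjs _; rewrite ler_wpM2r// mulr_ge0// ltW.
have h1 := nrm_trans (Tl (flatten ls)) a b.
have h2 := nrm_trans (Tl (flatten ls')) (Tl (flatten ls)) b.
rewrite [nrm (Tl (flatten ls') - b)]nrm_distrC in h2.
have -> : e = e' * (2 * c + 2) by rewrite /e' mulfVK// gt_eqF//; lra.
lra.
Qed.

Lemma apr1_apr k f a : apr1 k f a -> apr f a.
Proof.
move=> [sk _ h]; exists 1%N => e e0; have [l [lk fl al]] := h e e0.
exists [:: l]; rewrite /= cats0; split=> // l'; rewrite inE => /eqP ->.
exact: slice_le lk sk.
Qed.

Lemma aprD f g a b : apr f a -> apr g b -> apr (fun z => f z + g z) (a + b).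
Proof.
move=> [m hm] [n hn]; exists (m + n)%N => e e0.
have [ls [szl sl fl al]] := hm (e / 2) ltac:(lra).
have [ls' [szl' sl' fl' al']] := hn (e / 2) ltac:(lra).
exists (ls ++ ls'); rewrite flatten_cat size_cat; split; first exact: leq_add.
- by move=> l; rewrite mem_cat => /orP[/sl|/sl'].
- move=> z; rewrite evl_cat opprD addrACA; apply: le_trans (nrmD _ _) _.
  have := fl z; have := fl' z; lra.
- rewrite Tl_cat opprD addrACA; apply: le_trans (nrmD _ _) _; lra.
Qed.

Lemma apr0 : apr (fun _ => 0) 0.
Proof.
exists 0%N => e e0; exists [::]; split=> //= [z|].
  by rewrite evl_nil subrr nrm0 ltW.
by rewrite Tl_nil subrr nrm0 ltW.
Qed.

Lemma apr_sum (I : Type) (r : seq I) (F : I -> fct) (a : I -> A) :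
  (forall i, apr (F i) (a i)) ->
  apr (fun z => \sum_(i <- r) F i z) (\sum_(i <- r) a i).
Proof.
move=> h; elim: r => [|i r IH].
  rewrite big_nil (_ : (fun _ => _) = fun _ => 0); first exact: apr0.
  by apply/funext => z; rewrite big_nil.
rewrite big_cons (_ : (fun _ => _) = fun z => F i z + \sum_(i <- r) F i z).
  exact: aprD.
by apply/funext => z; rewrite big_cons.
Qed.

Lemma aprZ (k : R[i]) f a : apr f a -> apr (fun z => k * f z) (k *: a).
Proof.
move=> [m hm]; exists m => e e0; have k0 := nrm_ge0 k.
have [|ls [szl sl fl al]] := hm (e / (nrm k + 1)); first by rewrite divr_gt0//; lra.
exists [seq lscale k l | l <- ls].
have flE : flatten [seq lscale k l | l <- ls] = lscale k (flatten ls).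
  by elim: (ls) => // l r IH /=; rewrite IH /lscale map_cat.
have ek : nrm k * (e / (nrm k + 1)) <= e.
  rewrite mulrA ler_pdivrMr; [nra|lra].
rewrite size_map flE; split=> //.
- move=> _ /mapP[l /sl h ->]; apply: slice_le h => z; rewrite /supp /= evl_scale.
  by move=> h h'; apply: h; rewrite h' mulr0.
- move=> z; rewrite evl_scale -mulrBr nrmMc; apply: le_trans ek.
  by rewrite ler_wpM2l.
- rewrite Tl_scale -scalerBr nrmZ; apply: le_trans ek; by rewrite ler_wpM2l.
Qed.

Lemma apr1_adj k f a : apr1 k f a -> apr1 (ladj k) (involution f) (cadj a).
Proof.
move=> [sk hf h]; split; [exact: slice_adj|exact: AF_adj|].
move=> e e0; have [l [lk fl al]] := h e e0; exists (ladj l); split.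
- by rewrite !supp_adj => z; exact: lk.
- by move=> z; rewrite evl_adj /involution -rmorphB nrmJ.
- by rewrite Tl_adj -cadjB nrm_adj.
Qed.

Lemma apr1_conv k k' f g a b : apr1 k f a -> apr1 k' g b ->
  apr1 (lmul k k') (convolution f g) (cmul a b).
Proof.
move=> [sk hf hfa] [sk' hg hgb]; split; [exact: slice_mul|exact: AF_conv|].
move=> e e0; have [C hC] := AF_bounded hf; have [C' hC'] := AF_bounded hg.
pose K := `|C| + `|C'| + nrm a + nrm b.
have nC := normr_ge0 C; have nC' := normr_ge0 C'; have na := nrm_ge0 a; have nb := nrm_ge0 b.
have K0 : 0 <= K by rewrite !addr_ge0.
have fK z : nrm (f z) <= K.
  by apply: le_trans (hC z) _; have := ler_norm C; rewrite /K; lra.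
have gK z : nrm (g z) <= K.
  by apply: le_trans (hC' z) _; have := ler_norm C'; rewrite /K; lra.
pose e' := Num.min 1 (e / (2 * K + 1)).
have q0 : 0 < 2 * K + 1 by lra.
have e'0 : 0 < e' by rewrite lt_min ltr01 divr_gt0.
have e'1 : e' <= 1 by rewrite ge_min lexx.
have e'2 : e' * (2 * K + 1) <= e by rewrite -ler_pdivlMr// ge_min lexx orbT.
have [l [lk fl al]] := hfa e' e'0; have [l' [lk' gl' bl']] := hgb e' e'0.
exists (lmul l l'); split.
- have sl := slice_le lk sk; have sl' := slice_le lk' sk'.
  rewrite -!evl_mul !(@supp_conv _ _ _ _ _ _ M)// => c [x [y [lx ly xy]]].
  by exists x, y; split=> //; [exact: lk|exact: lk'].
- move=> z; rewrite -evl_mul; apply: le_trans e'2.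
  apply: (conv_approx sk sk' hf.1 lk hg.1 lk') => //.
  by rewrite ltW.
- rewrite (Tl_mul rep); apply: le_trans e'2.
  have -> : cmul a b - cmul (Tl l) (Tl l') = cmul (a - Tl l) b + cmul (Tl l) (b - Tl l').
    by rewrite cmulBl cmulBr addrA subrK.
  apply: le_trans (nrmD _ _) _.
  have h1 := nrmM (a - Tl l) b; have h2 := nrmM (Tl l) (b - Tl l').
  have h3 : nrm (Tl l) <= K + 1.
    have := nrm_trans a (Tl l) 0; rewrite !subr0 nrm_distrC /K; lra.
  have h4 : nrm b <= K by rewrite /K; lra.
  have := nrm_ge0 (a - Tl l); have := nrm_ge0 (b - Tl l'); have := nrm_ge0 (Tl l).
  move: (nrm (a - Tl l)) (nrm (b - Tl l')) (nrm (Tl l)) al bl' h1 h2 h3 h4.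
  move: (nrm (cmul _ _)) (nrm (cmul _ _)) (nrm b) nb => ? ? ? ? ? ? ? ? ? ? ? ? ? ? ? ?.
  nra.
Qed.

(** Approximants chosen inside the slice of k have differences supported in one slice, so [Tl_bound]
    makes their images a Cauchy sequence. *)
Lemma AF_apr1 k f : slice M (supp (evl k)) -> AF M k f -> exists a, apr1 k f a.
Proof.
move=> sk hf.
have hl (n : nat) : exists l : slist, supp (evl l) `<=` supp (evl k) /\
    forall z, nrm (f z - evl l z) <= n.+1%:R^-1.
  by apply: AF_slice => //; rewrite invr_gt0.
have [l hl'] := choice hl.
have dl (m n : nat) : nrm (Tl (l m) - Tl (l n)) <= m.+1%:R^-1 + n.+1%:R^-1.
  have [lm fm] := hl' m; have [ln fn] := hl' n.
  rewrite -scaleN1r -Tl_scale -Tl_cat; apply: (Tl_bound rep (M := M)).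
  - apply: slice_le sk => z; rewrite /supp /= evl_cat evl_scale mulN1r => h.
    have [/lm//|h1] := pselect (supp (evl (l m)) z).
    by apply: ln => h2; apply: h; rewrite h2 (supp0 h1) subrr.
  - by rewrite addr_ge0// invr_ge0.
  - move=> z; rewrite evl_cat evl_scale mulN1r; apply: le_trans (nrm_trans (f z) _ _) _.
    by apply: lerD => //; rewrite nrm_distrC.
have [|a ha] := @cauchy_nrm R A (fun n => Tl (l n)).
  move=> e e0; have [N hN] := @invn_lt R (e / 2) ltac:(lra).
  exists N => m n Nm Nn; apply: le_trans (dl _ _) _.
  have := @le_invn R _ _ Nm; have := @le_invn R _ _ Nn.
  by move: (m.+1%:R^-1) (n.+1%:R^-1) (N.+1%:R^-1) hN => x1 x2 x3; lra.
exists a; split=> // e e0; have [N hN] := ha e e0.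
have [N' hN'] := invn_lt e0.
exists (l (maxn N N')); have [h1 h2] := hl' (maxn N N'); split=> //.
  move=> z; apply: le_trans (h2 z) _; apply: le_trans (ltW hN').
  exact: le_invn (leq_maxr _ _).
exact: hN (leq_maxl _ _).
Qed.

Definition integ (f : fct) : A :=
  if pselect (exists a, apr f a) is left h then sval (cid h) else 0.

Lemma integE f a : apr f a -> integ f = a.
Proof.
move=> fa; rewrite /integ; case: pselect => [h|]; last by case; exists a.
by case: cid => b /= fb; exact: apr_uniq fb fa.
Qed.

Lemma Cc_apr f : Cc f -> exists n (F : 'I_n -> fct) (k : 'I_n -> slist) (a : 'I_n -> A),
  (forall i, apr1 (k i) (F i) (a i)) /\ f = fun z => \sum_(i < n) F i z.
Proof.
move=> /(Cc_decomp M)[n [F [k [hF Ef]]]].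
have h i : exists a, apr1 (k i) (F i) a by have [] := hF i; exact: AF_apr1.
by have [a ha] := choice h; exists n, F, k, a.
Qed.

Lemma Cc_apr1 f : Cc f -> apr f (integ f).
Proof.
move=> /Cc_apr[n [F [k [a [ha ->]]]]].
have h : apr (fun z => \sum_(i < n) F i z) (\sum_(i < n) a i).
  by apply: apr_sum => i; exact: apr1_apr (ha i).
by rewrite (integE h).
Qed.

Lemma integ_rep : Cc_rep integ.
Proof.
split=> [f g cf cg|k f cf|f g cf cg|f cf].
- by apply: integE; apply: aprD; exact: Cc_apr1.
- by apply: integE; apply: aprZ; exact: Cc_apr1.
- have [n [F [k [a [ha Ef]]]]] := Cc_apr cf; have [m [H [k' [b [hb Eg]]]]] := Cc_apr cg.
  have sF i : ffin M (F i).
    by have [sk [fk _] _] := ha i; apply: ffin_slice; exact: slice_le fk sk.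
  have sH i : ffin M (H i).
    by have [sk [fk _] _] := hb i; apply: ffin_slice; exact: slice_le fk sk.
  have -> : integ f = \sum_(i < n) a i.
    by apply: integE; rewrite Ef; apply: apr_sum => i; exact: apr1_apr (ha i).
  have -> : integ g = \sum_(i < m) b i.
    by apply: integE; rewrite Eg; apply: apr_sum => i; exact: apr1_apr (hb i).
  apply: integE; rewrite Ef Eg.
  (* Only the finiteness component is wanted; the empty combination is a dummy second factor. *)
  have [fH _] := conv_suml (index_enum 'I_m) sH (ffin_evl M ([::] : slist)).
  have [_ ->] := conv_suml (index_enum 'I_n) sF fH.
  have -> : (fun c => \sum_(i < n) convolution (F i) (fun z => \sum_(j < m) H j z) c) =
      fun c => \sum_(i < n) \sum_(j < m) convolution (F i) (H j) c.
    apply/funext => c; apply: eq_bigr => i _.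
    by have [_ ->] := conv_sumr (index_enum 'I_m) sH (sF i).
  rewrite cmul_suml; apply: apr_sum => i; rewrite cmul_sumr; apply: apr_sum => j.
  exact: apr1_apr (apr1_conv (ha i) (hb j)).
- have [n [F [k [a [ha Ef]]]]] := Cc_apr cf.
  have -> : integ f = \sum_(i < n) a i.
    by apply: integE; rewrite Ef; apply: apr_sum => i; exact: apr1_apr (ha i).
  apply: integE; rewrite Ef involution_sum cadj_sum; apply: apr_sum => i.
  exact: apr1_apr (apr1_adj (ha i)).
Qed.

End Integrated.

(** * Sums in C_c(G) *)

Section CcSum.
Context {R : realType} {G : groupoid}.
Local Notation fct := (garrow G -> R[i]).

Lemma CcD (f g : fct) : Cc f -> Cc g -> Cc (fun z => f z + g z).
Proof.
move=> [n [u [hu Eu]]] [m [v [hv Ev]]]; exists (n + m)%N,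
  (fun i : 'I_(n + m) => match fintype.split i with inl j => u j | inr j => v j end); split.
  by move=> i; case: fintype.split => j; [exact: hu|exact: hv].
apply/funext => z; rewrite Eu Ev big_split_ord /=; congr (_ + _); apply: eq_bigr => i _.
  by rewrite (unsplitK (inl i)).
by rewrite (unsplitK (inr i)).
Qed.

Lemma Cc_sum (I : Type) (r : seq I) (F : I -> fct) : (forall i, Cc (F i)) ->
  Cc (fun z => \sum_(i <- r) F i z).
Proof.
move=> hF; elim: r => [|i r IH].
  exists 0%N, (fun _ _ => 0); split; first by case.
  by apply/funext => z; rewrite big_ord0 big_nil.
rewrite (_ : (fun _ => _) = fun z => F i z + \sum_(i <- r) F i z); first exact: CcD.
by apply/funext => z; rewrite big_cons.
Qed.

End CcSum.

(** * Representations of the convolution algebra *)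

Section FromGroupoid.
Context {R : realType} {d : Order.disp_t} {B : cbDistrLatticeType d} {L : choiceType}.
Variable D : gbds B L.
Context {G : groupoid}.
Variable M : model D G.
Context {A : cstarAlgType R}.
Variable pi : (garrow G -> R[i]) -> A.
Hypothesis rpi : Cc_rep pi.
Local Notation arr := (garrow G).
Local Notation fct := (garrow G -> R[i]).
Local Notation slist := (@slist R _ _ _ D).
Local Notation sgp := (sgp D).
Local Notation meet := Order.meet.
Local Notation bot := (\bot%O : B).
Local Notation evl := (@evl R _ _ _ D G M).
Local Notation "x ** y" := (cmul x y) (at level 40, left associativity).

Definition piS (t : sgp) : A := pi (ind M t).

Lemma piM t u : piS (sm t u) = piS t ** piS u.
Proof. by rewrite /piS -conv_ind (Cc_repM rpi)//; exact: Cc_ind. Qed.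

Lemma piV t : piS (sj t) = cadj (piS t).
Proof. by rewrite /piS -involution_ind (Cc_repV rpi)//; exact: Cc_ind. Qed.

Lemma pi0 : pi (fun _ => 0) = 0.
Proof.
have -> : (fun _ : arr => 0 : R[i]) = fun z => 0 * ind M (s0 D) z.
  by apply/funext => z; rewrite mul0r.
by rewrite (Cc_repZ rpi) ?scale0r//; exact: Cc_ind.
Qed.

Lemma piS0 : piS (s0 D) = 0.
Proof. by rewrite /piS -pi0; congr pi; apply/funext => z; exact: ind_s0. Qed.

(** An empty X is allowed and gives the zero of S, so the generators and their relations need no
    separate case. *)
Definition selt a X b (ha : idealw D a X) (hb : idealw D b X) : sgp :=
  exist _ (mk_triple a X b) (S_mk ha hb).

Lemma idealw1 a X : ideal D a X -> idealw D [:: a] X.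
Proof. by exists X => //=. Qed.

Definition qproj X : A := piS (@selt [::] X [::] I I).

Definition qiso a X : A :=
  if pselect (ideal D a X) is left h then piS (@selt [:: a] X [::] (idealw1 h) I) else 0.

Lemma qisoE a X (h : ideal D a X) : qiso a X = piS (@selt [:: a] X [::] (idealw1 h) I).
Proof.
rewrite /qiso; case: pselect => // h'; congr piS; exact: sgp_inj.
Qed.

Lemma smul_mk a X b Y c : smul D (mk_triple a X b) (mk_triple b Y c) =
  mk_triple a (meet X Y) c.
Proof.
rewrite {1}/mk_triple; case: eqP => [->|X0]; first by rewrite meet0x mk_triple0.
rewrite {1}/mk_triple; case: eqP => [->|Y0]; first by rewrite smulx0 meetx0 mk_triple0.
exact: smul_diag.
Qed.

Lemma smul_mkl a X b m Y c : smul D (mk_triple a X b) (mk_triple (b ++ m) Y c) =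
  mk_triple (a ++ m) (meet (actw D m X) Y) c.
Proof.
rewrite {1}/mk_triple; case: eqP => [->|X0].
  by rewrite actw_bot meet0x mk_triple0.
rewrite {1}/mk_triple; case: eqP => [->|Y0]; first by rewrite smulx0 meetx0 mk_triple0.
exact: smul_l.
Qed.

Lemma smul_mkr a X b m Y c : smul D (mk_triple a X (b ++ m)) (mk_triple b Y c) =
  mk_triple a (meet X (actw D m Y)) (c ++ m).
Proof.
rewrite {1}/mk_triple; case: eqP => [->|X0]; first by rewrite meet0x mk_triple0.
rewrite {1}/mk_triple; case: eqP => [->|Y0].
  by rewrite smulx0 actw_bot meetx0 mk_triple0.
exact: smul_r.
Qed.

Lemma idem_p X : idem (@selt [::] X [::] I I).
Proof. by apply: E_mk. Qed.

Lemma mem_Th e z : idem e -> Th M e z -> pmem (sr M z) e.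
Proof. by move=> ie /Th_sr[+ _]; rewrite dom_idem. Qed.

Lemma Th_unit e z : idem e -> isunit M z -> pmem (sr M z) e -> Th M e z.
Proof.
move=> ie [f jf fz] ze; apply/(Th_sd e fz).
have xf := mem_Th jf fz.
apply: (mem_sd (e := sm e f)); first by rewrite dom_idem.
  by apply/memM.
by rewrite smA idemxx// (idemC ie jf) smA idemxx.
Qed.

Lemma Th_idemE e z : idem e -> isunit M z -> Th M e z <-> pmem (sr M z) e.
Proof. by move=> ie uz; split; [exact: mem_Th|exact: Th_unit]. Qed.

Lemma ind_nunit e z : idem e -> ~ isunit M z -> ind (R := R) M e z = 0.
Proof. by move=> ie nz; apply: ind0 => ez; apply: nz; exists e. Qed.

Lemma pe_le X Y : (X <= Y)%O ->
  sm (@selt [::] X [::] I I) (@selt [::] Y [::] I I) = @selt [::] X [::] I I.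
Proof. by move=> XY; apply: sgp_inj; rewrite [LHS]smul_mk (meet_l XY). Qed.

Lemma finite_Delta X : regular D X -> finite_set (Delta D X).
Proof.
have [->|/eqP X0] := eqVneq X bot; last by move=> rX; have [] := rX X X0 (lexx _).
by rewrite (_ : Delta D bot = set0)// -subset0 => a; rewrite /Delta/= act_bot.
Qed.

Lemma iact a X : ideal D a (act D a X). Proof. exact: ideal_act (lexx _). Qed.

Definition ae a X : sgp := @selt [:: a] (act D a X) [:: a] (idealw1 (iact a X)) (idealw1 (iact a X)).

Lemma idem_ae a X : idem (ae a X). Proof. by apply: E_mk; exact: idealw1 (iact a X). Qed.

Lemma ae_le a X : sm (ae a X) (@selt [::] X [::] I I) = ae a X.
Proof.
apply: sgp_inj; rewrite [LHS](@smul_mkr [:: a] (act D a X) [::] [:: a] X [::]).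
by rewrite [actw _ _ _]/= meetxx.
Qed.

Lemma prefix1 (a b : L) : a <> b -> ~~ prefix [:: a] [:: b].
Proof. by move=> ab; rewrite prefix_cons; apply/negP => /andP[/eqP]. Qed.

Lemma ae_disj a b X x : pmem x (ae a X) -> pmem x (ae b X) -> a = b.
Proof.
move=> xa xb; apply: contrapT => ab.
have := (memM x (idem_ae a X) (idem_ae b X)).2 (conj xa xb).
rewrite (_ : sm _ _ = s0 D); first exact: mem0.
apply: sgp_inj; rewrite -[LHS]/(smul D (mk_triple [:: a] (act D a X) [:: a])
  (mk_triple [:: b] (act D b X) [:: b])).
rewrite /mk_triple; case: eqP => // _; case: eqP => // _.
by rewrite smul_inc//; apply: prefix1 => // /esym.
Qed.

(* Tightness: a regular X is covered by the (a, act a X, a), a in Delta X. *)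
Lemma regular_cover X x : regular D X -> pmem x (@selt [::] X [::] I I) ->
  exists2 a, Delta D X a & pmem x (ae a X).
Proof.
move=> rX xX; have fX := finite_Delta rX.
pose F := [seq ae a X | a <- finmap.enum_fset (fset_set (Delta D X))].
have [||_ /mapP[a aX ->] xa] := @mem_covers _ _ _ D x _ F xX.
- by move=> _ /mapP[a _ ->]; exact: idem_ae.
- move=> f jf f0 fX'.
  have inF a : act D a X <> bot -> ae a X \in F.
    by move=> aX; apply: map_f; rewrite in_fset_set//; exact/mem_set.
  move: f0 (congr1 sval fX'); case Ef : (sval f) => [[[w C] w']|] f0; last first.
    by case: f0; apply: sgp_inj; rewrite Ef.
  have [ww' C0 iC] : E_set D (Some (w, C, w')) by rewrite -Ef.
  subst w'; rewrite -[sval (sm _ _)]/(smul D (sval f) (mk_triple [::] X [::])) Ef.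
  rewrite -(mk_tripleE w w C0) (smul_mkr w C [::] w X [::]) => EC.
  have CX : meet C (actw D w X) = C.
    move: EC; rewrite (mk_tripleE w w C0) /mk_triple; case: eqP => // _ [] //.
  (* For f at the empty word, regularity of X provides a letter a that does not annihilate C;
     otherwise the first letter of the word of f serves. *)
  case: w CX Ef iC {EC} => [|a w] CX Ef iC.
    have CX' : (C <= X)%O by rewrite leEmeet CX.
    have [_ [a aC]] := rX C C0 CX'.
    have aX : act D a X <> bot.
      move=> E; apply: aC; apply/eqP; rewrite -lex0 -E.
      exact: (actw_le D [:: a] CX').
    exists (ae a X); first exact: inF.
    move=> /(congr1 sval); rewrite -[sval (sm _ _)]/(smul D (sval f) (mk_triple [:: a] (act D a X) [:: a])).
    rewrite Ef -(mk_tripleE [::] [::] C0) (smul_mkl [::] C [::] [:: a]) /=.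
    by rewrite -act_meet meet_l// mk_tripleE.
  have aX : act D a X <> bot.
    by move=> E; apply: C0; rewrite -CX /= E -/(actw D w bot) actw_bot meetx0.
  exists (ae a X); first exact: inF.
  move=> /(congr1 sval); rewrite -[sval (sm _ _)]/(smul D (sval f) (mk_triple [:: a] (act D a X) [:: a])).
  rewrite Ef -(mk_tripleE (a :: w) (a :: w) C0) (smul_mkr (a :: w) C [:: a] w) /=.
  by rewrite -[actw _ _ _]/(actw D (a :: w) X) CX mk_tripleE.
exists a => //; move: aX; rewrite in_fset_set// => /set_mem.
by [].
Qed.

Lemma pi_sum (I : Type) (r : seq I) (F : I -> fct) : (forall i, Cc (F i)) ->
  pi (fun z => \sum_(i <- r) F i z) = \sum_(i <- r) pi (F i).
Proof.
move=> hF; elim: r => [|i r IH].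
  rewrite big_nil (_ : (fun _ => _) = fun _ => 0); first exact: pi0.
  by apply/funext => z; rewrite big_nil.
rewrite big_cons (_ : (fun _ => _) = fun z => F i z + \sum_(i <- r) F i z).
  by rewrite (Cc_repD rpi) ?IH//; exact: Cc_sum.
by apply/funext => z; rewrite big_cons.
Qed.

Lemma CcZ (k : R[i]) t : Cc (fun z => k * ind M t z).
Proof.
have -> : (fun z => k * ind M t z) = evl [:: (k, t)].
  by apply/funext => z; rewrite evl_cons evl_nil addr0.
apply: (@AF_Cc _ _ _ _ _ _ M [:: (k, t)]); last exact: AF_evl.
apply: slice_le (slice_Th M t) => z; rewrite /supp /= evl_cons evl_nil addr0 => h.
by apply: contrapT => nz; apply: h; rewrite (ind0 nz) mulr0.
Qed.

Lemma pi_evl (l : slist) : pi (evl l) = \sum_(q <- l) q.1 *: piS q.2.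
Proof.
rewrite /evl (@pi_sum _ l (fun q z => q.1 * ind M q.2 z)) => [|q]; last exact: CcZ.
by apply: eq_bigr => q _; rewrite (Cc_repZ rpi)//; exact: Cc_ind.
Qed.

Lemma actw_join w X Y :
  actw D w (Order.join X Y) = Order.join (actw D w X) (actw D w Y).
Proof. by elim: w X Y => //= a w IH X Y; rewrite act_join IH. Qed.

(** The multiplicative relations are identities in S. The additive ones are identities between
    indicators on the units, and these hold because the points are tight. *)
Lemma groupoid_gbds_rep : gbds_rep D qproj qiso.
Proof.
split=> [X|a X iX||X Y|X Y|X a Y iY|a a' Y Y' iY iY'|X rX].
- split; first by rewrite /qproj -piV idemV//; exact: idem_p.
  by rewrite /qproj -piM idemxx//; exact: idem_p.
- by rewrite /is_partial_isometry (qisoE iX) -piV -!piM smVK.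
- by rewrite /qproj -piS0; congr piS; apply: sgp_inj => /=; exact: mk_triple0.
- by rewrite /qproj -piM; congr piS; apply: sgp_inj; rewrite [RHS]smul_mk.
- have iX := idem_p X; have iY := idem_p Y; have iU := idem_p (Order.join X Y).
  have iM := idem_p (meet X Y).
  have key z : ind M (@selt [::] (Order.join X Y) [::] I I) z =
    \sum_(q <- [:: (1, @selt [::] X [::] I I); (1, @selt [::] Y [::] I I);
       (-1, @selt [::] (meet X Y) [::] I I)]) q.1 * ind (R := R) M q.2 z.
    rewrite !big_cons big_nil /= addr0 !mul1r mulN1r.
    have [uz|nz] := pselect (isunit M z); last first.
      by rewrite !ind_nunit// subr0 addr0.
    have EM : pmem (sr M z) (@selt [::] (meet X Y) [::] I I) <->
        pmem (sr M z) (@selt [::] X [::] I I) /\ pmem (sr M z) (@selt [::] Y [::] I I).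
      rewrite -memM// (_ : sm _ _ = @selt [::] (meet X Y) [::] I I)//.
      by apply: sgp_inj; rewrite [LHS]smul_mk.
    (* The idempotents of X and Y cover that of their join, so a tight filter containing the join
       contains X or Y. *)
    have EU : pmem (sr M z) (@selt [::] (Order.join X Y) [::] I I) <->
        pmem (sr M z) (@selt [::] X [::] I I) \/ pmem (sr M z) (@selt [::] Y [::] I I).
      split=> [zU|[zX|zY]]; last 2 first.
      - by apply: mem_up zX _ => //; exact: pe_le (leUl _ _).
      - by apply: mem_up zY _ => //; exact: pe_le (leUr _ _).
      have [|f f0 ff fU|f] := @mem_covers _ _ _ D (sr M z) _
          [:: @selt [::] X [::] I I; @selt [::] Y [::] I I] zU.
      + by move=> f; rewrite !inE => /orP[]/eqP ->.
      + apply: contrapT => h; apply: ff.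
        have f1 W : @selt [::] W [::] I I \in [:: @selt [::] X [::] I I; @selt [::] Y [::] I I] ->
            sm f (@selt [::] W [::] I I) = s0 D.
          by move=> WF; apply: contrapT => h'; apply: h; exists (@selt [::] W [::] I I).
        have fX := f1 X (mem_head _ _).
        have fY := f1 Y ltac:(by rewrite !inE eqxx orbT).
        move: (congr1 sval fX) (congr1 sval fY) (congr1 sval fU).
        rewrite -[sval (sm f (@selt [::] X [::] I I))]/(smul D (sval f) (mk_triple [::] X [::])).
        rewrite -[sval (sm f (@selt [::] Y [::] I I))]/(smul D (sval f) (mk_triple [::] Y [::])).
        rewrite -[sval (sm f (@selt [::] (Order.join X Y) [::] I I))]/(smul D (sval f) (mk_triple [::] (Order.join X Y) [::])).
        case Ef : (sval f) => [[[w C] w']|]; last by move=> _ _ _; apply: sgp_inj; rewrite Ef.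
        have [ww' C0 iC] : E_set D (Some (w, C, w')) by rewrite -Ef.
        subst w'; rewrite -(mk_tripleE w w C0) !(smul_mkr w C [::] w _ [::]).
        rewrite /mk_triple; case: eqP => // hX _; case: eqP => // hY _.
        have aU : actw D w (Order.join X Y) = Order.join (actw D w X) (actw D w Y).
          exact: actw_join.
        by rewrite aU meetUr hX hY joinxx eqxx; case: eqP.
      + by rewrite !inE => /orP[]/eqP -> h; [left|right].
    rewrite /ind.
    have hX := Th_idemE iX uz; have hY := Th_idemE iY uz.
    have hU := Th_idemE iU uz; have hM := Th_idemE iM uz.
    rewrite (asbool_equiv_eq hX) (asbool_equiv_eq hY) (asbool_equiv_eq hU) (asbool_equiv_eq hM).
    rewrite (asbool_equiv_eq EM) (asbool_equiv_eq EU) asbool_and asbool_or.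
    by case: asboolP => _; case: asboolP => _ /=; ring.
  rewrite {1}/qproj /piS (funext key : ind M _ = evl _).
  rewrite pi_evl !big_cons big_nil /= addr0 !scale1r scaleN1r addrA.
  by rewrite /qproj.
- rewrite (qisoE iY) /qproj -!piM; congr piS; apply: sgp_inj.
  rewrite [LHS](smul_mkl [::] X [::] [:: a]) [RHS](smul_mk [:: a] Y [::]).
  by rewrite meetC.
- rewrite (qisoE iY) (qisoE iY') -piV -piM.
  case: eqP => [aa'|aa'].
    subst a'; rewrite /qproj; congr piS; apply: sgp_inj.
    rewrite -[LHS]/(smul D (sadj (mk_triple [:: a] Y [::])) (mk_triple [:: a] Y' [::])).
    by rewrite sadj_mk smul_mk.
  rewrite -piS0; congr piS; apply: sgp_inj.
  rewrite -[LHS]/(smul D (sadj (mk_triple [:: a] Y [::])) (mk_triple [:: a'] Y' [::])).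
  rewrite sadj_mk /mk_triple; case: eqP => // _; case: eqP => [_|_]; first by rewrite smulx0.
  by rewrite smul_inc//; apply: prefix1 => // /esym.
- have fX := finite_Delta rX; rewrite (fsbig_finite _ _ fX).
  (* Relation (iv) as an identity of indicators: by [regular_cover] a point of X lies in some
     [ae a X], and by [ae_disj] in only one. *)
  have key z : ind M (@selt [::] X [::] I I) z =
    \sum_(q <- [seq (1, ae a X) | a <- finmap.enum_fset (fset_set (Delta D X))])
        q.1 * ind (R := R) M q.2 z.
    rewrite big_map.
    have [uz|nz] := pselect (isunit M z); last first.
      rewrite ind_nunit//; last exact: idem_p.
      by rewrite big1// => a _; rewrite ind_nunit ?mulr0//; exact: idem_ae.
    have hX := Th_idemE (idem_p X) uz.
    have [zX|zX] := pselect (Th M (@selt [::] X [::] I I) z); last first.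
      rewrite ind0// big1// => a _; rewrite ind0 ?mulr0// => za; apply: zX; apply/hX.
      by apply: mem_up (mem_Th (idem_ae a X) za) (ae_le a X); exact: idem_p.
    have [a aX za] := regular_cover rX (hX.1 zX).
    rewrite ind1// (big_rem a) /=; last by rewrite in_fset_set//; exact/mem_set.
    rewrite ind1 ?mulr1; last exact/(Th_idemE (idem_ae a X) uz).
    rewrite big1_seq ?addr0// => b /andP[_]; rewrite rem_filter; last exact: finmap.fset_uniq.
    rewrite mem_filter => /andP[ba _]; rewrite mul1r ind0// => zb.
    move/eqP: ba; apply; apply: ae_disj za; exact: mem_Th (idem_ae b X) zb.
  rewrite {1}/qproj /piS (funext key : ind M _ = evl _).
  rewrite pi_evl big_map; apply: eq_bigr => a _.
  rewrite scale1r (qisoE (iact a X)) -piV -piM; congr piS; apply: sgp_inj.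
  rewrite -[RHS]/(smul D (mk_triple [:: a] (act D a X) [::]) (sadj (mk_triple [:: a] (act D a X) [::]))).
  by rewrite sadj_mk smul_mk meetxx.
Qed.

Lemma gW_piS w X (h : idealw D w (actw D w X)) :
  @gW _ _ _ _ D A qproj qiso w X = piS (@selt w (actw D w X) [::] h I).
Proof.
elim: w X h => [|a w IH] X h; first by congr piS; exact: sgp_inj.
have h' : idealw D w (actw D w (act D a X)) by exact: (@idealw_suffix _ _ _ D [:: a]).
rewrite [LHS]/= (IH _ h') (qisoE (iact a X)) -piM; congr piS; apply: sgp_inj.
rewrite [LHS](smul_mkl [:: a] (act D a X) [::] w) /=.
by rewrite -/(actw D w _) meetxx.
Qed.

Lemma sW_piS w X (h : idealw D w X) : @sW _ _ _ _ D A qproj qiso w X = piS (@selt w X [::] h I).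
Proof.
case: w h => [|a w] h; first by congr piS; exact: sgp_inj.
have [Y iY XY] := h.
rewrite (sW_cons groupoid_gbds_rep iY XY) (qisoE iY).
have h' : idealw D w (actw D w Y).
  by have := @idealw_act _ _ _ D [:: a] w Y (idealw1 iY); exact: (@idealw_suffix _ _ _ D [:: a]).
rewrite (gW_piS h') /qproj -!piM; congr piS; apply: sgp_inj.
rewrite -[LHS]/(smul D (smul D (mk_triple [:: a] Y [::]) (mk_triple w (actw D w Y) [::])) (mk_triple [::] X [::])).
rewrite (smul_mkl [:: a] Y [::] w) meetxx smul_mk meetC.
by rewrite (meet_l XY).
Qed.

Lemma Trep_piS t : Trep (p := qproj) (s := qiso) t = piS t.
Proof.
rewrite /Trep; case Et : (sval t) => [[[a X] b]|] /=; last first.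
  by rewrite -piS0; congr piS; apply: sgp_inj; rewrite Et.
have [X0 ia ib] : S_set D (Some (a, X, b)) by rewrite -Et; exact: (svalP t).
rewrite (sW_piS ia) (sW_piS ib) -piV -piM; congr piS; apply: sgp_inj.
rewrite -[LHS]/(smul D (mk_triple a X [::]) (sadj (mk_triple b X [::]))).
by rewrite sadj_mk smul_mk meetxx Et mk_tripleE.
Qed.

End FromGroupoid.

(** * Comparison of the universal C*-algebras *)

Section ModelCStar.
Context {R : realType} {d : Order.disp_t} {B : cbDistrLatticeType d} {L : choiceType}.
Variable D : gbds B L.

Lemma hom_Trep (A A' : cstarAlgType R) (p : B -> A) (s : L -> B -> A)
    (q : B -> A') (t : L -> B -> A') (h : A -> A') :
  gbds_rep D p s -> gbds_rep D q t -> is_star_hom h ->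
  (forall X, h (p X) = q X) -> (forall a X, ideal D a X -> h (s a X) = t a X) ->
  forall u : sgp D, h (Trep (p := p) (s := s) u) = Trep (p := q) (s := t) u.
Proof.
move=> rep rep' hh hp hs.
have hg w X : h (@gW _ _ _ _ D A p s w X) = @gW _ _ _ _ D A' q t w X.
  elim: w X => [|a w IH] X /=; first exact: hp.
  by rewrite (star_homM hh) IH hs//; exact: ideal_act (lexx _).
have hW w X : idealw D w X -> h (@sW _ _ _ _ D A p s w X) = @sW _ _ _ _ D A' q t w X.
  case: w => [_|a w [Y iY XY]]; first exact: hp.
  by rewrite (sW_cons rep iY XY) (sW_cons rep' iY XY) !(star_homM hh) hs// hp hg.
move=> u; rewrite /Trep; move: (svalP u); case: (sval u) => [[[a X] b]|] /=; last first.
  by move=> _; exact: star_hom0.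
by move=> [_ ia ib]; rewrite (star_homM hh) (star_homV hh) !hW.
Qed.

Context {G : groupoid}.
Variable M : model D G.
Local Notation fct := (garrow G -> R[i]).
Local Notation slist := (@slist R _ _ _ D).
Local Notation evl := (@evl R _ _ _ D G M).

(** The two sides agree on simple functions by [Trep_piS]. On one slice a simple function can
    approximate f and the integrated form simultaneously; [Cc_bound] controls the left side and
    contractivity of h the right one. *)
Lemma gbds_integ_factor (A : cstarAlgType R) (p : B -> A) (s : L -> B -> A)
    (A' : cstarAlgType R) (pi : fct -> A') (h : A -> A') :
  gbds_rep D p s -> Cc_rep pi -> is_star_hom h ->
  (forall X, h (p X) = qproj M pi X) ->
  (forall a X, ideal D a X -> h (s a X) = qiso M pi a X) ->
  forall f, Cc f -> pi f = h (integ (p := p) (s := s) M f).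
Proof.
move=> rep rpi hh hp hs f cf.
have hT := hom_Trep rep (groupoid_gbds_rep M rpi) hh hp hs.
have hTl (l : slist) : h (@Tl _ _ _ _ D A p s l) = pi (evl l).
  rewrite (star_hom_sum _ _ hh) (pi_evl M rpi); apply: eq_bigr => q _.
  by rewrite (star_homZ hh) hT (Trep_piS M rpi).
have [n [F [k [a [ha Ef]]]]] := Cc_apr rep M cf.
have -> : integ (p := p) (s := s) M f = \sum_(i < n) a i.
  by apply: (integE rep); rewrite Ef; apply: apr_sum => i; exact: apr1_apr (ha i).
rewrite Ef (pi_sum M rpi) => [|i]; last first.
  by have [sk hf _] := ha i; exact: AF_Cc sk hf.
rewrite (star_hom_sum _ _ hh); apply: eq_bigr => i _.
apply/eqP; rewrite -subr_eq0; apply/eqP/nrm_small => e e0.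
have [sk hf hi] := ha i; have [l [lk fl al]] := hi (e / 2) ltac:(lra).
have h1 : nrm (pi (F i) - pi (evl l)) <= e / 2.
  have -> : pi (F i) - pi (evl l) = pi (fun z => F i z - evl l z).
    have cl : Cc (evl l) by apply: (AF_Cc (slice_le lk sk)); exact: AF_evl.
    have := AF_sub hf lk => hd.
    have cd := AF_Cc sk hd.
    apply/eqP; rewrite subr_eq -(Cc_repD rpi)//; apply/eqP; congr pi.
    by apply/funext => z; rewrite subrK.
  apply: (Cc_bound rpi sk (AF_sub hf lk)) => //; lra.
have h2 : nrm (h (@Tl _ _ _ _ D A p s l) - h (a i)) <= e / 2.
  rewrite -star_homB//; apply: le_trans (star_hom_contr _ hh) _.
  by rewrite nrm_distrC.
rewrite hTl in h2.
by have := nrm_trans (pi (evl l)) (pi (F i)) (h (a i)); lra.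
Qed.

Section Main.
Variable A : cstarAlgType R.
Variables (p : B -> A) (s : L -> B -> A).
Hypothesis rep : gbds_rep D p s.
Hypothesis gen : cstar_generated_by
  (range p `|` [set x | exists a X, ideal D a X /\ x = s a X]).
Hypothesis univ : forall (A' : cstarAlgType R) (q : B -> A') (t : L -> B -> A'),
  gbds_rep D q t -> exists h : A -> A', [/\ is_star_hom h,
    forall X, h (p X) = q X & forall a X, ideal D a X -> h (s a X) = t a X].
Local Notation T := (@Trep _ _ _ _ D A p s).
Local Notation Tl := (@Tl _ _ _ _ D A p s).
Local Notation j := (integ (p := p) (s := s) M).

Lemma proj_Trep X : p X = T (@selt _ _ _ D [::] X [::] I I).
Proof.
rewrite /Trep [sval _]/= /mk_triple; case: eqP => [->|_] /=; first exact: (rep_bot rep).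
by rewrite (projJ rep) (projM rep) meetxx.
Qed.

Lemma iso_Trep a X (h : ideal D a X) : s a X = T (@selt _ _ _ D [:: a] X [::] (idealw1 h) I).
Proof.
rewrite /Trep [RHS](_ : _ = @Traw _ _ _ _ D A p s (mk_triple [:: a] X [::]))//.
have XX : (X <= actw D [::] X)%O by exact: lexx.
rewrite (Traw_mk rep [::] (idealw1 h)) (sW_cons rep h XX) /= (projJ rep).
by rewrite -!cmulA !(projM rep) !meetxx (isoM rep)// meetxx.
Qed.

Lemma Cc_evl (l : slist) : Cc (evl l).
Proof. by apply: Cc_sum => q; exact: CcZ. Qed.

Lemma integ_Tl (l : slist) : j (evl l) = Tl l.
Proof.
apply: (integE rep); apply: apr_sum => q; apply: (@aprZ _ _ _ _ D A p s _ M).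
have E : ind (R := R) M q.2 = evl [:: (1, q.2)].
  by apply/funext => z; rewrite evl_cons evl_nil addr0 mul1r.
have -> : T q.2 = Tl [:: (1, q.2)] by rewrite Tl_cons Tl_nil addr0 scale1r.
rewrite E; apply: (@apr1_apr _ _ _ _ D A p s _ M [:: (1, q.2)]); split.
- by rewrite -E; exact: slice_ind.
- exact: AF_evl.
- by move=> e e0; exists [:: (1, q.2)]; split=> // [z|]; rewrite subrr nrm0 ltW.
Qed.

(** The limits of elements [Tl l] form a closed star-subalgebra containing the generators. *)
Lemma Tl_dense x (e : R) : 0 < e -> exists l : slist, nrm (x - Tl l) <= e.
Proof.
pose X : set A := [set y | forall e : R, 0 < e -> exists l : slist, nrm (y - Tl l) <= e].
have XT l : X (Tl l) by move=> e' e0; exists l; rewrite subrr nrm0 ltW.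
suff EX : X = setT.
  have Xx : X x by rewrite EX.
  exact: Xx.
have XTr u : X (T u).
  have -> : T u = Tl [:: (1, u)] by rewrite Tl_cons Tl_nil addr0 scale1r.
  exact: XT.
apply: gen.
  split.
  - by rewrite -(@Tl_nil _ _ _ _ D A p s); exact: XT.
  - move=> y y' hy hy' e' e0; have [l hl] := hy (e' / 2) ltac:(lra).
    have [l' hl'] := hy' (e' / 2) ltac:(lra); exists (l ++ l').
    rewrite Tl_cat opprD addrACA; apply: le_trans (nrmD _ _) _; lra.
  - move=> k y hy e' e0; have k0 := nrm_ge0 k.
    have [|l hl] := hy (e' / (nrm k + 1)); first by rewrite divr_gt0//; lra.
    exists (lscale k l); rewrite Tl_scale -scalerBr nrmZ.
    have : nrm k * (e' / (nrm k + 1)) <= e' by rewrite mulrA ler_pdivrMr; [nra|lra].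
    by apply: le_trans; rewrite ler_wpM2l.
  - move=> y y' hy hy' e' e0; have y0 := nrm_ge0 y.
    have [|l' hl'] := hy' (e' / 2 / (nrm y + 1)); first by rewrite !divr_gt0//; lra.
    have l0 := nrm_ge0 (Tl l').
    have [|l hl] := hy (e' / 2 / (nrm (Tl l') + 1)); first by rewrite !divr_gt0//; lra.
    exists (lmul l l'); rewrite (Tl_mul rep).
    have -> : cmul y y' - cmul (Tl l) (Tl l') =
        cmul y (y' - Tl l') + cmul (y - Tl l) (Tl l').
      by rewrite cmulBl cmulBr addrA subrK.
    apply: le_trans (nrmD _ _) _.
    have h1 := nrmM y (y' - Tl l'); have h2 := nrmM (y - Tl l) (Tl l').
    rewrite ler_pdivlMr in hl; last by lra.
    rewrite ler_pdivlMr in hl'; last by lra.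
    have := nrm_ge0 (y' - Tl l'); have := nrm_ge0 (y - Tl l); nra.
  - move=> y hy e' e0; have [l hl] := hy e' e0; exists (ladj l).
    by rewrite Tl_adj -cadjB nrm_adj.
  - apply: nrm_closed => y hy e' e0; have [y' hy' yy'] := hy (e' / 2) ltac:(lra).
    have [l hl] := hy' (e' / 2) ltac:(lra); exists l.
    have := nrm_trans y' y (Tl l); lra.
move=> y [[Y _ <-]|[a [Y [iY ->]]]].
  by rewrite proj_Trep; exact: XTr.
by rewrite (iso_Trep iY); exact: XTr.
Qed.

Lemma Cc_rep_factor (A' : cstarAlgType R) (pi : fct -> A') : Cc_rep pi ->
  exists2 h : A -> A', is_star_hom h & forall f, Cc f -> pi f = h (j f).
Proof.
move=> rpi; have [h [hh hp hs]] := univ (groupoid_gbds_rep M rpi).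
by exists h => //; exact: gbds_integ_factor.
Qed.

Lemma le_nrm (V W : normedZmodType R[i]) (v : V) (w : W) : nrm v <= nrm w -> `|v| <= `|w|.
Proof. by rewrite !nrmE lecR. Qed.

(** The supremum is attained at the integrated form itself, as every other representation factors
    through it by a contraction. *)
Lemma integ_lub f : Cc f ->
  isLub [set r | exists (A' : cstarAlgType R) (pi : fct -> A'), Cc_rep pi /\ r = `|pi f|]
    `|j f|.
Proof.
move=> cf; split.
  move=> _ [A' [pi [rpi ->]]]; have [h hh ->] := Cc_rep_factor rpi => //.
  by apply: le_nrm; exact: star_hom_contr.
by move=> b; apply; exists A, j; split=> //; exact: integ_rep.
Qed.

Lemma integ_dense x (e : R) : 0 < e -> exists2 f, Cc f & nrm (x - j f) <= e.
Proof.
move=> e0; have [l hl] := Tl_dense x e0; exists (evl l); first exact: Cc_evl.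
by rewrite integ_Tl.
Qed.

Lemma integ_groupoid_cstar : is_groupoid_cstar G A.
Proof.
exists j; split; [exact: integ_rep| |exact: integ_lub].
apply/dense_nrm => x e e0; have [f cf hf] := integ_dense x e0.
by exists (j f) => //; exists f.
Qed.

Lemma isLub_uniq (S : set R[i]) x y : isLub S x -> isLub S y -> x = y.
Proof.
by move=> [ux lx] [uy ly]; apply/eqP; rewrite eq_le lx ?ly.
Qed.

(** On the image of C_c(G) both norms are least upper bounds of the same set, so h is isometric
    there, and by density on A. An isometry from a complete space with dense range is onto. *)
Lemma gbds_groupoid_iso (A2 : cstarAlgType R) : is_groupoid_cstar G A2 -> cstar_iso A A2.
Proof.
move=> [j2 [r2 d2 l2]]; have [h hh hj] := Cc_rep_factor r2.
have iso1 f : Cc f -> nrm (h (j f)) = nrm (j f).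
  move=> cf; apply: complexI; rewrite -!nrmE -hj//.
  exact: isLub_uniq (l2 f cf) (integ_lub cf).
have iso x : nrm (h x) = nrm x.
  apply/eqP; rewrite eq_le star_hom_contr//=; apply/ler_addgt0Pl => e e0.
  have e2 : 0 < e / 2 by lra.
  have [f cf hf] := integ_dense x e2.
  have h1 := star_hom_contr (x - j f) hh; rewrite star_homB// in h1.
  have h2 := nrm_trans (j f) x 0; have h3 := nrm_trans (h x) (h (j f)) 0.
  rewrite !subr0 (iso1 f cf) in h2 h3; rewrite nrm_distrC in h1; lra.
have inj : injective h.
  move=> x y E; apply/eqP; rewrite -subr_eq0; apply/eqP/nrm_eq0.
  by rewrite -iso star_homB// E subrr nrm0.
have sur y : exists x, h x = y.
  have hx (n : nat) : exists x, nrm (y - h x) <= n.+1%:R^-1.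
    have [|_ [f cf <-] yf] := (dense_nrm _).1 d2 y n.+1%:R^-1; first by rewrite invr_gt0.
    by exists (j f); rewrite -hj.
  have [x hx'] := choice hx.
  have [|a ha] := @cauchy_nrm R A x.
    move=> e e0; have [N hN] := @invn_lt R (e / 2) ltac:(lra).
    exists N => m n Nm Nn; rewrite -iso star_homB//.
    apply: le_trans (nrm_trans y _ _) _; rewrite nrm_distrC.
    have h1 := hx' m; have h2 := hx' n; rewrite nrm_distrC in h1 *.
    have := @le_invn R _ _ Nm; have := @le_invn R _ _ Nn; move: h1 h2.
    rewrite (nrm_distrC (h (x m)) y).
    by move: (m.+1%:R^-1) (n.+1%:R^-1) (N.+1%:R^-1) hN => x1 x2 x3; lra.
  exists a; apply/eqP; rewrite -subr_eq0; apply/eqP/nrm_small => e e0.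
  have [N hN] := ha (e / 2) ltac:(lra); have [N' hN'] := @invn_lt R (e / 2) ltac:(lra).
  have h1 := hN _ (leq_maxl N N'); have h2 := hx' (maxn N N').
  have h3 := @le_invn R _ _ (leq_maxr N N').
  have h4 := star_hom_contr (a - x (maxn N N')) hh; rewrite star_homB// in h4.
  have := nrm_trans (h (x (maxn N N'))) (h a) y.
  rewrite [nrm (h (x _) - y)]nrm_distrC; move: h2 h3 hN'.
  by move: ((maxn _ _).+1%:R^-1) (N'.+1%:R^-1) => x1 x2; lra.
exists h => //; have [g hg] := choice sur.
by exists g => // x; apply: inj; rewrite hg.
Qed.

End Main.

End ModelCStar.

(** The groupoid enters only through [model]. The first statement gives existence of its C*-algebra,
    realized by A itself, and the second its uniqueness. *)
Theorem gbds_cstar_groupoid (R : realType) (d : Order.disp_t) (B : cbDistrLatticeType d)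
    (L : choiceType) (D : gbds B L) (G : groupoid) (M : model D G) (A : cstarAlgType R) :
  is_gbds_cstar D A -> is_groupoid_cstar G A /\
  forall A2 : cstarAlgType R, is_groupoid_cstar G A2 -> cstar_iso A A2.
Proof.
move=> [p [s [rep gen univ]]]; split; first exact: (integ_groupoid_cstar M rep gen univ).
by move=> A2; exact: (gbds_groupoid_iso M rep gen univ).
Qed.

(** * The tight groupoid as a groupoid of germs *)

Section TightModel.
Context {d : Order.disp_t} {B : cbDistrLatticeType d} {L : choiceType}.
Variable D : gbds B L.
Local Notation sgp := (sgp D).
Local Notation pt := (pt D).
Local Notation triple := (@triple d B L).
Implicit Types (s t u e f g : sgp) (x y : pt).

Definition pchar x : triple -> bool := fun a => `[< pt_set x a >].

Lemma pcharE x e : pchar x (sval e) = `[< pmem x e >]. Proof. by []. Qed.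

Lemma pchar_inj : injective pchar.
Proof.
move=> x y E; apply: pt_eq => e _.
by have := congr1 (fun phi => phi (sval e)) E; rewrite !pcharE => h;
  split=> /asboolP; [rewrite h|rewrite -h] => /asboolP.
Qed.

Lemma tight_charP phi : tight_char D phi <-> exists x, phi = pchar x.
Proof.
split=> [[xi txi ->]|[x ->]]; first by exists (Pt txi).
by exists (pt_set x) => //; exact: pt_tight.
Qed.

Lemma germ_dom_pchar s x : germ_dom D (sval s, pchar x) <-> pmem x (dom s).
Proof.
split=> [[_ _]|xs]; first by move/asboolP.
by split; [exact: (svalP s)|apply/tight_charP; exists x|apply/asboolP].
Qed.

Lemma germ_domP tp : germ_dom D tp <-> exists s x, pmem x (dom s) /\ tp = (sval s, pchar x).
Proof.
split=> [tpd|[s [x [xs ->]]]]; last exact/germ_dom_pchar.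
have [] := tpd; case: tp tpd => t phi tpd /= St /tight_charP[x E] _; subst phi.
by exists (exist _ t St), x; split=> //; exact/germ_dom_pchar.
Qed.

Definition tmk s x := germ D (sval s) (pchar x).

Lemma tmkP s x tp : pmem x (dom s) ->
  tmk s x tp <-> exists2 t, pmem x (sd s t) & tp = (sval t, pchar x).
Proof.
move=> xs; split=> [[/germ_domP[t [y [yt ->]]] /= /pchar_inj E [e [ie xe Ee]]]|[t xst ->]].
  subst y; exists t => //; apply: (@mem_sd _ _ _ D s t x (mkE ie)) => //.
    by apply/asboolP.
  exact: sgp_inj.
have [_ xt] := mem_sd_dom xst; split=> //; first exact/germ_dom_pchar.
exists (sval (sd s t)); split; [exact: idem_sd|exact/asboolP|].
by have /(congr1 sval) := sm_sd s t.
Qed.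

Lemma tmk_eq s t x y : pmem x (dom s) -> pmem y (dom t) ->
  tmk s x = tmk t y <-> x = y /\ pmem x (sd s t).
Proof.
move=> xs yt; split=> [E|[E xst]].
  have : tmk s x (sval s, pchar x) by apply/(tmkP _ xs); exists s => //; exact: sd_eqs.
  rewrite E => /(tmkP _ yt)[u ytu [/sgp_inj su /pchar_inj xy]]; subst u y.
  by split=> //; exact: sd_sym.
subst y; apply/seteqP; split=> tp.
  move=> /(tmkP _ xs)[u xsu ->]; apply/(tmkP _ yt); exists u => //.
  exact: sd_trans (sd_sym xst) xsu.
move=> /(tmkP _ yt)[u xtu ->]; apply/(tmkP _ xs); exists u => //.
exact: sd_trans xst xtu.
Qed.

Lemma rho_pchar s x : pmem x (dom s) -> rho D (sval s) (pchar x) = pchar (sact s x).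
Proof.
move=> xs; apply/funext => e; rewrite /rho.
case: asboolP => [ie|nie] /=.
  rewrite -[e in RHS]/(sval (mkE ie)) pcharE.
  rewrite -[smul _ _ _]/(sval (sm (sj s) (sm (mkE ie) s))) pcharE.
  by apply/asbool_equiv_eq; rewrite sactE//; split=> [|[]].
apply/esym/asboolPn => h; apply: nie; have [fx _] := pt_tight (sact s x).
exact: filter_sub fx _ h.
Qed.

Lemma tmk_src s x : pmem x (dom s) -> gsrc (g := Gtight D) (tmk s x) = [set pchar x].
Proof.
move=> xs; apply/seteqP; split=> phi /=.
  by move=> [_ /(tmkP _ xs)[t _ ->] <-].
move=> ->; exists (sval s, pchar x) => //.
by apply/(tmkP _ xs); exists s => //; exact: sd_eqs.
Qed.

Lemma tmk_rng s x : pmem x (dom s) -> grng (g := Gtight D) (tmk s x) = [set pchar (sact s x)].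
Proof.
move=> xs; apply/seteqP; split=> phi /=.
  move=> [_ /(tmkP _ xs)[t xst ->] <-]; rewrite rho_pchar -?(sact_sd xst)//.
  by have [] := mem_sd_dom xst.
move=> ->; exists (sval s, pchar x); last exact: rho_pchar.
by apply/(tmkP _ xs); exists s => //; exact: sd_eqs.
Qed.

(** Products of germs do not depend on representatives: if f and g witness agreement of the left and
    the right factors, g t^* f t witnesses agreement of the products. *)
Lemma sd_mul s s' t t' x : pmem x (sd t t') -> pmem (sact t x) (sd s s') ->
  pmem x (sd (sm s t) (sm s' t')).
Proof.
move=> xt xs; have [xdt _] := mem_sd_dom xt; have [xds _] := mem_sd_dom xs.
set f := sd s s'; set g := sd t t'; pose c := sm (sj t) (sm f t).
have ig : idem g by exact: idem_sd.
have ic : idem c by apply: idem_conj; exact: idem_sd.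
apply: (@mem_sd _ _ _ D _ _ _ (sm g c)); first exact/mem_dom_sm.
  by apply/memM => //; split=> //; have /(sactE _ xdt)[] := xs.
have tc : sm f t = sm t c by apply: sm_e; exact: idem_sd.
rewrite {1}(idemC ig ic) -(smA s) (smA t) -tc -(smA f) (smA s) sm_sd -(smA s').
rewrite (smA f) tc -(smA t) -(idemC ig ic) (smA t) sm_sd.
by rewrite -!smA.
Qed.

Lemma tmk_mul s t x : pmem x (dom t) -> pmem (sact t x) (dom s) ->
  gmul (g := Gtight D) (tmk s (sact t x)) (tmk t x) = tmk (sm s t) x.
Proof.
move=> xt xs; have xst : pmem x (dom (sm s t)) by apply/mem_dom_sm.
apply/seteqP; split=> z /=.
  move=> [a [b [psi [h1 /(tmkP _ xt)[t' xt' [Eb Epsi]] h2]]]]; subst b psi.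
  have [_ xdt'] := mem_sd_dom xt'; move: h1 h2; rewrite rho_pchar// -(sact_sd xt').
  move=> /(tmkP _ xs)[s' xs' [->]].
  have -> : tmk (sm s t) x = tmk (sm s' t') x; last by [].
  have [_ xds'] := mem_sd_dom xs'.
  apply/tmk_eq => //; last by split=> //; exact: sd_mul.
  by apply/mem_dom_sm; rewrite -(sact_sd xt').
move=> h; exists (sval s), (sval t), (pchar x); split=> //.
  by rewrite rho_pchar//; apply/(tmkP _ xs); exists s => //; exact: sd_eqs.
by apply/(tmkP _ xt); exists t => //; exact: sd_eqs.
Qed.

(** If s and t agree on f, their adjoints agree on s f s^*. *)
Lemma sd_inv s t x : pmem x (sd s t) -> pmem (sact s x) (sd (sj s) (sj t)).
Proof.
move=> xst; have [xs xt] := mem_sd_dom xst; set f := sd s t.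
have jf : idem f by exact: idem_sd.
have ds : sm (dom s) f = f by exact: sd_dom.
have dt : sm (dom t) f = f.
  rewrite /f /sd; case: pselect => [_|]; last by rewrite sms0.
  rewrite (idemC (idem_dom s) (idem_dom t)) smA idemxx//; exact: idem_dom.
have stf : sm s f = sm t f by exact: sm_sd.
apply: (@mem_sd _ _ _ D _ _ _ (sm s (sm f (sj s)))); first exact: mem_dom_sj.
  apply/(sactE _ xs); split; first exact: idem_conj'.
  have -> : sm (sj s) (sm (sm s (sm f (sj s))) s) = sm (sm (dom s) f) (dom s).
    by rewrite /dom !smA.
  by rewrite ds; apply/memM => //; exact: idem_dom.
have -> : sm (sj s) (sm s (sm f (sj s))) = sm f (sj s).
  by rewrite (smA (sj s)) -/(dom s) smA ds.
by rewrite (smA s) stf -(smA t) (smA (sj t)) -/(dom t) smA dt.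
Qed.

Lemma tmk_inv s x : pmem x (dom s) -> ginv (g := Gtight D) (tmk s x) = tmk (sj s) (sact s x).
Proof.
move=> xs; apply/seteqP; split=> z /=.
  move=> [a [phi [/(tmkP _ xs)[t xst [-> ->]]]]]; have [_ xt] := mem_sd_dom xst.
  rewrite rho_pchar// -(sact_sd xst).
  have -> : tmk (sj s) (sact s x) = tmk (sj t) (sact s x); last by [].
  apply/tmk_eq; first exact: mem_dom_sj.
    by rewrite (sact_sd xst); exact: mem_dom_sj.
  by split=> //; exact: sd_inv.
move=> h; exists (sval s), (pchar x); split; last by rewrite rho_pchar.
by apply/(tmkP _ xs); exists s => //; exact: sd_eqs.
Qed.

(** The cylinders given by one idempotent in x and finitely many outside form a filter base. It
    converges to the character of x in every coordinate, hence enters O. *)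
Lemma open_pchar x (O : set {ptws triple -> bool}) : open O -> O (pchar x) ->
  exists e (F : seq sgp), [/\ idem e, (forall f, f \in F -> idem f), pmem x e,
    (forall f, f \in F -> ~ pmem x f) &
    forall y, pmem y e -> (forall f, f \in F -> ~ pmem y f) -> O (pchar y)].
Proof.
move=> oO Ox.
pose P (p : sgp * seq sgp) := [/\ idem p.1, (forall f, f \in p.2 -> idem f), pmem x p.1 &
  forall f, f \in p.2 -> ~ pmem x f].
pose C (p : sgp * seq sgp) : set (triple -> bool) :=
  [set phi | exists y, [/\ phi = pchar y, pmem y p.1 & forall f, f \in p.2 -> ~ pmem y f]].
pose FF := filter_from P C.
have FFf : Filter FF.
  apply: filter_from_filter.
    by have [e xe] := mem_ex x; exists (e, [::]); split=> //; exact: mem_idem xe.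
  move=> [e F] [e' F'] [ie iF xe xF] [ie' iF' xe' xF']; exists (sm e e', F ++ F').
    split=> /=.
    - exact: idemM.
    - by move=> f; rewrite mem_cat => /orP[/iF|/iF'].
    - exact/memM.
    - by move=> f; rewrite mem_cat => /orP[/xF|/xF'].
  move=> _ [y [-> /= /(memM y ie ie')[ye ye'] yF]]; split; exists y; split=> // f fF;
    by apply: yF; rewrite mem_cat fF ?orbT.
have : FF --> (pchar x : {ptws triple -> bool}).
  apply/cvg_sup => a U [V [[W oW <-] Wf WU]]; apply: (filterS WU).
  have [e0 xe0] := mem_ex x; have ie0 := mem_idem xe0.
  have [xa|nxa] := pselect (pt_set x a).
    have ia : E_set D a by have [fx _] := pt_tight x; exact: filter_sub fx _ xa.
    exists (mkE ia, [::]); first by split.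
    move=> _ [y [-> ya _]] /=; rewrite (_ : pchar y a = pchar x a)//.
    by apply/asbool_equiv_eq.
  have [ia|nia] := pselect (E_set D a).
    exists (e0, [:: mkE ia]).
      by split=> // f; rewrite inE => /eqP ->.
    move=> _ [y [-> _ ya]] /=; rewrite (_ : pchar y a = pchar x a)//.
    apply/asbool_equiv_eq; split=> // ya'.
    by case: (ya (mkE ia)) => //; rewrite inE.
  (* Coordinates off E are false for every character and impose no condition. *)
  exists (e0, [::]) => //; move=> _ [y [-> _ _]] /=; rewrite (_ : pchar y a = pchar x a)//.
  apply/asbool_equiv_eq; split=> // ya.
  by case: nia; have [fy _] := pt_tight y; exact: filter_sub fy _ ya.
move=> /(_ O (open_nbhs_nbhs (conj oO Ox))) [[e F] [ie iF xe xF] h].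
by exists e, F; split=> // y ye yF; apply: h; exists y.
Qed.

Lemma open_cylinder e (F : seq sgp) : @open {ptws triple -> bool}
  [set phi | phi (sval e) /\ forall f, f \in F -> ~ phi (sval f)].
Proof.
have oev (a : triple) (b : bool) : @open {ptws triple -> bool} [set phi | phi a = b].
  apply: (@open_comp {ptws triple -> bool} bool (fun phi => phi a) [set b]).
    by move=> phi _; exact: (@proj_continuous triple (fun=> bool) a phi).
  exact: discrete_open.
elim: F => [|f F IH].
  rewrite [X in open X](_ : _ = [set phi | phi (sval e) = true]); first exact: oev.
  by apply/seteqP; split=> [phi []|phi].
rewrite [X in open X](_ : _ = [set phi | phi (sval f) = false] `&`
  [set phi | phi (sval e) /\ forall f, f \in F -> ~ phi (sval f)]); first exact: openI.
apply/seteqP; split=> [phi [pe pF]|phi [/= pf [pe pF]]].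
  split; first by apply/negbTE/negP; apply: pF; rewrite inE eqxx.
  by split=> // g gF; apply: pF; rewrite inE gF orbT.
by split=> // g; rewrite inE => /orP[/eqP ->|/pF//]; rewrite pf.
Qed.

Lemma tmk_base Z s x : gbase (g := Gtight D) Z -> pmem x (dom s) -> Z (tmk s x) ->
  exists t F, [/\ pmem x (sd s t), forall f, f \in F -> idem f, incell t F x &
    forall y, incell t F y -> Z (tmk t y)].
Proof.
move=> [s' [O [Ss' oO Od ->]]] xs [phi [Ox /tight_charP[y Ey]] E]; subst phi.
pose u : sgp := exist _ s' Ss'; rewrite -[s']/(sval u) -/(tmk u y) in E *.
have Ou z : O (pchar z) -> pmem z (dom u).
  by move=> Oz; have /asboolP : pchar z (smul D (sadj s') s') by
    apply: Od; split=> //; apply/tight_charP; exists z.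
have yu := Ou y Ox; have [xy yus] := (tmk_eq yu xs).1 E; subst x.
have [e [F [ie iF ye yF hO]]] := open_pchar oO Ox.
have key z : pmem z (dom u) -> pmem z e -> pmem z (sd u (sm u e)).
  by move=> zu ze; apply: (mem_sd zu ze); rewrite -smA idemxx.
exists (sm u e), F; split=> //.
- exact: sd_trans (sd_sym yus) (key y yu ye).
- by split=> //; rewrite domMe//; apply/memM => //; exact: idem_dom.
move=> z [zt zF]; have [zu ze] : pmem z (dom u) /\ pmem z e.
  by move: zt; rewrite domMe// => /(memM z (idem_dom u) ie).
exists (pchar z); first by split; [exact: hO|apply/tight_charP; exists z].
by apply/(tmk_eq zu zt); split=> //; exact: key.
Qed.

Lemma tmk_cell s (F : seq sgp) : gbase (g := Gtight D) [set z | exists2 x, incell s F x & z = tmk s x].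
Proof.
exists (sval s), [set phi | phi (sval (dom s)) /\ forall f, f \in F -> ~ phi (sval f)].
split; [exact: (svalP s)|exact: open_cylinder|by move=> phi [[]]|].
apply/seteqP; split=> z.
  move=> [x [xs xF] ->]; exists (pchar x) => //; split; last by apply/tight_charP; exists x.
  by split=> [|f /xF nf]; [exact/asboolP|move=> /asboolP].
move=> [phi [[ps pF] /tight_charP[x Ex]] <-]; subst phi; exists x => //.
by split=> [|f /pF nf]; [exact/asboolP|move=> xf; apply: nf; apply/asboolP].
Qed.

Lemma tmk_arr z : garr (g := Gtight D) z <-> exists s x, pmem x (dom s) /\ z = tmk s x.
Proof.
split=> [[_ /germ_domP[s [x [xs ->]]] <-]|[s [x [xs ->]]]]; first by exists s, x.
by exists (sval s, pchar x) => //; exact/germ_dom_pchar.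
Qed.

Lemma set1_inj (T : Type) : injective (@set1 T).
Proof. by move=> a b E; have : [set a] a by []; rewrite E. Qed.

Definition tight_model : model D (Gtight D).
Proof.
exists tmk.
- exact: tmk_arr.
- exact: tmk_eq.
- by move=> s t x y xs yt; rewrite !tmk_src//; split=> [h|->//]; apply: pchar_inj; exact: set1_inj h.
- by move=> s t x y xs yt; rewrite !tmk_rng//; split=> [h|->//]; apply: pchar_inj; exact: set1_inj h.
- by move=> s t x y xs yt; rewrite tmk_src// tmk_rng//; split=> [h|->//]; apply: pchar_inj; exact: set1_inj h.
- exact: tmk_mul.
- exact: tmk_inv.
- exact: tmk_base.
- by move=> s F _ _; exact: tmk_cell.
Qed.

End TightModel.

(** * Gamma as a groupoid of germs *)

Section InfiniteWords.
Context {L : choiceType}.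
Implicit Types (u v a b m : seq L) (w : @word L) (n : nat).

Lemma wcat0 w : wcat [::] w = w.
Proof. by case: w => //= f; congr InfWord; apply/funext => n; rewrite nth_nil subn0. Qed.

Lemma wcatA u v w : wcat (u ++ v) w = wcat u (wcat v w).
Proof.
case: w => /= [x|f]; first by rewrite catA.
congr InfWord; apply/funext => n; rewrite nth_cat size_cat subnDA.
by case: ltnP => h; [exact: set_nth_default|rewrite [RHS]nth_default].
Qed.

Lemma wcat_inj u w w' : wcat u w = wcat u w' -> w = w'.
Proof.
case: w w' => [x|f] [y|g] //= [] E; first by congr FinWord; exact: cat_cancel E.
congr InfWord; apply/funext => n; have := congr1 (fun h => h (size u + n)%N) E.
by rewrite addKn !nth_default// leq_addr.
Qed.

Lemma wprefix_cat u w n : wprefix (wcat u w) (size u + n) = u ++ wprefix w n.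
Proof.
case: w => /= [x|f]; first by rewrite take_cat ltnNge leq_addr/= addKn.
rewrite /mkseq iotaD map_cat add0n; congr (_ ++ _).
  case: u => // a u; apply: (@eq_from_nth _ a); first by rewrite size_map size_iota.
  move=> i; rewrite size_map size_iota => hi.
  by rewrite (nth_map 0%N) ?size_iota// nth_iota// add0n; exact: set_nth_default.
have -> : iota (size u) n = [seq (size u + i)%N | i <- iota 0 n] by rewrite -iotaDl addn0.
rewrite -map_comp; apply: eq_map => i /=.
by rewrite nth_default ?leq_addr// addKn.
Qed.

Lemma wprefix_cat0 u w : wprefix (wcat u w) (size u) = u.
Proof.
rewrite -[X in wprefix _ X]addn0 wprefix_cat; case: w => [x|f] /=; last by rewrite cats0.
by rewrite take0 cats0.
Qed.

Lemma le_wlen_cat u w n : le_wlen (size u + n) (wcat u w) = le_wlen n w.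
Proof. by case: w => //= x; rewrite size_cat leq_add2l. Qed.

Lemma le_wlen0 w : le_wlen 0 w. Proof. by case: w. Qed.

Lemma wcat_cmp a b w w' : wcat a w = wcat b w' -> (size a <= size b)%N ->
  exists2 m, b = a ++ m & w = wcat m w'.
Proof.
move=> E ab; have E' := E; rewrite -(cat_take_drop (size a) b) wcatA in E'.
have h : a = take (size a) b.
  have := wprefix_cat0 (take (size a) b) (wcat (drop (size a) b) w').
  by rewrite size_takel// -E' wprefix_cat0.
exists (drop (size a) b); first by rewrite {1}h cat_take_drop.
by rewrite -h in E'; exact: wcat_inj E'.
Qed.

Lemma wsplit w n : le_wlen n w ->
  exists2 w', w = wcat (wprefix w n) w' & size (wprefix w n) = n.
Proof.
case: w => /= [x nx|f _].
  by exists (FinWord (drop n x)); rewrite /= ?cat_take_drop// size_takel.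
exists (InfWord (fun k => f (n + k)%N)); last by rewrite size_mkseq.
rewrite /=; congr InfWord; apply/funext => k; rewrite size_mkseq.
have [kn|nk] := ltnP k n; first by rewrite nth_mkseq.
by rewrite nth_default ?size_mkseq// subnKC.
Qed.

End InfiniteWords.

(** * The word of a tight filter and the shift maps *)

Section FilterWords.
Context {d : Order.disp_t} {B : cbDistrLatticeType d} {L : choiceType}.
Variable D : gbds B L.
Local Notation sgp := (sgp D).
Local Notation pt := (pt D).
Local Notation triple := (@triple d B L).
Local Notation bot := (\bot%O : B).
Local Notation "A /\' C" := (@Order.meet d B A C) (at level 48, left associativity).
Implicit Types (s t e f g : sgp) (x y : pt) (u v a b m : seq L) (w : @word L) (A C F X Y : B).

Definition pin x v A := pt_set x (Some (v, A, v)).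

Lemma pin_E x v A : pin x v A -> A <> bot /\ idealw D v A.
Proof. by have [fx _] := pt_tight x => /(filter_sub fx)[]. Qed.

Lemma pin_mem x e : pmem x e -> exists v A, sval e = Some (v, A, v) /\ pin x v A.
Proof.
rewrite /pmem /pin => xe; have := mem_idem xe; rewrite /idem; move: xe.
case E: (sval e) => [[[v A] v']|]; last by have [fx _] := pt_tight x => /(filter_zero fx).
by move=> xe [vv' _ _]; subst v'; exists v, A.
Qed.

Lemma pin_ex x v A : pin x v A -> exists2 e, pmem x e & sval e = Some (v, A, v).
Proof.
move=> h; have [fx _] := pt_tight x; have ie := filter_sub fx h.
by exists (mkE ie).
Qed.

(** For v and its extension by m, the order of E reads A <= theta_m(Y); the ideal of v must be
    assumed for Y, as it does not follow from that of A. *)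
Lemma pin_up x v m A Y : pin x (v ++ m) A -> idealw D v Y -> (A <= actw D m Y)%O -> pin x v Y.
Proof.
move=> xA iY AY; have [nA iA] := pin_E xA; have [e xe Ee] := pin_ex xA.
have nY : Y <> bot by move=> Y0; apply: nA; apply/eqP; rewrite -lex0 -(actw_bot D m) -Y0.
have xY : E_set D (Some (v, Y, v)) by [].
have : pmem x (mkE xY); last by [].
apply: (mem_up _ xe) => //; apply: sgp_inj; rewrite -[LHS]/(smul D (sval e) (Some (v, Y, v))).
by rewrite Ee smul_r (meet_idPl AY) mk_tripleE.
Qed.

Lemma pin_le x v A Y : pin x v A -> idealw D v Y -> (A <= Y)%O -> pin x v Y.
Proof. by move=> xA iY AY; apply: (@pin_up x v [::] A Y); rewrite ?cats0. Qed.

Lemma pin_mk x e v A : pmem x e -> sval e = mk_triple v A v -> pin x v A.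
Proof.
rewrite /pmem /pin => + E; rewrite E /mk_triple; case: eqP => // _.
by have [fx _] := pt_tight x => /(filter_zero fx).
Qed.

Lemma pin_meet x v m A C : pin x v A -> pin x (v ++ m) C -> pin x (v ++ m) (actw D m A /\' C).
Proof.
move=> /pin_ex[e xe Ee] /pin_ex[f xf Ef].
have ie := mem_idem xe; have jf := mem_idem xf.
have xef : pmem x (sm e f) by apply/memM.
apply: pin_mk xef _; rewrite -[LHS]/(smul D (sval e) (sval f)) Ee Ef; exact: smul_l.
Qed.

Lemma pin_cmp x v v' A A' : pin x v A -> pin x v' A' ->
  (exists m, v' = v ++ m) \/ (exists m, v = v' ++ m).
Proof.
move=> /pin_ex[e xe Ee] /pin_ex[f xf Ef].
have ie := mem_idem xe; have jf := mem_idem xf.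
have xef : pmem x (sm e f) by apply/memM.
case: (word_cmpP v v') => [m ->|m -> _|h1 h2]; [by left; exists m|by right; exists m|].
case: (@mem0 _ _ _ D x); rewrite (_ : s0 D = sm e f)//; apply: sgp_inj.
by rewrite -[RHS]/(smul D (sval e) (sval f)) Ee Ef smul_inc.
Qed.

(** Any element of x lies above one whose word extends the given b, so membership can be tested on
    extensions of b alone. *)
Lemma pin_normal x e b A : pmem x e -> pin x b A -> exists m k c C F,
  [/\ sval e = Some (c, C, c), b ++ m = c ++ k, (F <= actw D k C)%O & pin x (b ++ m) F].
Proof.
move=> /pin_mem[c [C [-> xC]]] xA; have [[k E]|[m E]] := pin_cmp xC xA.
  exists [::], k, c, C, (actw D k C /\' A); split=> //; first by rewrite cats0.
    exact: leIl.
  by rewrite cats0 E; apply: pin_meet => //; rewrite -E.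
exists m, [::], c, C, (actw D m A /\' C); split=> //; first by rewrite cats0.
  exact: leIr.
by apply: pin_meet => //; rewrite -E.
Qed.

(** A description common to finite and infinite words: the words occurring in x are prefixes of w,
    and their lengths exhaust that of w. *)
Lemma filter_wordP x w : filter_word (pt_set x) w <->
  (forall v A, pin x v A -> exists w', w = wcat v w') /\
  (forall n, le_wlen n w -> exists v A, pin x v A /\ (n <= size v)%N).
Proof.
case: w => [u|f] /=; split.
- move=> [[A xA] hu]; split=> [v C xC|n nu]; last by exists u, A.
  have [[m ->]|[m E]] := pin_cmp xC xA; first by exists (FinWord m).
  have := hu v C xC; rewrite E size_cat -{2}[size u]addn0 leq_add2l leqn0 size_eq0 => /eqP ->.
  by exists (FinWord [::]); rewrite /= !cats0.
- move=> [h1 h2]; have [v [A [xA uv]]] := h2 _ (leqnn (size u)).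
  have [[v'|//] [E]] := h1 v A xA.
  have v0 : v' = [::].
    by apply/size0nil; move: uv; rewrite E size_cat -{2}[size v]addn0 leq_add2l leqn0 => /eqP.
  rewrite v0 cats0 in E; subst u; split; first by exists A.
  move=> c C /h1[[c'|//] [->]]; rewrite size_cat; exact: leq_addr.
- move=> [h1 h2]; split=> [v A /h1 E|n _]; last exact: h2.
  have [//|w' E' _] := @wsplit L (InfWord f) (size v).
  by exists w'; rewrite E' /= -E.
- move=> [h1 h2]; split=> [v A /h1[w' E]|n]; last exact: h2.
  by rewrite -{1}(wprefix_cat0 v w') -E.
Qed.

Lemma filter_word_ex x : exists w, filter_word (pt_set x) w.
Proof.
have [[N hN]|nb] := pselect (exists N, forall v A, pin x v A -> (size v <= N)%N).
  have [e /pin_mem[v0 [A0 [_ x0]]]] := mem_ex x.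
  pose P n := `[< exists v A, pin x v A /\ size v = n >].
  have exP : exists n, P n by exists (size v0); apply/asboolP; exists v0, A0.
  have bP n : P n -> (n <= N)%N by move=> /asboolP[v [A [/hN + <-]]].
  have [n /asboolP[u [A [xA un]]] nmax] := ex_maxnP exP bP.
  exists (FinWord u); split; first by exists A.
  by move=> v C xC; rewrite un; apply: nmax; apply/asboolP; exists v, C.
have ub n : exists v, (exists A, pin x v A) /\ (n < size v)%N.
  apply: contrapT => h; apply: nb; exists n => v A xA; rewrite leqNgt; apply/negP => nv.
  by apply: h; exists v; split => //; exists A.
have [l _] : exists l : L, True.
  by have [[|l v] [_]] := ub 0%N => // _; exists l.
have [c hc] := choice ub.
exists (InfWord (fun n => nth l (c n) n)); split.
  move=> v A xA; apply: (@eq_from_nth _ l); first by rewrite size_mkseq.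
  move=> i iv; rewrite nth_mkseq//; have [[C xC] ic] := hc i.
  by have [[m ->]|[m E]] := pin_cmp xA xC; [|rewrite E]; rewrite nth_cat ?iv ?ic.
by move=> n; have [[A xA] nc] := hc n; exists (c n), A; split=> //; exact: ltnW.
Qed.

Lemma filter_word_uniq x w w' :
  filter_word (pt_set x) w -> filter_word (pt_set x) w' -> w = w'.
Proof.
move=> /filter_wordP[h1 h2] /filter_wordP[k1 k2].
have key w1 w2 : (forall n, le_wlen n w1 -> exists v A, pin x v A /\ (n <= size v)%N) ->
    (forall v A, pin x v A -> exists w', w2 = wcat v w') ->
    forall n, le_wlen n w1 -> le_wlen n w2.
  move=> a1 a2 n /a1[v [A [/a2[w3 ->] nv]]].
  by case: w3 => //= z; rewrite size_cat (leq_trans nv)// leq_addr.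
have e1 n : le_wlen n w = le_wlen n w'.
  by apply/idP/idP => h; [apply: key h2 k1 n h|apply: key k2 h1 n h].
have e2 n : le_wlen n w -> wprefix w n = wprefix w' n.
  move=> nw; have [v [A [xA nv]]] := h2 n nw.
  have [w1 E1] := h1 v A xA; have [w2 E2] := k1 v A xA.
  have tk z : wprefix (wcat v z) n = take n v.
    have := wprefix_cat0 (take n v) (wcat (drop n v) z).
    by rewrite -wcatA cat_take_drop size_takel.
  by rewrite E1 E2 !tk.
case: w w' e1 e2 {h1 h2 k1 k2 key} => [u|f] [u'|f'] e1 e2.
- have E : size u = size u'.
    apply/eqP; rewrite eqn_leq -[(_ <= size u')%N]/(le_wlen (size u) (FinWord u')) -e1/=.
    by rewrite leqnn/= -[(_ <= size u)%N]/(le_wlen (size u') (FinWord u)) e1/=.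
  by have := e2 (size u) (leqnn _); rewrite /= take_size E take_size => ->.
- by have := e1 (size u).+1; rewrite /= ltnn.
- by have := e1 (size u').+1; rewrite /= ltnn.
- congr InfWord; apply/funext => n; have := e2 n.+1 erefl.
  rewrite /= /mkseq -addn1 iotaD !map_cat => /eqP; rewrite eqseq_cat ?size_map// => /andP[_].
  by rewrite /= add0n => /eqP[].
Qed.

(** Removes both the exceptional clause for the empty [u] and the indexing of components by
    length. *)
Lemma shiftP x u w (z : triple) :
  filter_word (pt_set x) (wcat u w) -> Defs.shift D u w (pt_set x) z <->
  exists k w' X A, [/\ z = Some (k, X, k), w = wcat k w', idealw D k X, (A <= X)%O & pin x (u ++ k) A].
Proof.
move=> hw; case: u hw => [|l u] hw.
  rewrite wcat0 in hw; split=> [xe|[k [w' [X [A [-> _ iX AX xA]]]]]]; last exact: pin_le xA iX AX.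
  have [fx _] := pt_tight x; have ie := filter_sub fx xe.
  have [k [A [/= E xA]]] := @pin_mem x (mkE ie) xe.
  have /filter_wordP[/(_ k A xA)[w' Ew] _] := hw; have [_ iA] := pin_E xA.
  by exists k, w', A, A.
set u' := l :: u in hw *; rewrite -[Defs.shift _ _ _ _]/(filter_of w _).
split=> [[n [X [nw [iX [A [_ xA] AX]] ->]]]|[k [w' [X [A [-> Ew iX AX xA]]]]]].
  have [w' Ew _] := wsplit nw; rewrite wprefix_cat in xA.
  by exists (wprefix w n), w', X, A.
have Ek : k = wprefix w (size k) by rewrite Ew wprefix_cat0.
exists (size k), X; split; last by rewrite -Ek.
  by rewrite Ew -[size k]addn0 le_wlen_cat le_wlen0.
split; first by rewrite -Ek.
by exists A => //; rewrite /filter_at /= wprefix_cat -Ek; split=> //; have [] := pin_E xA.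
Qed.

End FilterWords.

(** * Shift-equivalent pairs of filters and elements of S *)

Section GammaModel.
Context {d : Order.disp_t} {B : cbDistrLatticeType d} {L : choiceType}.
Variable D : gbds B L.
Local Notation sgp := (sgp D).
Local Notation pt := (pt D).
Local Notation triple := (@triple d B L).
Local Notation bot := (\bot%O : B).
Local Notation "A /\' C" := (@Order.meet d B A C) (at level 48, left associativity).
Implicit Types (s t e f g : sgp) (x y : pt) (u v a b m : seq L) (w : @word L) (A C F X Y : B).

Lemma sgp_S s a A b : sval s = Some (a, A, b) -> [/\ A <> bot, idealw D a A & idealw D b A].
Proof. by move=> E; have := svalP s; rewrite E. Qed.

Lemma sval_sj s a A b : sval s = Some (a, A, b) -> sval (sj s) = Some (b, A, a).
Proof. by rewrite /= => ->. Qed.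

Lemma sval_dom s a A b : sval s = Some (a, A, b) -> sval (dom s) = Some (b, A, b).
Proof.
move=> E; have [nA _ _] := sgp_S E.
rewrite -[LHS]/(smul D (sval (sj s)) (sval s)) (sval_sj E) E smul_diag meetxx.
exact: mk_tripleE.
Qed.

Lemma dom_pin s a A b x : sval s = Some (a, A, b) -> pmem x (dom s) <-> pin x b A.
Proof. by move=> E; rewrite /pmem /pin (sval_dom E). Qed.

Lemma dom_form s x : pmem x (dom s) -> exists a A b, sval s = Some (a, A, b).
Proof.
move=> xs; case E: (sval s) => [[[a A] b]|]; first by exists a, A, b.
case: (@mem0 _ _ _ D x); rewrite (_ : s0 D = dom s)//; apply: sgp_inj.
by rewrite -[RHS]/(smul D (sadj (sval s)) (sval s)) E.
Qed.

Lemma pin_sact s a A b x m F : sval s = Some (a, A, b) -> pmem x (dom s) ->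
  pin (sact s x) (a ++ m) F -> exists2 F', (F' <= F)%O & pin x (b ++ m) F'.
Proof.
move=> E xs /pin_ex[f /(sactE _ xs)[jf xf] Ef].
have [nA _ _] := sgp_S E.
exists (actw D m A /\' (F /\' actw D m A)); first by apply: le_trans (leIr _ _) _; exact: leIl.
apply: pin_mk xf _.
rewrite -[LHS]/(smul D (sval (sj s)) (smul D (sval f) (sval s))) (sval_sj E) E Ef smul_r.
rewrite {1}/mk_triple; case: eqP => [->|_]; first by rewrite smulx0 meetx0 mk_triple0.
exact: smul_l.
Qed.

Lemma sact_pin s a A b x m F : sval s = Some (a, A, b) -> pmem x (dom s) ->
  pin x (b ++ m) F -> exists2 F', (F' <= F)%O & pin (sact s x) (a ++ m) F'.
Proof.
move=> E xs xF; apply: (pin_sact (sval_sj E) (mem_dom_sj xs)).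
by rewrite sactK.
Qed.

Lemma sact_pin0 s a A b x : sval s = Some (a, A, b) -> pmem x (dom s) -> pin (sact s x) a A.
Proof. by move=> E xs; apply/(dom_pin _ (sval_sj E)); exact: mem_dom_sj. Qed.

Lemma word_sact s a A b x : sval s = Some (a, A, b) -> pmem x (dom s) ->
  exists w, filter_word (pt_set x) (wcat b w) /\ filter_word (pt_set (sact s x)) (wcat a w).
Proof.
move=> E xs; have [w0 hw] := filter_word_ex x.
have xb := (dom_pin x E).1 xs; have /filter_wordP[h1 h2] := hw.
have [w Ew] := h1 _ _ xb; subst w0; exists w; split=> //; apply/filter_wordP; split.
  move=> v C /pin_ex[e ye Ee].
  have [m [k [c [C' [F [Ec am _ yF]]]]]] := pin_normal ye (sact_pin0 E xs).
  move: Ec; rewrite Ee => -[vc _ _]; subst c.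
  have [F' _ xF] := pin_sact E xs yF; have [w' Ew] := h1 _ _ xF.
  rewrite wcatA in Ew; have {}Ew := wcat_inj Ew.
  by exists (wcat k w'); rewrite Ew -!wcatA am.
move=> n nw; have [|v [C [xC vn]]] := h2 (size b + (n - size a))%N.
  rewrite le_wlen_cat; have [an|na] := leqP (size a) n.
    by rewrite -(subnKC an) le_wlen_cat in nw.
  by rewrite (eqP (ltnW na)) le_wlen0.
have [m Em] : exists m, v = b ++ m.
  have [[m ->]|[m Em]] := pin_cmp xb xC; first by exists m.
  exists [::]; rewrite cats0; move: vn; rewrite Em size_cat => h.
  have m0 : m = [::] by apply: size0nil; lia.
  by rewrite m0 cats0.
subst v; have [F _ yF] := sact_pin E xs xC; exists (a ++ m), F; split=> //.
by rewrite !size_cat in vn *; lia.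
Qed.

(** The element s transports only words extending u m. If k extends m this is direct; if m = k n,
    the element is first pushed down to u m, transported to v m and lifted back to v k. *)
Lemma shift_sact_sub s u v m A x w : sval s = Some (u ++ m, A, v ++ m) -> pmem x (dom s) ->
  filter_word (pt_set x) (wcat v w) -> filter_word (pt_set (sact s x)) (wcat u w) ->
  Defs.shift D u w (pt_set (sact s x)) `<=` Defs.shift D v w (pt_set x).
Proof.
move=> E xs hx hy z /(shiftP _ hy)[k [w' [X [F [-> Ew iX FX yF]]]]].
apply/(shiftP _ hx); exists k, w', X.
suff [F' F'X xF'] : exists2 F', (F' <= X)%O & pin x (v ++ k) F' by exists F'; split.
have ym := sact_pin0 E xs; have [[n Ek]|[n Em]] := pin_cmp ym yF.
  have [kn Fk] : k = m ++ n /\ pin (sact s x) ((u ++ m) ++ n) F.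
    by split; [apply: (@cat_cancel L u); rewrite catA|rewrite -Ek].
  have [F' F'F xF'] := pin_sact E xs Fk; exists F'; first exact: le_trans FX.
  by rewrite kn catA.
have mn : m = k ++ n by apply: (@cat_cancel L u); rewrite catA.
have : pin (sact s x) ((u ++ m) ++ [::]) (actw D n F /\' A).
  by rewrite cats0 Em; apply: pin_meet => //; rewrite -Em.
move=> /(pin_sact E xs)[F' F'F xF']; rewrite cats0 mn catA in xF'.
have {}F'F : (F' <= actw D n F)%O by apply: le_trans F'F _; exact: leIl.
(* F lies in the ideal of u k but perhaps not in that of v k; meeting it with Y puts it there. For v
   k empty the ideal is all of B. *)
have [Y iY F'Y] : exists2 Y, idealw D (v ++ k) Y & (F' <= actw D n Y)%O.
  have [->|vk] := eqVneq (v ++ k) [::]; first by exists F.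
  by apply: idealw_prefix; [exact/eqP|have [] := pin_E xF'].
exists (Y /\' F); first by apply: le_trans FX; exact: leIr.
apply: pin_up xF' _ _; first exact: idealw_meetl.
by rewrite actw_meet lexI F'Y.
Qed.

Lemma shift_sact s u v m A x w : sval s = Some (u ++ m, A, v ++ m) -> pmem x (dom s) ->
  filter_word (pt_set x) (wcat v w) -> filter_word (pt_set (sact s x)) (wcat u w) ->
  Defs.shift D u w (pt_set (sact s x)) = Defs.shift D v w (pt_set x).
Proof.
move=> E xs hx hy; apply/seteqP; split; first exact: shift_sact_sub E xs hx hy.
have := shift_sact_sub (sval_sj E) (mem_dom_sj xs) hy; rewrite sactK//; exact.
Qed.

Lemma sact_eq s a A b x y : sval s = Some (a, A, b) -> pmem x (dom s) -> pin y a A ->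
  (forall m F, pin y (a ++ m) F -> exists2 F', (F' <= F)%O & pin x (b ++ m) F') ->
  (forall m F, pin x (b ++ m) F -> exists2 F', (F' <= F)%O & pin y (a ++ m) F') ->
  y = sact s x.
Proof.
move=> E xs ya hyx hxy; apply: pt_eq => e ie.
have key (z z' : pt) : pin z a A ->
    (forall m F, pin z (a ++ m) F -> exists2 F', (F' <= F)%O & pin z' (a ++ m) F') ->
    pmem z e -> pmem z' e.
  move=> za h ze; have [m [k [c [C [F [Ec am FC zF]]]]]] := pin_normal ze za.
  have [F' F'F z'F] := h _ _ zF; rewrite am in z'F; rewrite /pmem Ec.
  apply: pin_up z'F _ (le_trans F'F FC).
  by move: ie; rewrite /idem Ec => -[].
split; [apply: key => //|apply: key; first exact: (sact_pin0 E xs)].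
- move=> m F /hyx[F' F'F /(sact_pin E xs)[F'' h]]; exists F'' => //; exact: le_trans F'F.
- move=> m F /(pin_sact E xs)[F' F'F /hxy[F'' h]]; exists F'' => //; exact: le_trans F'F.
Qed.

Lemma pin_shift u v w x y k F : filter_word (pt_set y) (wcat u w) ->
  filter_word (pt_set x) (wcat v w) ->
  Defs.shift D u w (pt_set y) = Defs.shift D v w (pt_set x) ->
  pin y (u ++ k) F -> exists2 F', (F' <= F)%O & pin x (v ++ k) F'.
Proof.
move=> hy hx E yF; have : Defs.shift D u w (pt_set y) (Some (k, F, k)).
  apply/(shiftP _ hy); have /filter_wordP[/(_ _ _ yF)[w' Ew] _] := hy.
  exists k, w', F, F; split=> //; last by have [_ /idealw_suffix] := pin_E yF.
  by rewrite wcatA in Ew; exact: wcat_inj Ew.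
rewrite E => /(shiftP _ hx)[k' [w' [X [F' [[<- <-] _ _ F'F xF]]]]].
by exists F'.
Qed.

Lemma shift_sactE s u v m A x y w : sval s = Some (u ++ m, A, v ++ m) -> pmem x (dom s) ->
  filter_word (pt_set y) (wcat u w) -> filter_word (pt_set x) (wcat v w) ->
  Defs.shift D u w (pt_set y) = Defs.shift D v w (pt_set x) -> y = sact s x.
Proof.
move=> E xs hy hx Eyx; have [nA ia ib] := sgp_S E.
apply: (sact_eq E xs).
- have [F FA yF] := pin_shift hx hy (esym Eyx) ((dom_pin x E).1 xs).
  exact: pin_le yF ia FA.
- by move=> n F; rewrite -!catA; exact: (pin_shift hy hx Eyx).
- by move=> n F; rewrite -!catA; exact: (pin_shift hx hy (esym Eyx)).
Qed.

Lemma shift_ex u v x y w :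
  filter_word (pt_set y) (wcat u w) -> filter_word (pt_set x) (wcat v w) ->
  Defs.shift D u w (pt_set y) = Defs.shift D v w (pt_set x) ->
  exists s m A, [/\ sval s = Some (u ++ m, A, v ++ m), pmem x (dom s) & y = sact s x].
Proof.
move=> hy hx Eyx; have /filter_wordP[h1 h2] := hy.
have [|c [C [yC uc]]] := h2 (size u).
  by rewrite -[size u]addn0 le_wlen_cat le_wlen0.
have [w' Ew] := h1 _ _ yC; have [m Ec Em] := wcat_cmp Ew uc; subst c.
(* Equality of the shifts moves C from the word u m of y to some A <= C at the word v m of x, so A
   lies in both ideals. *)
have [A AC xA] := pin_shift hy hx Eyx yC; have [nA iA] := pin_E xA.
have iA' : idealw D (u ++ m) A by have [_] := pin_E yC; exact: idealw_le.
have hs : S_set D (Some (u ++ m, A, v ++ m)) by [].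
pose s : sgp := exist _ _ hs; have E : sval s = Some (u ++ m, A, v ++ m) by [].
have xs : pmem x (dom s) by apply/(dom_pin x E).
by exists s, m, A; split=> //; exact: shift_sactE E xs hy hx Eyx.
Qed.

Definition deg s : int :=
  if sval s is Some (a, _, b) then (size a)%:Z - (size b)%:Z else 0.

Definition gmk s x := (pt_set (sact s x), deg s, pt_set x).

Lemma degE s a A b : sval s = Some (a, A, b) -> deg s = (size a)%:Z - (size b)%:Z.
Proof. by rewrite /deg => ->. Qed.

Lemma pt_set_inj : injective (@pt_set _ _ _ D).
Proof. by move=> x y E; apply: pt_eq => e _; rewrite /pmem E. Qed.

Lemma deg_sj s : deg (sj s) = - deg s.
Proof. by rewrite /deg /=; case: (sval s) => [[[a A] b]|] /=; rewrite ?oppr0// opprB. Qed.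

Lemma deg_sm s t : sm s t <> s0 D -> deg (sm s t) = deg s + deg t.
Proof.
move=> n0; have {}n0 : smul D (sval s) (sval t) <> None.
  by move=> h; apply: n0; exact: sgp_inj.
rewrite {1}/deg -[sval (sm _ _)]/(smul D (sval s) (sval t)) /deg; move: n0.
case: (sval s) => [[[a A] b]|] //; case: (sval t) => [[[c C] e]|] //.
case: (word_cmpP b c) => [m ->|m -> _|h1 h2]; rewrite ?smul_l ?smul_r ?smul_inc//.
  by rewrite /mk_triple; case: eqP => // _ _; rewrite !size_cat !PoszD; lia.
by rewrite /mk_triple; case: eqP => // _ _; rewrite !size_cat !PoszD; lia.
Qed.

Lemma deg_idem e : idem e -> deg e = 0.
Proof. by rewrite /idem /deg; case: (sval e) => [[[a A] b]|] //= [-> _ _]; rewrite subrr. Qed.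

Lemma mem_n0 x e : pmem x e -> e <> s0 D.
Proof. by move=> xe E; case: (@mem0 _ _ _ D x); rewrite -E. Qed.

Lemma mem_dom_n0 s x : pmem x (dom s) -> s <> s0 D.
Proof. by move=> /mem_n0 h E; apply: h; rewrite E /dom sms0. Qed.

Lemma deg_sd s t x : pmem x (sd s t) -> deg s = deg t.
Proof.
move=> xst; have [xs _] := mem_sd_dom xst.
have h r : sm r (sd s t) = sm s (sd s t) -> deg r = deg (sm s (sd s t)).
  move=> Er; have : sm r (sd s t) <> s0 D.
    rewrite Er; apply: (@mem_dom_n0 _ x); rewrite domMe; last exact: idem_sd.
    by rewrite sd_dom.
  by move=> /deg_sm; rewrite Er (deg_idem (idem_sd s t)) addr0 => <-.
by rewrite (h s)// (h t)// sm_sd.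
Qed.

Lemma gmk_sd s t x : pmem x (sd s t) -> gmk s x = gmk t x.
Proof. by move=> h; rewrite /gmk (sact_sd h) (deg_sd h). Qed.

(* Two arrows with the same range, degree and source have comparable second
   words, and then the first words differ by the same suffix. *)
Lemma sd_gmk s t x : pmem x (dom s) -> pmem x (dom t) -> deg s = deg t ->
  sact s x = sact t x -> pmem x (sd s t).
Proof.
(* The second words both occur in x, hence are comparable; by symmetry that of s extends that of
   t. *)
wlog [c [m [A [b [C [Es Et]]]]]] : s t / exists c m A b C,
    sval s = Some (c, A, b ++ m) /\ exists a, sval t = Some (a, C, b).
  move=> H xs xt Ed Ey.
  have [a [A [b Es]]] := dom_form xs; have [c [C [b' Et]]] := dom_form xt.
  have [[m Em]|[m Em]] := pin_cmp ((dom_pin x Es).1 xs) ((dom_pin x Et).1 xt).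
    apply/sd_sym/H => //; exists c, m, C, b, A; split; first by rewrite -Em.
    by exists a.
  by apply: H => //; exists a, m, A, b', C; split; [rewrite -Em|exists c].
have {Et}[c' Et] := Et; move=> xs xt Ed Ey.
have [w [hx hy]] := word_sact Es xs; have [w' [hx' hy']] := word_sact Et xt.
have := filter_word_uniq hx hx'; rewrite wcatA => /wcat_inj Ew; subst w'.
have := filter_word_uniq hy (_ : filter_word _ (wcat c' (wcat m w))).
rewrite Ey => /(_ hy'); rewrite -wcatA => Ec.
have sc : size c = size (c' ++ m).
  by move: Ed; rewrite (degE Es) (degE Et) !size_cat !PoszD; lia.
have {}Ec : c = c' ++ m by rewrite -(wprefix_cat0 c w) Ec sc wprefix_cat0.
subst c; apply: (@mem_sd _ _ _ D s t x (sm (dom s) (dom t))) => //.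
  by apply/memM => //; exact: idem_dom.
have dst : sm s (dom t) = sm t (dom s).
  apply: sgp_inj; rewrite -[LHS]/(smul D (sval s) (sval (dom t))).
  rewrite -[RHS]/(smul D (sval t) (sval (dom s))) (sval_dom Es) (sval_dom Et) Es Et.
  by rewrite smul_r smul_l meetC.
rewrite {2}(idemC (idem_dom s) (idem_dom t)).
by rewrite (smA s) (smA t) !sm_dom.
Qed.

Lemma gmk_eq s t x y : pmem x (dom s) -> pmem y (dom t) ->
  gmk s x = gmk t y <-> x = y /\ pmem x (sd s t).
Proof.
move=> xs yt; split=> [[Er Ed /pt_set_inj E]|[<-]]; last exact: gmk_sd.
by subst y; split=> //; apply: sd_gmk => //; exact: pt_set_inj.
Qed.

Lemma gmk_arr_shift s u v m A x : sval s = Some (u ++ m, A, v ++ m) -> pmem x (dom s) ->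
  exists w, [/\ filter_word (pt_set x) (wcat v w), filter_word (pt_set (sact s x)) (wcat u w),
    Defs.shift D u w (pt_set (sact s x)) = Defs.shift D v w (pt_set x) &
    gmk s x = (pt_set (sact s x), (size u)%:Z - (size v)%:Z, pt_set x)].
Proof.
move=> E xs; have [w0 [hx hy]] := word_sact E xs; rewrite !wcatA in hx hy.
exists (wcat m w0); split=> //; first exact: shift_sact E xs hx hy.
by rewrite /gmk (degE E) !size_cat !PoszD; congr (_, _, _); lia.
Qed.

Lemma gmk_arr z : garr (g := Gamma D) z <-> exists s x, pmem x (dom s) /\ z = gmk s x.
Proof.
split=> [[eta [xi [u [v [w [ty hy tx hx [E ->]]]]]]]|[s [x [xs ->]]]].
  have [s [m [A [Es xs Ey]]]] := @shift_ex u v (Pt tx) (Pt ty) w hy hx E.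
  exists s, (Pt tx); split=> //; have [w' [_ _ _ ->]] := gmk_arr_shift Es xs.
  by rewrite -Ey.
have [a [A [b E]]] := dom_form xs.
have [|w [hx hy Eyx ->]] := @gmk_arr_shift s a b [::] A x _ xs; first by rewrite !cats0.
by exists (pt_set (sact s x)), (pt_set x), a, b, w; split=> //; exact: pt_tight.
Qed.

Lemma seq_sval (es : seq triple) : (forall z, z \in es -> E_set D z) ->
  exists2 F : seq sgp, (forall f, f \in F -> idem f) & [seq sval f | f : sgp <- F] = es.
Proof.
elim: es => [|f es IH] h; first by exists [::].
have [|F iF EF] := IH; first by move=> g ge; apply: h; rewrite inE ge orbT.
have jf : E_set D f by apply: h; rewrite inE eqxx.
exists (mkE jf :: F); last by rewrite /= EF.
by move=> g; rewrite inE => /orP[/eqP ->|/iF].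
Qed.

Lemma gmk_base Z s x : gbase (g := Gamma D) Z -> pmem x (dom s) -> Z (gmk s x) ->
  exists t (F : seq sgp), [/\ pmem x (sd s t), forall f, f \in F -> idem f, incell t F x &
    forall y, incell t F y -> Z (gmk t y)].
Proof.
move=> [u [v [A [e0 [es [hS he hes ->]]]]]] xs [eta [xi [w [Ez _ hy hx [[_ xe xes] Eyx]]]]].
move: Ez => -[Ey Ed Ex]; subst eta xi.
have [s' [m [A' [Es' xs' Ey]]]] := shift_ex hy hx Eyx.
have xss : pmem x (sd s s').
  apply: sd_gmk => //; rewrite Ed (degE Es') !size_cat !PoszD; lia.
have [F iF EF] := seq_sval hes; pose e := mkE he; have ie : idem e by [].
have key y : pmem y (dom s') -> pmem y e -> pmem y (sd s' (sm s' e)).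
  by move=> ys ye; apply: (mem_sd ys ye); rewrite -smA idemxx.
have cellP y : incell (sm s' e) F y <->
    [/\ pmem y (dom s'), pmem y e & forall f, f \in F -> ~ pmem y f].
  rewrite /incell domMe//; split=> [[/(memM y (idem_dom s') ie)[]]//|[ys ye yF]].
  by split=> //; apply/(memM y (idem_dom s') ie).
exists (sm s' e), F; split=> //.
- exact: sd_trans xss (key x xs' xe).
- apply/cellP; split=> // f fF xf; apply: (xes (sval f)) => //.
  by rewrite -EF; apply/mapP; exists f.
move=> y /cellP[ys ye yF]; rewrite -(gmk_sd (key y ys ye)).
have [w' [hx' hy' E' ->]] := gmk_arr_shift Es' ys.
exists (pt_set (sact s' y)), (pt_set y), w'; split=> //.
  exists (pt_set (sact s' y)), (pt_set y), u, v, w'; split=> //; exact: pt_tight.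
split=> //; split=> //; first exact: pt_tight.
by move=> f; rewrite -EF => /mapP[g gF ->]; exact: yF.
Qed.

Lemma gmk_cell s (F : seq sgp) : s <> s0 D -> (forall f, f \in F -> idem f) ->
  gbase (g := Gamma D) [set z | exists2 x, incell s F x & z = gmk s x].
Proof.
move=> n0 iF; have [a [A [b E]]] : exists a A b, sval s = Some (a, A, b).
  case E: (sval s) => [[[a A] b]|]; first by exists a, A, b.
  by case: n0; exact: sgp_inj.
have E0 : sval s = Some (a ++ [::], A, b ++ [::]) by rewrite !cats0.
have [nA ia ib] := sgp_S E.
exists a, b, A, (Some (b, A, b)), [seq sval f | f : sgp <- F]; split=> //.
  by move=> _ /mapP[f fF ->]; exact: iF.
apply/seteqP; split=> z.
  move=> [x [xs xF] ->]; have [w [hx hy Eyx ->]] := gmk_arr_shift E0 xs.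
  exists (pt_set (sact s x)), (pt_set x), w; split=> //.
    by exists (pt_set (sact s x)), (pt_set x), a, b, w; split=> //; exact: pt_tight.
  split=> //; split; [exact: pt_tight|exact/(dom_pin x E)|].
  by move=> _ /mapP[f fF ->]; exact: xF.
move=> [eta [xi [w [-> arr hy hx [[_ xe xF] Eyx]]]]].
move: arr => [eta' [xi' [u' [v' [w' [ty _ tx _ [_ Ez]]]]]]].
case: Ez => E1 _ E2; subst eta' xi'.
have xs : pmem (Pt tx) (dom s) by apply/(dom_pin _ E).
have Ey := @shift_sactE s a b [::] A (Pt tx) (Pt ty) w E0 xs hy hx Eyx.
exists (Pt tx); last by rewrite /gmk -Ey (degE E).
by split=> // f fF; apply: (xF (sval f)); apply/mapP; exists f.
Qed.

Definition gamma_model : model D (Gamma D).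
Proof.
exists gmk.
- exact: gmk_arr.
- exact: gmk_eq.
- by move=> s t x y _ _; split=> [h|->//]; exact: pt_set_inj.
- by move=> s t x y _ _; split=> [h|/= ->//]; exact: pt_set_inj.
- by move=> s t x y _ _; split=> [h|/= ->//]; exact: pt_set_inj.
(* Degrees add only for non-zero products; x in the domain of the product guarantees this. *)
- move=> s t x xt xs; have xst : pmem x (dom (sm s t)) by apply/mem_dom_sm.
  by rewrite /gmk /= sact_sm// deg_sm//; exact: mem_dom_n0 xst.
- by move=> s x xs; rewrite /gmk /= sactK// deg_sj.
- exact: gmk_base.
- exact: gmk_cell.
Qed.

End GammaModel.

(** * Isomorphism as an equivalence relation, and the conclusion *)

Lemma cstar_iso_sym (R : realType) (A A' : cstarAlgType R) : cstar_iso A A' -> cstar_iso A' A.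
Proof.
move=> [h hh [g gK hK]]; exists g; last by exists h.
split.
- by move=> x y; apply: (can_inj gK); rewrite (star_homD hh) !hK.
- by move=> k x; apply: (can_inj gK); rewrite (star_homZ hh) !hK.
- by move=> x y; apply: (can_inj gK); rewrite (star_homM hh) !hK.
- by move=> x; apply: (can_inj gK); rewrite (star_homV hh) !hK.
Qed.

Lemma cstar_iso_trans (R : realType) (A A' A'' : cstarAlgType R) :
  cstar_iso A A' -> cstar_iso A' A'' -> cstar_iso A A''.
Proof.
move=> [h hh bh] [g gh bg]; exists (g \o h); last exact: bij_comp.
split=> [x y|k x|x y|x] /=.
- by rewrite (star_homD hh) (star_homD gh).
- by rewrite (star_homZ hh) (star_homZ gh).
- by rewrite (star_homM hh) (star_homM gh).
- by rewrite (star_homV hh) (star_homV gh).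
Qed.

Theorem theorem6p4 (R : realType) (d : Order.disp_t)
    (B : cbDistrLatticeType d) (L : choiceType) (D : gbds B L) :
  [/\ exists A : cstarAlgType R, is_gbds_cstar D A,
      exists A : cstarAlgType R, is_groupoid_cstar (Gamma D) A,
      exists A : cstarAlgType R, is_groupoid_cstar (Gtight D) A
    & forall A1 A2 A3 : cstarAlgType R,
        is_gbds_cstar D A1 ->
        is_groupoid_cstar (Gamma D) A2 ->
        is_groupoid_cstar (Gtight D) A3 ->
        cstar_iso A1 A2 /\ cstar_iso A2 A3].
Proof.
have [A hA] := @gbds_cstar_exists R d B L D.
have mG (A' : cstarAlgType R) := @gbds_cstar_groupoid R _ _ _ _ _ (gamma_model D) A'.
have mT (A' : cstarAlgType R) := @gbds_cstar_groupoid R _ _ _ _ _ (tight_model D) A'.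
split; [by exists A|by exists A; have [] := mG A hA|by exists A; have [] := mT A hA|].
move=> A1 A2 A3 h1 h2 h3; have [_ /(_ _ h2) i12] := mG A1 h1.
by have [_ /(_ _ h3) i13] := mT A1 h1; split=> //; exact: cstar_iso_trans (cstar_iso_sym i12) i13.
Qed.
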